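(* Let $Y$ be an infinitely divisible real-valued random variable, let $(Y_t)_{t\ge0}$ be the corresponding Lévy process (so $Y_1$ has the law of $Y$) with characteristics $(b,\sigma,\nu)$, and let $(Y'_t)_{t\ge0}$ and $(Y''_t)_{t\ge0}$ be copies of $(Y_t)_{t\ge 0}$, the three processes being independent. Let $G:\mathbb{R}\to\mathbb{R}$ be a smooth function such that $\mathbb{E}\left(G^{(k)}(Y)\right)^2<+\infty$ for all $k\ge0$. For $m\ge1$ and $n=2^m+1$, let $(B_k)_{1\le k\le n}$ be the sequence associated (see context) with $S_n=G(X_{1,n}+\dots+X_{n,n})$. Let $\alpha\in(0,1)$. Then $$2^mB_{\lfloor\alpha2^m\rfloor+1}\xrightarrow[m\to\infty]{}\mathbb{E}\left(\sigma\,G'(Y_\alpha+Y''_{1-\alpha})G'(Y'_\alpha+Y''_{1-\alpha})+\int_{\mathbb{R}}\Delta_uG(Y_\alpha+Y''_{1-\alpha})\,\Delta_uG(Y'_\alpha+Y''_{1-\alpha})\,\mathrm{d}\nu(u)\right),$$ where $\Delta_uG(x)=G(x+u)-G(x)$.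
   Context: $(b,\sigma,\nu)$ comes from the Lévy–Khintchine representation: $\nu$ is the Lévy measure and $\sigma$ is the Gaussian (variance) coefficient, i.e. the Gaussian part contributes $-\sigma s^2/2$ to the characteristic exponent of $Y$ at $s$ (equivalently $\frac\sigma2f''$ to the infinitesimal generator). For $n\ge1$ and $1\le\ell\le n$, $X_{\ell,n}=Y_{\ell/n}-Y_{(\ell-1)/n}$ and $X'_{\ell,n}=Y'_{\ell/n}-Y'_{(\ell-1)/n}$. The sequence $(B_k)$ associated with $S_n$, viewed as a function $S$ of the $n$ independent variables $X_{1,n},\dots,X_{n,n}$, is $$B_k:=\mathbb{E}\,\frac1{n!}\sum_{i\in\mathfrak{S}_n}S\,(S^{i_1,\dots,i_{k-1}}-S^{i_1,\dots,i_k}),\qquad1\le k\le n,$$ where $\mathfrak{S}_n$ is the symmetric group, $i_j=i(j)$, and $S^{i_1,\dots,i_j}$ is $S$ with $X_{\ell,n}$ replaced by $X'_{\ell,n}$ for each $\ell\in\{i_1,\dots,i_j\}$ (no replacement for an empty list).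
   Formalization: The expectation in the limit can be undefined for some G allowed by the hypotheses; convergence to it is stated when the random variable inside is integrable, and in all cases convergence is proved to the finite value with the expectation taken inside the integral over ν. *)

(* Defs.v *)
From mathcomp Require Export all_boot all_order all_algebra all_fingroup.
From mathcomp Require Export all_classical all_reals all_analysis.

Set Implicit Arguments.
Unset Strict Implicit.
Unset Printing Implicit Defensive.

Import Order.TTheory GRing.Theory Num.Theory.
Import numFieldNormedType.Exports.

Local Open Scope classical_set_scope.
Local Open Scope ring_scope.
Local Open Scope ereal_scope.

Definition same_law (R : realType) (d d' : measure_display)
    (T : measurableType d) (T' : measurableType d')
    (P : probability T R) (P' : probability T' R)
    (X : T -> R) (X' : T' -> R) : Prop :=
  forall A : set R, measurable A -> P (X @^-1` A) = P' (X' @^-1` A).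

(* The product rule for a subfamily is the case where the remaining sets
   are the whole line. *)
Definition mutually_independent (R : realType) (d : measure_display)
    (T : measurableType d) (P : probability T R) (n : nat)
    (X : 'I_n -> T -> R) : Prop :=
  forall A : 'I_n -> set R, (forall i, measurable (A i)) ->
    P (\bigcap_i (X i @^-1` A i)) = \prod_(i < n) P (X i @^-1` A i).

Definition infinitely_divisible (R : realType) (d : measure_display)
    (T : measurableType d) (P : probability T R) (X : T -> R) : Prop :=
  forall n : nat, (0 < n)%N ->
  exists (d' : measure_display) (T' : measurableType d')
         (P' : probability T' R) (Z : 'I_n -> {RV P' >-> R}),
    [/\ mutually_independent P' (fun i => Z i : T' -> R),
        forall i j, same_law P' P' (Z i) (Z j)
      & same_law P P' X (fun w => \sum_(i < n) Z i w)%R].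

(* Processes are indexed by all of R, but only times t >= 0 are ever used:
   the values at negative times are junk. *)

Definition cadlag (R : realType) (f : R -> R) : Prop :=
  (forall t : R, (0 <= t)%R -> f x @[x --> t^'+] --> f t) /\
  (forall t : R, (0 < t)%R -> cvg (f x @[x --> t^'-])).

Definition levy_process (R : realType) (d : measure_display)
    (T : measurableType d) (P : probability T R) (Y : R -> {RV P >-> R}) : Prop :=
  [/\ {ae P, forall w, Y 0%R w = 0%R},
      forall (n : nat) (t : nat -> R), (0 <= t 0%N)%R ->
        (forall i, t i <= t i.+1)%R ->
        mutually_independent P
          (fun (i : 'I_n) (w : T) => (Y (t i.+1) w - Y (t i) w)%R),
      forall s t : R, (0 <= s)%R -> (0 <= t)%R ->
        same_law P P (fun w => Y (s + t)%R w - Y s w)%R (Y t)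
    & {ae P, forall w, cadlag (fun t => Y t w)}].

Definition levy_measure (R : realType) (nu : {measure set R -> \bar R}) : Prop :=
  nu [set 0%R] = 0 /\
  \int[nu]_u (Num.min 1%R (u ^+ 2)%R)%:E < +oo.

(* Real and imaginary parts of the characteristic exponent
     psi s = i b s - sigma s^2 / 2
             + \int (exp (i s u) - 1 - i s u 1_{|u| <= 1}) d nu(u). *)
Definition levy_exponent_re (R : realType) (sigma : R)
    (nu : {measure set R -> \bar R}) (s : R) : R :=
  (- (sigma * s ^+ 2 / 2) + \int[nu]_u (cos (s * u) - 1))%R.

Definition levy_exponent_im (R : realType) (b : R)
    (nu : {measure set R -> \bar R}) (s : R) : R :=
  (b * s + \int[nu]_u (sin (s * u) - (if `|u| <= 1 then s * u else 0)))%R.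

(* E exp (i s X) = exp (psi s), split into real and imaginary parts. *)
Definition levy_khintchine (R : realType) (d : measure_display)
    (T : measurableType d) (P : probability T R) (X : T -> R)
    (b sigma : R) (nu : {measure set R -> \bar R}) : Prop :=
  [/\ (0 <= sigma)%R, levy_measure nu &
      forall s : R,
        'E_P[fun w => cos (s * X w)] =
          (expR (levy_exponent_re sigma nu s) *
           cos (levy_exponent_im b nu s))%R%:E /\
        'E_P[fun w => sin (s * X w)] =
          (expR (levy_exponent_re sigma nu s) *
           sin (levy_exponent_im b nu s))%R%:E].

(* The characteristics of a Levy process are those of its value at time 1. *)
Definition has_characteristics (R : realType) (d : measure_display)
    (T : measurableType d) (P : probability T R) (Y : R -> {RV P >-> R})
    (b sigma : R) (nu : {measure set R -> \bar R}) : Prop :=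
  levy_khintchine P (Y 1%R) b sigma nu.

(* Equality of all finite-dimensional laws. *)
Definition process_copy (R : realType) (d : measure_display)
    (T : measurableType d) (P : probability T R)
    (Y Y' : R -> {RV P >-> R}) : Prop :=
  forall (n : nat) (t : 'I_n -> R) (A : 'I_n -> set R),
    (forall i, (0 <= t i)%R) -> (forall i, measurable (A i)) ->
    P (\bigcap_i (Y (t i) @^-1` A i)) = P (\bigcap_i (Y' (t i) @^-1` A i)).

Definition process_sigma_algebra (R : realType) (d : measure_display)
    (T : measurableType d) (P : probability T R) (Y : R -> {RV P >-> R}) :
    set (set T) :=
  <<s [set E : set T | exists (t : R) (A : set R),
        [/\ (0 <= t)%R, measurable A & E = Y t @^-1` A] ]>>.

Definition independent_processes3 (R : realType) (d : measure_display)
    (T : measurableType d) (P : probability T R)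
    (Y Y' Y'' : R -> {RV P >-> R}) : Prop :=
  forall E E' E'' : set T,
    process_sigma_algebra Y E -> process_sigma_algebra Y' E' ->
    process_sigma_algebra Y'' E'' ->
    P (E `&` E' `&` E'') = P E * P E' * P E''.

Definition smooth (R : realType) (G : R -> R) : Prop :=
  forall (k : nat) (x : R), derivable (derive1n k G) x 1%R.

(* x with x l replaced by x' l for l among the first j values i 0, ..., i (j-1)
   of the permutation i; coordinates are numbered from 0. *)
Definition replaced (V : Type) (n : nat) (i : 'S_n) (j : nat)
    (x x' : 'I_n -> V) : 'I_n -> V :=
  fun l => if l \in [set i a | a : 'I_n & (a < j)%N]%SET then x' l else x l.

Definition Bseq (R : realType) (d : measure_display)
    (T : measurableType d) (P : probability T R) (n : nat)
    (S : ('I_n -> R) -> R) (X X' : T -> 'I_n -> R) (k : nat) : \bar R :=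
  'E_P[fun w => ((n`!)%:R^-1 * \sum_(i : 'S_n)
     S (X w) * (S (replaced i k.-1 (X w) (X' w)) -
                S (replaced i k (X w) (X' w))))%R].

Definition increments (R : realType) (d : measure_display)
    (T : measurableType d) (P : probability T R) (Y : R -> {RV P >-> R})
    (n : nat) (w : T) : 'I_n -> R :=
  fun l => (Y (l.+1%:R / n%:R) w - Y (l%:R / n%:R) w)%R.

Arguments increments {R d T P} Y n w.

Definition Delta (R : realType) (u : R) (G : R -> R) (x : R) : R :=
  (G (x + u) - G x)%R.

(* Main.v *)
(* Write mu_t for the law of Y_t and P_t F (c) = E F (Y_t + c). By exchangeability
   of the increments, E S S^{i_1..i_j} = phi (j / n) with
   phi t = E (P_t G (Y_{1-t}))^2, so B_k is phi ((k-1)/n) - phi (k/n), which is a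
   squared L2 norm V. When G is a trigonometric polynomial, phi is explicit by
   the Levy-Khintchine formula and 2^m V tends to - phi' alpha, which is the
   asserted limit L (G). In general, V decreases in k (Jensen) and telescopes, so
   2^m V, and hence L, is at most alpha^-1 E G(Y)^2. As both are squared
   seminorms, convergence passes to L2(Y) limits: first to bounded C^1 functions
   with bounded derivative, then, by cutoffs, to G.

   Exchanging E with the integral over nu is Fubini for the jumps larger than 1.
   For the small ones the kernel K (x, y) = \int_{|u| <= 1} Delta_u G (x) Delta_u G (y) d nu
   is not known to be integrable; if it is, its truncations 1_{|x|,|y| <= N} K are
   squared norms of an L2-Cauchy sequence, which identifies E K. *)
From HB Require Import structures.
Require Import Defs.
From mathcomp Require Import measurable_realfun.
From mathcomp Require Import ring lra.

Import Order.TTheory GRing.Theory Num.Theory.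
Import numFieldNormedType.Exports.

Local Open Scope classical_set_scope.
Local Open Scope ring_scope.
Local Open Scope ereal_scope.

Set Implicit Arguments.
Unset Strict Implicit.
Unset Printing Implicit Defensive.

(** * Laws of the increments *)

(** The form L contains G' and [Delta u G], over which E G(Y)^2 has no direct control. What replaces
    such control is that the approximating classes are stable under differences: the bound on L,
    applied to differences of approximants, makes their Gaussian and jump parts Cauchy in L2, and
    almost everywhere convergence with Fatou's lemma identifies the limits. The jump part needs the
    shifted averages P_alpha |G| (c + u) to be finite for almost every (u, c); this is extracted
    from the bound on the jump part itself, applied to truncations of a C^1 majorant of |G|. The
    Levy-Khintchine formula is assumed at time 1, whereas phi involves all times in [0, 1]:
    continuous square roots give it at dyadic times, right continuity of the paths at the others.
    The passage to bounded C^1 functions requires trigonometric polynomials that converge boundedly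
    and pointwise together with their derivatives; antiderivatives of Bernstein polynomials,
    evaluated at sin (x / t), provide them. *)

Lemma tuple_measurableE d (T : measurableType d) (N : nat) :
  (measurable : set (set (N.-tuple T))) =
  <<s [set E | exists A : 'I_N -> set T, (forall i, measurable (A i)) /\
         E = [set t : N.-tuple T | forall i, A i (tnth t i)]] >>.
Proof.
apply/seteqP; split.
- apply: smallest_sub; first exact: smallest_sigma_algebra.
  move=> E; rewrite -bigcup_seq/= => -[i _ [A mA <-]].
  apply: sub_sigma_algebra => /=.
  exists (fun j => if j == i then A else setT); split.
    by move=> j; case: ifP.
  apply/seteqP; split => t /=.
    by move=> [_ At] j; case: ifPn => // /eqP ->.
  by move=> /(_ i); rewrite eqxx.
- apply: smallest_sub; first exact: sigma_algebra_measurable.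
  move=> _ [A [mA ->]].
  rewrite (_ : [set _ | _] = \bigcap_i ((@tnth _ T ^~ i) @^-1` A i)).
    apply: fin_bigcap_measurable => [|i _]; [exact: finite_finset|].
    rewrite -[X in measurable X]setTI.
    exact: measurable_tnth.
  by apply/seteqP; split => t /= h i; [move=> _; exact: h|exact: (h i)].
Qed.

Lemma tuple_law (R : realType) d d' (T : measurableType d) (T' : measurableType d')
    (P : probability T R) (P' : probability T' R) (N : nat)
    (v : 'I_N -> T -> R) (v' : 'I_N -> T' -> R) :
  (forall i, measurable_fun setT (v i)) -> (forall i, measurable_fun setT (v' i)) ->
  (forall A : 'I_N -> set R, (forall i, measurable (A i)) ->
    P (\bigcap_i (v i @^-1` A i)) = P' (\bigcap_i (v' i @^-1` A i))) ->
  forall E : set (N.-tuple R), measurable E ->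
    P ((fun w => [tuple v i w | i < N]) @^-1` E) =
    P' ((fun w => [tuple v' i w | i < N]) @^-1` E).
Proof.
move=> mv mv' vv' E mE.
have mt : measurable_fun setT (fun w => [tuple v i w | i < N]).
  apply/measurable_fun_tnthP => i; rewrite (_ : _ \o _ = v i)//.
  by apply/funext => w /=; rewrite tnth_mktuple.
have mt' : measurable_fun setT (fun w => [tuple v' i w | i < N]).
  apply/measurable_fun_tnthP => i; rewrite (_ : _ \o _ = v' i)//.
  by apply/funext => w /=; rewrite tnth_mktuple.
pose X : {mfun T >-> N.-tuple R} := HB.pack (fun w => [tuple v i w | i < N])
  (isMeasurableFun.Build _ _ _ _ _ mt).
pose X' : {mfun T' >-> N.-tuple R} := HB.pack (fun w => [tuple v' i w | i < N])
  (isMeasurableFun.Build _ _ _ _ _ mt').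
change (distribution P X E = distribution P' X' E).
(* Uniqueness asks for a generating class stable under intersection: rectangles in all coordinates
   are, cylinders over a single coordinate are not. *)
apply: (measure_unique _ (fun=> setT) (tuple_measurableE R N)) => //=.
- move=> _ _ [A [mA ->]] [B [mB ->]]; exists (fun i => A i `&` B i); split.
    by move=> i; exact: measurableI.
  apply/seteqP; split => t /=; first by move=> [h k] i; split; auto.
  by move=> h; split => i; have [] := h i.
- move=> _; exists (fun=> setT); split => //.
  by apply/seteqP; split.
- by rewrite bigcup_const.
- move=> _ [A [mA ->]].
  rewrite /distribution/= /pushforward/=.
  have e (S : Type) (u : 'I_N -> S -> R) : (fun w => [tuple u i w | i < N]) @^-1`
     [set t | forall i, A i (tnth t i)] = \bigcap_i (u i @^-1` A i).
    apply/seteqP; split => w /= h i; last by rewrite tnth_mktuple; exact: h.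
    by move=> _; have := h i; rewrite tnth_mktuple.
  by rewrite !e vv'.
- by move=> _; rewrite probability_setT ltry.
Qed.

Section law.
Context (R : realType) d d' (T : measurableType d) (S : measurableType d').
Variables (P : {measure set T -> \bar R}) (m : {measure set S -> \bar R}).
Variables (X : T -> S) (mX : measurable_fun setT X).
Hypothesis PX : forall E, measurable E -> P (X @^-1` E) = m E.

(** The law of X is given as an equality on sets, so the target can be a product measure or the law
    of another process. *)
Lemma ge0_integral_law (f : S -> \bar R) :
  measurable_fun setT f -> (forall x, 0 <= f x) ->
  \int[P]_w f (X w) = \int[m]_x f x.
Proof.
move=> mf f0; pose X' : {mfun T >-> S} := HB.pack X (isMeasurableFun.Build _ _ _ _ _ mX).
transitivity (\int[pushforward P X']_x f x).
  by rewrite ge0_integral_pushforward.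
by apply: eq_measure_integral => E mE _; exact: PX.
Qed.

Lemma integrable_law (f : S -> \bar R) :
  m.-integrable setT f -> P.-integrable setT (fun w => f (X w)).
Proof.
move=> /integrableP[mf fi]; apply/integrableP; split.
  exact: measurableT_comp.
rewrite (ge0_integral_law (f := fun x => `|f x|))//.
exact: measurableT_comp.
Qed.

Lemma integral_law (f : S -> \bar R) : measurable_fun setT f ->
  \int[P]_w f (X w) = \int[m]_x f x.
Proof.
move=> mf; rewrite [LHS]integralE [RHS]integralE.
rewrite -(ge0_integral_law (f := f^\+)) -?(ge0_integral_law (f := f^\-))//; first by rewrite -[fun w => f (X w)]/(f \o X) funepos_comp funeneg_comp.
- exact: measurable_funeneg.
- exact: measurable_funepos.
Qed.

End law.

Lemma law_pair (R : realType) d d1 d2 (T : measurableType d)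
    (T1 : measurableType d1) (T2 : measurableType d2) (P : {measure set T -> \bar R})
    (m1 : {sigma_finite_measure set T1 -> \bar R})
    (m2 : {sigma_finite_measure set T2 -> \bar R}) (X : T -> T1) (Z : T -> T2) :
  measurable_fun setT X -> measurable_fun setT Z ->
  (forall A B, measurable A -> measurable B ->
     P (X @^-1` A `&` Z @^-1` B) = m1 A * m2 B) ->
  forall E, measurable E -> P ((fun w => (X w, Z w)) @^-1` E) = (m1 \x m2) E.
Proof.
move=> mX mZ XZ E mE.
have mXZ : measurable_fun setT (fun w => (X w, Z w)) by exact: measurable_fun_pair.
pose W : {mfun T >-> (T1 * T2)%type} := HB.pack (fun w => (X w, Z w))
  (isMeasurableFun.Build _ _ _ _ _ mXZ).
by rewrite (product_measure_unique (m' := pushforward P W)).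
Qed.

(** Two applications of [law_pair]. For the pair (X, Z), fix C: P restricted to the event W in C is
    compared with the product of m2 and of m1 scaled by m0 C, which turns the triple factorisation
    into a factorisation of pairs. *)
Lemma law_triple (R : realType) d d0 d1 d2 (T : measurableType d)
    (T0 : measurableType d0) (T1 : measurableType d1) (T2 : measurableType d2)
    (P : probability T R) (m0 : probability T0 R)
    (m1 : probability T1 R) (m2 : probability T2 R)
    (W : T -> T0) (X : T -> T1) (Z : T -> T2) :
  measurable_fun setT W -> measurable_fun setT X -> measurable_fun setT Z ->
  (forall C A B, measurable C -> measurable A -> measurable B ->
     P (W @^-1` C `&` (X @^-1` A `&` Z @^-1` B)) = m0 C * (m1 A * m2 B)) ->
  forall E, measurable E ->
    P ((fun w => (W w, (X w, Z w))) @^-1` E) = (m0 \x (m1 \x m2)) E.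
Proof.
move=> mW mX mZ WXZ.
apply: (@law_pair R _ _ _ T T0 _ P m0 (m1 \x m2 : probability _ R) W (fun w => (X w, Z w))) => //; first exact: measurable_fun_pair.
move=> C D mC mD.
have mWC : measurable (W @^-1` C) by rewrite -[X in measurable X]setTI; exact: mW.
have fC : (0 <= fine (m0 C))%R by rewrite fine_ge0.
pose m1' := mscale (NngNum fC) m1.
have m1'E B : m1' B = m0 C * m1 B by rewrite /m1' /mscale/= fineK// fin_num_measure.
have mrE B : mrestr P mWC B = P (B `&` W @^-1` C) by [].
have e : mrestr P mWC ((fun w => (X w, Z w)) @^-1` D) = (m1' \x m2) D.
  apply: (@law_pair R d d1 d2 T T1 T2 (mrestr P mWC) m1' m2 X Z mX mZ _ D mD).
  move=> A B mA mB; transitivity (P ((X @^-1` A `&` Z @^-1` B) `&` W @^-1` C)) => //.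
  rewrite setIC WXZ// muleA; congr (_ * _); exact/esym/m1'E.
transitivity (mrestr P mWC ((fun w => (X w, Z w)) @^-1` D)).
  exact: (congr1 P (setIC _ _)).
rewrite e.
rewrite /product_measure1 /= ge0_integral_mscale//=; last exact: measurable_fun_xsection.
by rewrite fineK// fin_num_measure.
Qed.

Section ae.
Context (R : realType) d (T : measurableType d) (m : {measure set T -> \bar R}).

Lemma aeS (A B : T -> Prop) : (forall x, A x -> B x) ->
  {ae m, forall x, A x} -> {ae m, forall x, B x}.
Proof. by move=> AB; apply: filterS => x; exact: AB. Qed.

Lemma aeS2 (A B C : T -> Prop) : (forall x, A x -> B x -> C x) ->
  {ae m, forall x, A x} -> {ae m, forall x, B x} -> {ae m, forall x, C x}.
Proof. by move=> ABC; apply: filterS2 => x; exact: ABC. Qed.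

End ae.

Section levy_laws.
Context (R : realType) d (T : measurableType d) (P : probability T R).
Variable Y : R -> {RV P >-> R}.
Hypothesis Y_levy : levy_process Y.

(** The first component is kept as an increment from time 0, since Y 0 vanishes only almost
    surely. *)
Lemma levy_pair_law (s t : R) : (0 <= s)%R -> (0 <= t)%R ->
  forall E, measurable E ->
  P ((fun w => (Y s w - Y 0 w, Y (s + t) w - Y s w)%R) @^-1` E) =
  (distribution P (Y s) \x distribution P (Y t)) E.
Proof.
move=> s0 t0; have [_ ind stat _] := Y_levy.
apply: law_pair => [||A B mA mB].
- exact: measurable_funB.
- exact: measurable_funB.
(* [levy_process] takes an infinite monotone sequence of times, so 0, s, s + t is continued as a
   constant. *)
pose ts n := if n is n'.+1 then (if n' is n''.+1 then (s + t)%R else s) else 0%R.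
have h : mutually_independent P (fun (i : 'I_2) w => (Y (ts i.+1) w - Y (ts i) w)%R).
  by apply: ind => // -[|[|i]] /=; rewrite ?lerDl.
have mAB (i : 'I_2) : measurable (if i == 0%N :> nat then A else B) by case: ifP.
have := h _ mAB; rewrite big_ord_recl big_ord1 /=.
have -> : \bigcap_(i in [set: 'I_2])
   ((fun w => (Y (ts i.+1) w - Y (ts i) w)%R) @^-1` (if i == 0%N :> nat then A else B)) =
   (fun w => (Y s w - Y 0 w)%R) @^-1` A `&` (fun w => (Y (s + t) w - Y s w)%R) @^-1` B.
  apply/seteqP; split => w /=.
    by move=> h'; split; [exact: (h' ord0 I)|exact: (h' ord_max I)].
  by move=> [h1 h2] [[|[|k]] kn] _ //=.
move=> ->; congr (_ * _); last by exact: stat.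
by have := stat 0%R s (lexx _) s0 A mA; rewrite add0r.
Qed.

Lemma levy_conv (s t : R) : (0 <= s)%R -> (0 <= t)%R ->
  forall E : set R, measurable E ->
  (distribution P (Y s) \x distribution P (Y t)) ((fun p : R * R => (p.1 + p.2)%R) @^-1` E) =
  distribution P (Y (s + t)%R) E.
Proof.
move=> s0 t0 E mE; have [_ _ stat _] := Y_levy.
rewrite -levy_pair_law//; last first.
  by rewrite -[X in measurable X]setTI; exact: measurable_funD.
have := stat 0%R (s + t)%R (lexx _) (addr_ge0 s0 t0) E mE; rewrite add0r; apply: etrans.
by congr (P _); apply/seteqP; split => w /=; rewrite [(Y s w - _ + _)%R]addrC subrKA.
Qed.

Lemma levy_zero (f : R -> \bar R) : measurable_fun setT f -> (forall x, 0 <= f x) ->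
  \int[distribution P (Y 0%R)]_x f x = f 0%R.
Proof.
move=> mf f0; have [Y0 _ _ _] := Y_levy.
rewrite ge0_integral_distribution//.
rewrite (ge0_ae_eq_integral (g := fun=> f 0%R))//.
- by rewrite integral_cst//= -[RHS]mule1; congr (_ * _); exact: probability_setT.
- exact: measurableT_comp.
- by move=> w _; exact: f0.
- by apply: aeS Y0 => w /= -> _.
Qed.

End levy_laws.

Section blocks.
Context (R : realType) (n : nat) (i : 'S_n) (j : nat).

(** A function of the total sum sees a partial replacement only through the sums over the kept and
    the replaced block. Indexing by positions in the permutation makes the replaced block an initial
    segment. *)
Definition kept_sum (x : 'I_n -> R) : R := (\sum_(a < n | (j <= a)%N) x (i a))%R.
Definition moved_sum (x : 'I_n -> R) : R := (\sum_(a < n | (a < j)%N) x (i a))%R.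

Lemma sum_kept_moved (x : 'I_n -> R) :
  (\sum_(l < n) x l = moved_sum x + kept_sum x)%R.
Proof.
rewrite (reindex_perm i)/= (bigID (fun a : 'I_n => (a < j)%N))/=; congr (_ + _)%R.
by apply: eq_bigl => a; rewrite -leqNgt.
Qed.

Lemma sum_replaced (x x' : 'I_n -> R) :
  (\sum_(l < n) replaced i j x x' l = moved_sum x' + kept_sum x)%R.
Proof.
have memi (a : 'I_n) : (i a \in [set i b | b : 'I_n & (b < j)%N]%SET) = (a < j)%N.
  by rewrite mem_imset ?inE//; exact: perm_inj.
rewrite sum_kept_moved; congr (_ + _)%R; apply: eq_bigr => a ja.
  by rewrite /replaced memi ja.
by rewrite /replaced memi ltnNge ja.
Qed.

End blocks.

Section increments_law.
Context (R : realType) d (T : measurableType d) (P : probability T R).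
Variables Y Y' Y'' : R -> {RV P >-> R}.
Hypothesis Y_levy : levy_process Y.
Hypothesis Y'_copy : process_copy Y Y'.
Hypothesis Y_indep : independent_processes3 Y Y' Y''.
Variables (n : nat) (n0 : (0 < n)%N).

Let dt : R := n%:R^-1.
Let dt0 : (0 <= dt)%R. Proof. by rewrite invr_ge0. Qed.

Lemma measurable_increments (Z : R -> {RV P >-> R}) l :
  measurable_fun setT (fun w => increments Z n w l).
Proof. exact: measurable_funB. Qed.

(** This is exchangeability: the right-hand side does not involve i. *)
Lemma increments_rect (i : 'S_n) (A : 'I_n -> set R) : (forall a, measurable (A a)) ->
  P (\bigcap_a ((fun w => increments Y n w (i a)) @^-1` A a)) =
  \prod_(a < n) distribution P (Y dt) (A a).
Proof.
move=> mA; have [_ ind stat _] := Y_levy.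
have := ind n (fun l => (l%:R * dt)%R) _ _ (fun l => A (i^-1%g l)) => h.
rewrite (_ : \bigcap_a _ = \bigcap_(a in [set: 'I_n]) ((fun w =>
  (Y (a.+1%:R * dt) w - Y (a%:R * dt) w)%R) @^-1` A (i^-1%g a))); last first.
  apply/seteqP; split => w /= Aw a _.
    by have := Aw (i^-1%g a) I; rewrite permKV.
  by have := Aw (i a) I; rewrite permK.
rewrite h//.
- rewrite (reindex_perm i)/=; apply: eq_bigr => a _; rewrite permK.
  rewrite -natr1 mulrDl mul1r; apply: stat => //.
  by rewrite mulr_ge0.
- by rewrite mul0r.
- by move=> l; rewrite ler_wpM2r// ler_nat.
Qed.

Let moved_kept (j : nat) (t : n.-tuple R) : R * R :=
  (moved_sum 1%g j (tnth t), kept_sum 1%g j (tnth t)).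

Lemma measurable_sumT d0 (T0 : measurableType d0) (I : finType) (p : pred I) (f : I -> T0 -> R) :
  (forall i, measurable_fun setT (f i)) ->
  measurable_fun setT (fun w => \sum_(i | p i) f i w)%R.
Proof.
move=> mf; rewrite (_ : (fun _ => _) = (fun w => \sum_(i <- enum p) f i w)%R).
  exact: measurable_sum.
by apply/funext => w; rewrite big_enum.
Qed.

Lemma moved_sum_telescope (j : nat) w : (j <= n)%N ->
  moved_sum 1%g j (increments Y n w) = (Y (j%:R * dt) w - Y 0 w)%R.
Proof.
move=> jn; rewrite /moved_sum; under eq_bigr do rewrite perm1 /increments.
rewrite -(big_mkord (fun a => (a < j)%N)
  (fun a => Y (a.+1%:R / n%:R) w - Y (a%:R / n%:R) w)%R).
transitivity (\sum_(0 <= a < j) (Y (a.+1%:R / n%:R) w - Y (a%:R / n%:R) w))%R.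
  by rewrite [RHS](big_nat_widen _ _ _ _ _ jn).
by rewrite telescope_sumr// mul0r.
Qed.

Lemma kept_sum_telescope (j : nat) w : (j <= n)%N ->
  kept_sum 1%g j (increments Y n w) = (Y 1 w - Y (j%:R * dt) w)%R.
Proof.
move=> jn; rewrite /kept_sum; under eq_bigr do rewrite perm1 /increments.
rewrite -(big_mkord (fun a => (j <= a)%N)
  (fun a => Y (a.+1%:R / n%:R) w - Y (a%:R / n%:R) w)%R).
transitivity (\sum_(j <= a < n) (Y (a.+1%:R / n%:R) w - Y (a%:R / n%:R) w))%R.
  by rewrite [RHS](big_nat_widenl _ 0%N).
by rewrite telescope_sumr// divff// pnatr_eq0 -lt0n.
Qed.

(** By exchangeability i may be replaced by the identity, for which both blocks telescope to
    increments of Y over [0, j / n] and [j / n, 1]. *)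
Lemma increments_pair_law (i : 'S_n) (j : nat) : (j <= n)%N ->
  forall E, measurable E ->
  P ((fun w => (moved_sum i j (increments Y n w), kept_sum i j (increments Y n w))) @^-1` E) =
  (distribution P (Y (j%:R * dt)%R) \x distribution P (Y (1 - j%:R * dt)%R)) E.
Proof.
move=> jn E mE.
have h0 : (0 <= j%:R * dt)%R by rewrite mulr_ge0.
have h1 : (0 <= 1 - j%:R * dt)%R.
  by rewrite subr_ge0 ler_pdivrMr ?ltr0n// mul1r ler_nat.
have mk : measurable_fun setT (moved_kept j).
  by apply: measurable_fun_pair; apply: measurable_sumT => a; exact: measurable_tnth.
have e (k : 'S_n) : (fun w => (moved_sum k j (increments Y n w), kept_sum k j (increments Y n w))) @^-1` E =
  (fun w => [tuple increments Y n w (k l) | l < n]) @^-1` (moved_kept j @^-1` E).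
  suff h w : (moved_sum k j (increments Y n w), kept_sum k j (increments Y n w)) =
    moved_kept j [tuple increments Y n w (k l) | l < n].
    by apply/seteqP; split => w /=; rewrite h.
  by congr (_, _); apply: eq_bigr => a _; rewrite perm1 tnth_mktuple.
rewrite e (@tuple_law _ _ _ _ _ P P n _ (fun l w => increments Y n w ((1%g : 'S_n) l))); first last.
- by rewrite -[X in measurable X]setTI; exact: mk.
- by move=> A mA; rewrite !increments_rect.
- by move=> a; exact: measurable_increments.
- by move=> a; exact: measurable_increments.
rewrite -e -(levy_pair_law Y_levy h0 h1 mE) addrC subrK; congr (P _).
by apply/seteqP; split => w /=; rewrite moved_sum_telescope// kept_sum_telescope.
Qed.

Lemma process_sigma_tuple d0 (S : measurableType d0) (Z : R -> {RV P >-> R}) N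
    (t : 'I_N -> R) (h : N.-tuple R -> S) E :
  (forall k, (0 <= t k)%R) -> measurable_fun setT h -> measurable E ->
  process_sigma_algebra Z ((fun w => h [tuple Z (t k) w | k < N]) @^-1` E).
Proof.
move=> t0 mh mE; pose G := [set E : set T | exists (t : R) (A : set R),
        [/\ (0 <= t)%R, measurable A & E = Z t @^-1` A] ].
rewrite /process_sigma_algebra -/G.
(* T is given the sigma-algebra generated by the process as its measurable structure, so that
   membership of the event becomes measurability of a tuple of coordinates. *)
have mt : measurable_fun setT
    (fun w : g_sigma_algebraType G => [tuple Z (t k) w | k < N]).
  apply/measurable_fun_tnthP => k; rewrite (_ : _ \o _ = Z (t k)).
    by move=> _ A mA; rewrite setTI; apply: sub_sigma_algebra; exists (t k), A.
  by apply/funext => w /=; rewrite tnth_mktuple.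
have := measurableT_comp mh mt; move=> /(_ measurableT _ mE).
by rewrite setTI.
Qed.

Let grid (k : 'I_n.+1) : R := (k%:R / n%:R)%R.

Let grid0 k : (0 <= grid k)%R. Proof. by rewrite mulr_ge0. Qed.

(** The increments as a measurable function of the n + 1 grid values: in this form
    [process_sigma_tuple] places the block events in the sigma-algebra of the process. *)
Let steps (t : n.+1.-tuple R) (l : 'I_n) : R :=
  (tnth t (lift ord0 l) - tnth t (widen_ord (leqnSn n) l))%R.

Let stepsE (Z : R -> {RV P >-> R}) w :
  steps [tuple Z (grid k) w | k < n.+1] = increments Z n w.
Proof. by apply/funext => l; rewrite /steps !tnth_mktuple /grid lift0. Qed.

Let measurable_steps l : measurable_fun setT (steps ^~ l).
Proof. by apply: measurable_funB; exact: measurable_tnth. Qed.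

(** Independence of the processes separates the two blocks of Y, taken jointly, from the block of
    Y', with the sure event for Y''. The joint law of the former is [increments_pair_law]; the law
    of the latter is that of the same block of Y, as Y' has the same finite-dimensional laws. *)
Lemma increments_triple_law (i : 'S_n) (j : nat) : (j <= n)%N ->
  forall E, measurable E ->
  P ((fun w => (kept_sum i j (increments Y n w),
       (moved_sum i j (increments Y n w), moved_sum i j (increments Y' n w)))) @^-1` E) =
  (distribution P (Y (1 - j%:R * dt)%R) \x
    (distribution P (Y (j%:R * dt)%R) \x distribution P (Y (j%:R * dt)%R))) E.
Proof.
move=> jn; apply: law_triple.
- by apply: measurable_sumT => a; exact: measurable_increments.
- by apply: measurable_sumT => a; exact: measurable_increments.
- by apply: measurable_sumT => a; exact: measurable_increments.
move=> C A B mC mA mB.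
have hmk : measurable_fun setT (fun t => (moved_sum i j (steps t), kept_sum i j (steps t))).
  by apply: measurable_fun_pair; apply: measurable_sumT => a; exact: measurable_steps.
have hm : measurable_fun setT (fun t => moved_sum i j (steps t)).
  by apply: measurable_sumT => a; exact: measurable_steps.
have mAC : measurable (A `*` C) by exact: measurableX.
have sY := process_sigma_tuple (Z := Y) grid0 hmk mAC.
have sY' := process_sigma_tuple (Z := Y') grid0 hm mB.
have sY'' : process_sigma_algebra Y'' setT.
  have := process_sigma_tuple (Z := Y'') grid0 hm measurableT; by rewrite preimage_setT.
have := Y_indep sY sY' sY''.
have eY : (fun w => (moved_sum i j (steps [tuple Y (grid k) w | k < n.+1]),
   kept_sum i j (steps [tuple Y (grid k) w | k < n.+1]))) @^-1` (A `*` C) =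
   (fun w => (moved_sum i j (increments Y n w), kept_sum i j (increments Y n w))) @^-1` (A `*` C).
  by apply/seteqP; split => w /=; rewrite stepsE.
have eY' (Z : R -> {RV P >-> R}) : (fun w => moved_sum i j (steps [tuple Z (grid k) w | k < n.+1])) @^-1` B =
   (fun w => moved_sum i j (increments Z n w)) @^-1` B.
  by apply/seteqP; split => w /=; rewrite stepsE.
rewrite setIT probability_setT mule1 eY increments_pair_law// product_measure1E//.
have eB : P ((fun w => moved_sum i j (increments Y' n w)) @^-1` B) =
    distribution P (Y (j%:R * dt)%R) B.
  transitivity (P ((fun w => moved_sum i j (increments Y n w)) @^-1` B)).
    rewrite -(eY' Y) -(eY' Y').
    have mg (Z : R -> {RV P >-> R}) (k : 'I_n.+1) : measurable_fun setT (Z (grid k)) by [].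
    have mhB : measurable ((fun t => moved_sum i j (steps t)) @^-1` B).
      by rewrite -[X in measurable X]setTI; exact: hm.
    exact/esym/(tuple_law (mg Y) (mg Y') (fun A mA => Y'_copy grid0 mA) mhB).
  have mTB : measurable (B `*` [set: R]) by exact: measurableX.
  have := increments_pair_law i jn mTB; rewrite product_measure1E//.
  rewrite [X in _ * X]probability_setT mule1 => <-; congr (P _).
  by apply/seteqP; split => w /=; [split|case].
rewrite (eY' Y') eB => h; rewrite muleCA muleA -h; congr (P _).
by apply/seteqP; split => w /=; tauto.
Qed.

End increments_law.

Section fixed_time_law.
Context (R : realType) d (T : measurableType d) (P : probability T R).
Variables Y Y' Y'' : R -> {RV P >-> R}.
Hypothesis Y'_copy : process_copy Y Y'.
Hypothesis Y''_copy : process_copy Y Y''.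
Hypothesis Y_indep : independent_processes3 Y Y' Y''.

Lemma process_copy1 (Z Z' : R -> {RV P >-> R}) t (A : set R) : process_copy Z Z' ->
  (0 <= t)%R -> measurable A -> P (Z' t @^-1` A) = P (Z t @^-1` A).
Proof.
move=> ZZ' t0 mA.
have e (X : T -> R) : \bigcap_(k in [set: 'I_1]) (X @^-1` A) = X @^-1` A.
  by apply/seteqP; split => w /= => [/(_ ord0 I)|h _ _].
by have := ZZ' 1%N (fun=> t) (fun=> A) (fun=> t0) (fun=> mA); rewrite !e.
Qed.

(** The shared variable comes first, as in [increments_triple_law], so that the expectations in B_k
    and in the limit both fall under [double_has_int]. *)
Lemma fixed_time_triple_law (s t : R) : (0 <= s)%R -> (0 <= t)%R ->
  forall E, measurable E ->
  P ((fun w => (Y'' s w, (Y t w, Y' t w))) @^-1` E) =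
  (distribution P (Y s) \x (distribution P (Y t) \x distribution P (Y t))) E.
Proof.
move=> s0 t0; apply: law_triple => // C A B mC mA mB.
have gen (Z : R -> {RV P >-> R}) r D : (0 <= r)%R -> measurable D ->
    process_sigma_algebra Z (Z r @^-1` D).
  by move=> r0 mD; apply: sub_sigma_algebra; exists r, D.
have := Y_indep (gen _ _ _ t0 mA) (gen _ _ _ t0 mB) (gen _ _ _ s0 mC).
rewrite (process_copy1 Y'_copy)// (process_copy1 Y''_copy)// => h.
rewrite muleC -h; congr (P _).
by apply/seteqP; split => w /=; tauto.
Qed.

End fixed_time_law.

(** * Bounded measurable functions *)

Section bounded_measurable.
Context (R : realType) d (T : measurableType d).
Implicit Types F H : T -> R.

(** Such functions are integrable for every probability, so linearity and Fubini hold for them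
    without side conditions. Unbounded functions are reached later by truncation. *)
Definition bmeas F := measurable_fun setT F /\ exists M, forall x, (`|F x| <= M)%R.

Lemma bmeas_measurable F : bmeas F -> measurable_fun setT F.
Proof. by case. Qed.

Lemma bmeas_cst (k : R) : bmeas (fun=> k).
Proof. by split => //; exists `|k|%R. Qed.

Lemma bmeasD F H : bmeas F -> bmeas H -> bmeas (fun x => F x + H x)%R.
Proof.
move=> [mF [M FM]] [mH [N HN]]; split; first exact: measurable_funD.
exists (M + N)%R => x; rewrite (le_trans (ler_normD _ _))//; exact: lerD.
Qed.

Lemma bmeasM F H : bmeas F -> bmeas H -> bmeas (fun x => F x * H x)%R.
Proof.
move=> [mF [M FM]] [mH [N HN]]; split; first exact: measurable_funM.
by exists (M * N)%R => x; rewrite normrM; exact: ler_pM.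
Qed.

Lemma bmeasZ k F : bmeas F -> bmeas (fun x => k * F x)%R.
Proof. by move=> bF; apply: bmeasM => //; exact: bmeas_cst. Qed.

Lemma bmeasN F : bmeas F -> bmeas (fun x => - F x)%R.
Proof.
move=> bF; rewrite (_ : (fun x => - F x)%R = (fun x => -1 * F x)%R); first exact: bmeasZ.
by apply/funext => x; rewrite mulN1r.
Qed.

Lemma bmeasB F H : bmeas F -> bmeas H -> bmeas (fun x => F x - H x)%R.
Proof. by move=> bF bH; apply: bmeasD => //; exact: bmeasN. Qed.

Lemma bmeasX F n : bmeas F -> bmeas (fun x => F x ^+ n)%R.
Proof.
move=> [mF [M FM]]; split; first exact: measurable_funX.
by exists (M ^+ n)%R => x; rewrite normrX lerXn2r ?nnegrE//; exact: le_trans (FM x).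
Qed.

Lemma bmeas_sum I (r : seq I) (F : I -> T -> R) : (forall i, bmeas (F i)) ->
  bmeas (fun x => \sum_(i <- r) F i x)%R.
Proof.
move=> bF; elim: r => [|i r ih].
  by under eq_fun do rewrite big_nil; exact: bmeas_cst.
by under eq_fun do rewrite big_cons; exact: bmeasD.
Qed.

Lemma bmeas_integrable (m : probability T R) F : bmeas F ->
  m.-integrable setT (EFin \o F).
Proof.
move=> [mF [M FM]]; apply: measurable_bounded_integrable => //.
  by rewrite [ltLHS](probability_setT m) ltry.
exists M; split; first exact: num_real.
by move=> y My x _; exact: le_trans (FM x) (ltW My).
Qed.

Lemma bmeas_fin_num (m : probability T R) F : bmeas F ->
  \int[m]_x (F x)%:E \is a fin_num.
Proof. by move=> bF; apply: integrable_fin_num => //; exact: bmeas_integrable. Qed.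

Lemma EFin_Rint (m : probability T R) F : bmeas F ->
  (\int[m]_x F x)%R%:E = \int[m]_x (F x)%:E.
Proof. by move=> bF; rewrite /Rintegral fineK//; exact: bmeas_fin_num. Qed.

Lemma RintD (m : probability T R) F H : bmeas F -> bmeas H ->
  (\int[m]_x (F x + H x) = \int[m]_x F x + \int[m]_x H x)%R.
Proof. by move=> bF bH; rewrite RintegralD//; exact: bmeas_integrable. Qed.

Lemma RintB (m : probability T R) F H : bmeas F -> bmeas H ->
  (\int[m]_x (F x - H x) = \int[m]_x F x - \int[m]_x H x)%R.
Proof. by move=> bF bH; rewrite RintegralB//; exact: bmeas_integrable. Qed.

Lemma RintZ (m : probability T R) F k : bmeas F ->
  (\int[m]_x (k * F x) = k * \int[m]_x F x)%R.
Proof. by move=> bF; rewrite RintegralZl//; exact: bmeas_integrable. Qed.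

Lemma Rint_cst (m : probability T R) (k : R) : (\int[m]_x k = k)%R.
Proof. by rewrite Rintegral_cst// [X in fine X](probability_setT m) mulr1. Qed.

Lemma Rint_sum I (r : seq I) (m : probability T R) (F : I -> T -> R) :
  (forall i, bmeas (F i)) ->
  (\int[m]_x (\sum_(i <- r) F i x) = \sum_(i <- r) \int[m]_x F i x)%R.
Proof.
move=> bF; elim: r => [|i r ih].
  by under eq_Rintegral do rewrite big_nil; rewrite Rint_cst big_nil.
under eq_Rintegral do rewrite big_cons.
by rewrite RintD ?ih ?big_cons//; exact: bmeas_sum.
Qed.

Lemma Rint_le_bound (m : probability T R) F M : bmeas F ->
  (forall x, `|F x| <= M)%R -> (`|\int[m]_x F x| <= M)%R.
Proof.
move=> bF FM; apply: le_trans (le_normr_Rintegral _ _) _ => //; first exact: bmeas_integrable.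
rewrite -[leRHS](Rint_cst m); apply: le_Rintegral => //.
- exact/integrable_norm/bmeas_integrable.
- exact/bmeas_integrable/bmeas_cst.
Qed.

(** The decomposition of a second moment into variance and squared mean; it is the source of both
    Jensen's inequality and [phi_V]. *)
Lemma Rint_sqr (m : probability T R) F : bmeas F ->
  (\int[m]_x (F x) ^+ 2 =
   \int[m]_x (F x - \int[m]_y F y) ^+ 2 + (\int[m]_y F y) ^+ 2)%R.
Proof.
move=> bF; set k := (\int[m]_y F y)%R.
have -> : (\int[m]_x (F x - k) ^+ 2 = \int[m]_x (F x ^+ 2 + (k ^+ 2 - (2 * k) * F x)))%R.
  by apply: eq_Rintegral => x _; ring.
rewrite RintD; [|exact: bmeasX|by apply: bmeasB; [exact: bmeas_cst|exact: bmeasZ]].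
rewrite RintB; [|exact: bmeas_cst|exact: bmeasZ].
by rewrite Rint_cst RintZ// -/k; ring.
Qed.

Lemma sqr_Rint_le (m : probability T R) F : bmeas F ->
  ((\int[m]_x F x) ^+ 2 <= \int[m]_x (F x) ^+ 2)%R.
Proof.
by move=> bF; rewrite [leRHS]Rint_sqr// lerDr; apply: Rintegral_ge0 => x _; exact: sqr_ge0.
Qed.

End bounded_measurable.

Lemma bmeas_comp (R : realType) d d' (T : measurableType d) (S : measurableType d')
  (F : S -> R) (f : T -> S) : measurable_fun setT f -> bmeas F -> bmeas (fun x => F (f x)).
Proof. by move=> mf [mF [M FM]]; split; [exact: measurableT_comp|exists M]. Qed.

Section bounded_product.
Context (R : realType) d1 d2 (T1 : measurableType d1) (T2 : measurableType d2).

Lemma measurable_integral (m : {sigma_finite_measure set T2 -> \bar R}) (f : T1 * T2 -> \bar R) :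
  measurable_fun setT f -> measurable_fun setT (fun x => \int[m]_y f (x, y)).
Proof.
move=> mf; under eq_fun do rewrite integralE.
apply: emeasurable_funB.
- apply: (eq_measurable_fun (fun x => \int[m]_y (f^\+ (x, y)))).
    by move=> x _; apply: eq_integral => y _; rewrite !funeposE.
  by apply: (@measurable_fun_fubini_tonelli_F _ _ _ _ _ _ (f^\+)) => //; exact: measurable_funepos.
- apply: (eq_measurable_fun (fun x => \int[m]_y (f^\- (x, y)))).
    by move=> x _; apply: eq_integral => y _; rewrite !funenegE.
  by apply: (@measurable_fun_fubini_tonelli_F _ _ _ _ _ _ (f^\-)) => //; exact: measurable_funeneg.
Qed.

Lemma measurable_Rint (m : {sigma_finite_measure set T2 -> \bar R}) (f : T1 * T2 -> R) :
  measurable_fun setT f -> measurable_fun setT (fun x => \int[m]_y f (x, y))%R.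
Proof.
move=> mf.
have mf' : measurable_fun setT (EFin \o f) by exact: measurableT_comp.
have mfine : measurable_fun setT (@fine R) by exact: fine_measurable.
exact: (measurableT_comp mfine (measurable_integral m mf')).
Qed.

Lemma bmeas_Rint (m : probability T2 R) (f : T1 * T2 -> R) :
  bmeas f -> bmeas (fun x => \int[m]_y f (x, y))%R.
Proof.
move=> bf; have [mf [M fM]] := bf; split; first exact: measurable_Rint.
exists M => x; apply: Rint_le_bound => // .
by apply: (bmeas_comp (f := fun y => (x, y)) _ bf); exact: measurable_fun_pair.
Qed.

End bounded_product.

Section bounded_fubini.
Context (R : realType) d1 d2 (T1 : measurableType d1) (T2 : measurableType d2).

Lemma Rint_prod (m1 : probability T1 R) (m2 : probability T2 R) (f : T1 * T2 -> R) : bmeas f ->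
  (\int[m1]_x \int[m2]_y f (x, y) = \int[m1 \x m2]_p f p)%R.
Proof.
move=> bf; apply: EFin_inj; rewrite EFin_Rint; last exact: bmeas_Rint.
rewrite [RHS](EFin_Rint (m1 \x m2 : probability _ _))//.
rewrite -integral12_prod_meas1; last exact: (@bmeas_integrable _ _ _ (m1 \x m2 : probability _ _)).
apply: eq_integral => x _; rewrite EFin_Rint//.
by apply: (bmeas_comp (f := fun y => (x, y)) _ bf); exact: measurable_fun_pair.
Qed.

End bounded_fubini.

Lemma Rint_dct (R : realType) d (T : measurableType d) (m : {measure set T -> \bar R})
    (f_ : nat -> T -> R) (f g : T -> R) :
  (forall n, measurable_fun setT (f_ n)) -> measurable_fun setT f ->
  m.-integrable setT (EFin \o g) ->
  {ae m, forall x, f_ n x @[n --> \oo] --> f x} ->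
  (forall n x, `|f_ n x| <= g x)%R ->
  (\int[m]_x f_ n x)%R @[n --> \oo] --> (\int[m]_x f x)%R.
Proof.
move=> mf_ mf ig ff fg.
have mef n : measurable_fun setT (EFin \o f_ n) by apply/measurable_EFinP.
have mef' : measurable_fun setT (EFin \o f) by apply/measurable_EFinP.
have ae1 : {ae m, forall x, setT x -> (EFin \o f_ n) x @[n --> \oo] --> (EFin \o f) x}.
  by apply: aeS ff => x fx _; apply/fine_cvgP; split; [exact: nearW|exact: fx].
have ae2 : {ae m, forall x n, setT x -> `|(EFin \o f_ n) x| <= (EFin \o g) x}.
  by apply: aeW => x n _; rewrite lee_fin.
have [fi _ h] := dominated_convergence measurableT mef mef' ae1 ig ae2.
by apply: fine_cvg; rewrite fineK; [exact: h|exact: integrable_fin_num].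
Qed.

Definition Pop (R : realType) (m : probability R R) (F : R -> R) (c : R) : R :=
  (\int[m]_a F (a + c))%R.

(** What the analysis of phi and V retains of the Levy process: its one-dimensional laws form a
    convolution semigroup, started at the Dirac mass at 0. *)
Record conv_semigroup (R : realType) (mu : R -> probability R R) : Prop := {
  conv_law : forall s t, (0 <= s)%R -> (0 <= t)%R -> forall E : set R, measurable E ->
    (mu s \x mu t) ((fun p : R * R => (p.1 + p.2)%R) @^-1` E) = mu (s + t)%R E;
  conv_zero : forall f, measurable_fun setT f -> (forall x, 0 <= f x) ->
    \int[mu 0%R]_x f x = f 0%R }.

(** * The convolution semigroup *)

Section semigroup.
Context (R : realType) (mu : R -> probability R R) (mu_conv : conv_semigroup mu).
Implicit Types F : R -> R.

Lemma measurable_add : measurable_fun setT (fun p : R * R => (p.1 + p.2)%R).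
Proof. exact: measurable_funD. Qed.

Let madd := measurable_add.

Lemma measurable_addr (c : R) : measurable_fun setT (fun x : R => (x + c)%R).
Proof. exact: measurable_funD. Qed.

Lemma measurable_addl (c : R) : measurable_fun setT (fun x : R => (c + x)%R).
Proof. exact: measurable_funD. Qed.

Lemma conv_int s t (f : R -> \bar R) : (0 <= s)%R -> (0 <= t)%R ->
  measurable_fun setT f -> (forall x, 0 <= f x) ->
  \int[mu (s + t)%R]_x f x = \int[mu s]_x \int[mu t]_y f (x + y)%R.
Proof.
move=> s0 t0 mf f0.
rewrite -(ge0_integral_law madd (conv_law mu_conv s0 t0))//.
by rewrite (@fubini_tonelli1 _ _ _ _ _ _ _ (fun p : R * R => f (p.1 + p.2)%R))//; exact: measurableT_comp.
Qed.

Lemma conv_Rint s t F : (0 <= s)%R -> (0 <= t)%R -> bmeas F ->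
  (\int[mu (s + t)%R]_x F x = \int[mu s]_x \int[mu t]_y F (x + y))%R.
Proof.
move=> s0 t0 bF.
have bF' : bmeas (fun p : R * R => F (p.1 + p.2)%R) by exact: bmeas_comp.
rewrite (Rint_prod _ _ bF'); apply: EFin_inj; rewrite EFin_Rint//.
rewrite (EFin_Rint (mu s \x mu t : probability _ _))//.
rewrite -(integral_law madd (conv_law mu_conv s0 t0))//.
by apply: measurableT_comp => //; exact: bmeas_measurable.
Qed.

Lemma Pop_measurable (m : probability R R) F : measurable_fun setT F ->
  measurable_fun setT (Pop m F).
Proof.
move=> mF; apply: (@measurable_Rint _ _ _ _ _ m (fun p : R * R => F (p.2 + p.1)%R)).
by apply: measurableT_comp => //; exact: measurable_funD.
Qed.

Lemma Pop_bmeas (m : probability R R) F : bmeas F -> bmeas (Pop m F).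
Proof.
move=> bF; apply: (@bmeas_Rint _ _ _ _ _ m (fun p : R * R => F (p.2 + p.1)%R)).
by apply: bmeas_comp bF; exact: measurable_funD.
Qed.

Lemma PopB (m : probability R R) F H c : bmeas F -> bmeas H ->
  Pop m (fun x => F x - H x)%R c = (Pop m F c - Pop m H c)%R.
Proof.
by move=> bF bH; rewrite /Pop RintB//; apply: bmeas_comp => //; exact: measurable_addr.
Qed.

Lemma Pop_conv s h F c : (0 <= s)%R -> (0 <= h)%R -> bmeas F ->
  (Pop (mu (s + h)) F c = \int[mu h]_z Pop (mu s) F (c + z))%R.
Proof.
move=> s0 h0 bF; rewrite /Pop addrC.
have bFc : bmeas (fun a : R => F (a + c)%R) by apply: bmeas_comp bF; exact: measurable_addr.
apply: (etrans (conv_Rint h0 s0 bFc)).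
by apply: eq_Rintegral => z _; apply: eq_Rintegral => a _; congr F; ring.
Qed.

Lemma measurable_Delta2 d (S : measurableType d) F (f g : S -> R) : measurable_fun setT F ->
  measurable_fun setT f -> measurable_fun setT g ->
  measurable_fun setT (fun p => Delta (f p) F (g p)).
Proof.
move=> mF mf mg; apply: measurable_funB; last exact: (measurableT_comp mF mg).
by apply: (measurableT_comp mF); exact: measurable_funD.
Qed.

Lemma measurable_Pop_family (m : probability R R) (k : R * R -> R) : measurable_fun setT k ->
  measurable_fun setT (fun p : R * R => Pop m (fun z => k (p.1, z)) p.2).
Proof.
move=> mk; apply: (@measurable_Rint _ _ _ _ _ m (fun q : (R * R) * R => k (q.1.1, q.2 + q.1.2)%R)).
apply: (measurableT_comp mk); apply: measurable_fun_pair; first exact: measurableT_comp.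
by apply: measurable_funD => //; exact: measurableT_comp.
Qed.

Lemma measurable_Pop_Delta (m : probability R R) F : measurable_fun setT F ->
  measurable_fun setT (fun p : R * R => Pop m (Delta p.1 F) p.2).
Proof.
move=> mF; apply: (@measurable_Pop_family m (fun q => Delta q.1 F q.2)).
exact: measurable_Delta2.
Qed.

Definition phi t F := \int[mu (1 - t)%R]_c ((Pop (mu t) F c) ^+ 2)%:E.

(** The inner integral is a variance: by [Pop_conv] the subtracted term is the mean of P_s F (c + z)
    over z. *)
Definition Vform s h F := \int[mu (1 - (s + h))%R]_c \int[mu h]_z
  ((Pop (mu s) F (c + z) - Pop (mu (s + h)) F c) ^+ 2)%:E.

Let step s h F (p : R * R) : R :=
  ((Pop (mu s) F (p.1 + p.2) - Pop (mu (s + h)) F p.1) ^+ 2)%R.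

Let bmeas_step s h F : bmeas F -> bmeas (step s h F).
Proof.
move=> bF; apply: bmeasX; apply: bmeasB.
  by apply: bmeas_comp; [exact: madd|exact: Pop_bmeas].
by apply: bmeas_comp; [exact: measurable_fst|exact: Pop_bmeas].
Qed.

Let measurable_step s h F : bmeas F ->
  measurable_fun setT (fun c : R => \int[mu h]_z ((Pop (mu s) F (c + z) - Pop (mu (s + h)) F c) ^+ 2)%:E).
Proof.
move=> bF; apply: (@measurable_integral _ _ _ _ _ (mu h) (EFin \o step s h F)).
by apply/measurable_EFinP; case: (bmeas_step s h bF).
Qed.

(** Write Y_(1-s) as Y_(1-(s+h)) plus an independent increment z of length h. Given the first term,
    the second moment of P_s F splits into its variance in z, which gives V, and its squared mean,
    which is (P_(s+h) F)^2. *)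
Lemma phi_V s h F : (0 <= s)%R -> (0 <= h)%R -> (s + h <= 1)%R -> bmeas F ->
  phi s F = Vform s h F + phi (s + h) F.
Proof.
move=> s0 h0 sh bF; rewrite /phi /Vform.
have bW := Pop_bmeas (mu s) bF.
rewrite (_ : 1 - s = (1 - (s + h)) + h)%R; last by ring.
have mW2 : measurable_fun setT (fun c => ((Pop (mu s) F c) ^+ 2)%:E).
  by apply/measurable_EFinP/measurable_funX; case: bW.
rewrite conv_int ?subr_ge0//; last by move=> x; rewrite lee_fin sqr_ge0.
rewrite -ge0_integralD//; last first.
- by apply/measurable_EFinP/measurable_funX; case: (Pop_bmeas (mu (s + h)) bF).
- by move=> x _; rewrite lee_fin sqr_ge0.
- exact: measurable_step.
- by move=> x _; apply: integral_ge0 => y _; rewrite lee_fin sqr_ge0.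
apply: eq_integral => c _.
have bWc : bmeas (fun z => Pop (mu s) F (c + z)) by apply: bmeas_comp bW; exact: measurable_addl.
rewrite -EFin_Rint; last exact: bmeasX.
rewrite Rint_sqr// -(Pop_conv c s0 h0 bF) EFinD EFin_Rint//.
by apply: bmeasX; apply: bmeasB => //; exact: bmeas_cst.
Qed.

Lemma Vform_ge0 s h F : 0 <= Vform s h F.
Proof. by apply: integral_ge0 => c _; apply: integral_ge0 => z _; rewrite lee_fin sqr_ge0. Qed.

Lemma phi_ge0 t F : 0 <= phi t F.
Proof. by apply: integral_ge0 => c _; rewrite lee_fin sqr_ge0. Qed.

(* Jensen: P_{s+h} averages P_s over an independent increment. *)
Lemma Vform_mono s h F : (0 <= s)%R -> (0 <= h)%R -> (s + h + h <= 1)%R -> bmeas F ->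
  Vform (s + h) h F <= Vform s h F.
Proof.
move=> s0 h0 shh bF; rewrite /Vform.
pose psi c := \int[mu h]_z ((Pop (mu s) F (c + z) - Pop (mu (s + h)) F c) ^+ 2)%:E.
have mpsi : measurable_fun setT psi.
  exact: measurable_step.
have psi0 c : 0 <= psi c by apply: integral_ge0 => y _; rewrite lee_fin sqr_ge0.
(* The right-hand side is brought to the law of c on the left, at the price of one more
   increment. *)
rewrite -/(psi _) (_ : 1 - (s + h) = (1 - (s + h + h)) + h)%R; last by ring.
rewrite [leRHS]conv_int ?subr_ge0//.
apply: ge0_le_integral.
- exact: measurableT.
- by move=> c _; apply: integral_ge0 => y _; rewrite lee_fin sqr_ge0.
- exact: measurable_step.
- apply: (@measurable_integral _ _ _ _ _ (mu h) (fun p : R * R => psi (p.1 + p.2)%R)).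
  exact: (measurableT_comp mpsi madd).
move=> c _.
(* The extra increment is moved innermost: for each fixed step z, Jensen's inequality then applies
   to the average over it. *)
rewrite [leRHS](@fubini_tonelli _ _ _ _ _ (mu h) (mu h) (fun p : R * R =>
  ((Pop (mu s) F (c + p.1 + p.2) - Pop (mu (s + h)) F (c + p.1)) ^+ 2)%:E)); last 2 first.
- apply/measurable_EFinP/measurable_funX/measurable_funB; apply: measurableT_comp.
  + exact/bmeas_measurable/Pop_bmeas.
  + by apply: measurable_funD => //; exact: measurable_funD.
  + exact/bmeas_measurable/Pop_bmeas.
  + exact: measurable_funD.
- by move=> p; rewrite lee_fin sqr_ge0.
apply: ge0_le_integral.
- exact: measurableT.
- by move=> z _; rewrite lee_fin sqr_ge0.
- apply/measurable_EFinP/measurable_funX/measurable_funB => //; apply: measurableT_comp.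
  + exact/bmeas_measurable/Pop_bmeas.
  + exact: measurable_funD.
- apply: (@measurable_integral _ _ _ _ _ (mu h) (fun p : R * R =>
    ((Pop (mu s) F (c + p.2 + p.1) - Pop (mu (s + h)) F (c + p.2)) ^+ 2)%:E)).
  apply/measurable_EFinP/measurable_funX/measurable_funB; apply: measurableT_comp.
  + exact/bmeas_measurable/Pop_bmeas.
  + by apply: measurable_funD => //; exact: measurable_funD.
  + exact/bmeas_measurable/Pop_bmeas.
  + exact: measurable_funD.
move=> z _.
have bPs : bmeas (fun y => Pop (mu s) F (c + z + y)).
  by apply: bmeas_comp; [exact: measurable_addl|exact: Pop_bmeas].
have bPs' : bmeas (fun y => Pop (mu s) F (c + y + z)).
  by apply: (bmeas_comp (f := fun y => (c + y + z)%R)); [apply: measurable_funD => //; exact: measurable_addl|exact: Pop_bmeas].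
have bPsh : bmeas (fun y => Pop (mu (s + h)) F (c + y)).
  by apply: bmeas_comp; [exact: measurable_addl|exact: Pop_bmeas].
rewrite -EFin_Rint; last by apply: bmeasX; exact: bmeasB.
rewrite lee_fin Pop_conv// (@Pop_conv (s + h)%R)//; last exact: addr_ge0.
rewrite (_ : \int[mu h]_z0 _ = \int[mu h]_y Pop (mu s) F (c + y + z))%R; last first.
  by apply: eq_Rintegral => y _; congr Pop; ring.
by rewrite -RintB//; apply: sqr_Rint_le; exact: bmeasB.
Qed.

Lemma conv_zeroT (f : R -> \bar R) : measurable_fun setT f -> \int[mu 0%R]_x f x = f 0%R.
Proof.
move=> mf; rewrite integralE !(conv_zero mu_conv)//.
- by rewrite -[LHS]/((fun x => f^\+ x - f^\- x) 0%R) -funeposneg.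
- exact: measurable_funeneg.
- exact: measurable_funepos.
Qed.

Lemma Pop0 F c : measurable_fun setT F -> Pop (mu 0%R) F c = F c.
Proof.
move=> mF; rewrite /Pop /Rintegral conv_zeroT ?add0r//.
by apply/measurable_EFinP; apply: measurableT_comp => //; exact: measurable_addr.
Qed.

Lemma phi0 F : measurable_fun setT F -> phi 0 F = \int[mu 1%R]_x ((F x) ^+ 2)%:E.
Proof.
by move=> mF; rewrite /phi subr0; apply: eq_integral => c _; rewrite Pop0.
Qed.

Lemma Vform_bound h F k : (0 <= h)%R -> (k.+1%:R * h <= 1)%R -> bmeas F ->
  k.+1%:R%:E * Vform (k%:R * h) h F <= \int[mu 1%R]_x ((F x) ^+ 2)%:E.
Proof.
move=> h0 kh bF; rewrite -phi0; last exact: bmeas_measurable.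
(* Induction along the telescoping sum, with each of the first j + 1 decrements already replaced by
   the smallest one, that starting at k h. *)
suff H j : (j <= k)%N -> j.+1%:R%:E * Vform (k%:R * h) h F + phi (j.+1%:R * h) F <= phi 0 F.
  by apply: le_trans (H k _) => //; rewrite leeDl// phi_ge0.
have Vk i : (i <= k)%N -> Vform (k%:R * h) h F <= Vform (i%:R * h) h F.
  move=> jk; rewrite -(subnKC jk); set l := (k - i)%N.
  have : ((i + l).+1%:R * h <= 1)%R by rewrite subnKC.
  elim: l => [|l ih] hl; first by rewrite addn0.
  apply: le_trans (ih _); last by apply: le_trans hl; rewrite ler_wpM2r// ler_nat addnS.
  rewrite addnS -natr1 mulrDl mul1r; apply: Vform_mono => //; first by rewrite mulr_ge0.
  by move: hl; rewrite addnS -natr1 -[in X in (X + 1)%R]natr1 !mulrDl mul1r.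
elim: j => [|i ih] jk.
  rewrite mul1e mul1r [leRHS](@phi_V 0%R h)//; first by rewrite add0r leeD2r//; have := Vk 0%N jk; rewrite mul0r.
  by rewrite add0r; apply: le_trans kh; rewrite -[leLHS]mul1r ler_wpM2r// ler1n.
apply: le_trans (ih (ltnW jk)).
have e : (i.+1%:R * h + h = i.+2%:R * h)%R by rewrite -(natr1 i.+1) mulrDl mul1r.
rewrite [phi (i.+1%:R * h) F](@phi_V _ h)// ?mulr_ge0//; last first.
  by rewrite e; apply: le_trans kh; rewrite ler_wpM2r// ler_nat.
rewrite e [leRHS]addeA; apply: leeD2r; rewrite -(natr1 i.+1) EFinD ge0_muleDl ?lee_fin// mul1e leeD2l//.
exact: Vk.
Qed.

End semigroup.

(** * Levy exponents and characteristic functions *)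

Section trig_bounds.
Context (R : realType).
Implicit Types x u s : R.

Lemma mvt_between (f df : R -> R) (a b : R) :
  (forall x, is_derive x 1%R f (df x)) ->
  exists2 c, (Num.min a b <= c <= Num.max a b)%R & (f b - f a = df c * (b - a))%R.
Proof.
move=> fdf.
have cf x : {for x, continuous f}.
  by apply: differentiable_continuous; apply/derivable1_diffP; have [] := fdf x.
wlog ab : a b / (a <= b)%R => [H|].
  have /orP[/H//|/H[c]] := le_total a b.
  rewrite minC maxC => cab e; exists c => //.
  by rewrite -opprB e -mulrN opprB.
have [c] := MVT_segment ab (fun x _ => fdf x) (continuous_subspaceT cf).
by rewrite in_itv/= => cab e; exists c => //; rewrite min_l// max_r.
Qed.

Lemma ler_norm_sin x : (`|sin x| <= `|x|)%R.
Proof.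
have [c _ e] := @mvt_between sin cos 0 x (fun y => is_derive_sin y).
move: e; rewrite sin0 !subr0 => ->; rewrite normrM -[leRHS]mul1r ler_wpM2r//.
exact: cos_max.
Qed.

Lemma cos_sub1 x : (cos x - 1 = - (2 * sin (x / 2) ^+ 2))%R.
Proof.
rewrite -[in LHS](@mulfVK _ 2 _ x)// [in LHS]mulr_natr cos_mulr2n sin2cos2 -mulr_natl.
by ring.
Qed.

Lemma ler_norm_cos_sub1 x : (`|cos x - 1| <= x ^+ 2)%R.
Proof.
rewrite cos_sub1 normrN normrM normrX (ger0_norm (_ : 0 <= 2)%R)//.
have : (`|sin (x / 2)| ^+ 2 <= `|x / 2| ^+ 2)%R by rewrite lerXn2r ?nnegrE// ler_norm_sin.
rewrite !real_normK ?num_real// => h.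
have : (0 <= x ^+ 2)%R by exact: sqr_ge0.
move: h; rewrite expr_div_n; lra.
Qed.

(** The mean value theorem twice: |sin x - x| = |cos c - 1| |x| with c between 0 and x, and |cos c -
    1| <= |c|. *)
Lemma ler_norm_sin_sub x : (`|sin x - x| <= x ^+ 2)%R.
Proof.
have d (y : R) : is_derive y 1%R (fun y => sin y - y)%R (cos y - 1)%R.
  exact: is_deriveB.
have [c cx] := @mvt_between _ _ 0 x d.
rewrite sin0 !subr0 => ->; rewrite normrM -(real_normK (num_real x)) expr2 ler_wpM2r//.
have cx' : (`|c| <= `|x|)%R.
  move: cx; rewrite minEle maxEle; case: ifPn => x0 /andP[c1 c2].
    by rewrite !ger0_norm//; exact: le_trans c2.
  by move: x0; rewrite -ltNge => /ltW x0; rewrite !ler0_norm// lerN2.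
have [e _] := @mvt_between cos (fun y => - sin y)%R 0 c (fun y => is_derive_cos y).
rewrite cos0 subr0 => ->; rewrite normrM normrN.
by apply: le_trans cx'; rewrite -[leRHS]mul1r ler_wpM2r// sin_max.
Qed.

Lemma measurable_cos : measurable_fun setT (@cos R).
Proof. by apply: continuous_measurable_fun; exact: continuous_cos. Qed.

Lemma measurable_sin : measurable_fun setT (@sin R).
Proof. by apply: continuous_measurable_fun; exact: continuous_sin. Qed.

End trig_bounds.

(** The weight whose integral [levy_measure] makes finite; integrability under nu is derived below
    by domination by its multiples. *)
Definition lm_weight (R : realType) (u : R) : R := Num.min 1%R (u ^+ 2)%R.

Section levy_measure_facts.
Context (R : realType) (nu : {measure set R -> \bar R}) (nu_levy : levy_measure nu).
Implicit Types f : R -> R.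

Lemma lm_weight_ge0 (u : R) : (0 <= lm_weight u)%R.
Proof. by rewrite /lm_weight le_min ler01 sqr_ge0. Qed.

Lemma measurable_lm_weight : measurable_fun setT (@lm_weight R).
Proof. by apply: measurable_minr => //; exact: measurable_funX. Qed.

Lemma lm_weight_integrable : nu.-integrable setT (EFin \o @lm_weight R).
Proof.
apply/integrableP; split; first by apply/measurable_EFinP; exact: measurable_lm_weight.
rewrite (eq_integral (fun u : R => (Num.min 1 (u ^+ 2))%R%:E)); first by have [] := nu_levy.
by move=> u _; rewrite gee0_abs// lee_fin lm_weight_ge0.
Qed.

Lemma lm_integrable f (C : R) : measurable_fun setT f ->
  (forall u, `|f u| <= C * lm_weight u)%R -> nu.-integrable setT (EFin \o f).
Proof.
move=> mf fC.
apply: (@le_integrable _ _ _ nu setT measurableT _ (fun u => C%:E * (lm_weight u)%:E)).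
- exact/measurable_EFinP.
- by move=> u _; rewrite -EFinM /= lee_fin (le_trans (fC u))// ler_norm.
- exact: (integrableZl measurableT C lm_weight_integrable).
Qed.

(** The factor 2 + s^2 serves both regimes: 2 where the weight equals 1, and s^2 where it equals
    u^2. *)
Lemma lm_weight_scaled (s u : R) (y : R) : (`|y| <= 2)%R -> (`|y| <= (s * u) ^+ 2)%R ->
  (`|y| <= (2 + s ^+ 2) * lm_weight u)%R.
Proof.
move=> y2 ysu; rewrite /lm_weight minEle; case: ifPn => _.
  by rewrite mulr1 (le_trans y2)// lerDl sqr_ge0.
rewrite (le_trans ysu)// exprMn ler_wpM2r ?sqr_ge0// lerDr//.
Qed.

Definition cos1 (s u : R) : R := (cos (s * u) - 1)%R.
Definition sin1 (s u : R) : R := (sin (s * u) - (if `|u| <= 1 then s * u else 0))%R.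

Lemma cos1_bound s u : (`|cos1 s u| <= (2 + s ^+ 2) * lm_weight u)%R.
Proof.
apply: lm_weight_scaled; last exact: ler_norm_cos_sub1.
rewrite (le_trans (ler_normB _ _))// normr1; have := cos_max (s * u); lra.
Qed.

Lemma sin1_bound s u : (`|sin1 s u| <= (2 + s ^+ 2) * lm_weight u)%R.
Proof.
have s2 : (0 <= s ^+ 2)%R by exact: sqr_ge0.
rewrite /sin1; case: ifPn => u1.
  rewrite (le_trans (ler_norm_sin_sub _))// exprMn /lm_weight min_r; last first.
    by rewrite -(ger0_norm (sqr_ge0 u)) normrX expr_le1.
  by rewrite ler_wpM2r ?sqr_ge0// lerDr.
rewrite subr0 /lm_weight min_l ?mulr1; last first.
  by rewrite -(ger0_norm (sqr_ge0 u)) normrX exprn_ege1// ltW// ltNge.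
by rewrite (le_trans (sin_max _))//; lra.
Qed.

Lemma measurable_cos1 s : measurable_fun setT (cos1 s).
Proof.
apply: measurable_funB => //.
by apply: (measurableT_comp (@measurable_cos R)); exact: measurable_funM.
Qed.

Lemma measurable_sin1 s : measurable_fun setT (sin1 s).
Proof.
apply: measurable_funB.
  by apply: (measurableT_comp (@measurable_sin R)); exact: measurable_funM.
by apply: measurable_fun_ifT => //; apply: measurable_fun_ler => //; exact: measurableT_comp.
Qed.

Lemma cos1_integrable s : nu.-integrable setT (EFin \o cos1 s).
Proof. by apply: lm_integrable (cos1_bound s); exact: measurable_cos1. Qed.

Lemma sin1_integrable s : nu.-integrable setT (EFin \o sin1 s).
Proof. by apply: lm_integrable (sin1_bound s); exact: measurable_sin1. Qed.

Lemma lm_continuous (f : R -> R -> R) :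
  (forall s, measurable_fun setT (f s)) ->
  (forall u, continuous (f ^~ u)) ->
  (forall s u, `|f s u| <= (2 + s ^+ 2) * lm_weight u)%R ->
  continuous (fun s => \int[nu]_u f s u)%R.
Proof.
move=> mf cf fb s.
(* The domination has to be uniform near s: for |x| < B the factor 2 + x^2 is at most 2 + B^2. *)
pose B := (`|s| + 1)%R.
apply: (@continuity_under_integral _ _ _ nu f setT measurableT (- B)%R B _ _
  (fun u => (2 + B ^+ 2) * lm_weight u)%R).
- by move=> x _; exact: lm_integrable (fb x).
- by apply: aeW => u _ x _; exact: cf.
- exact: (integrableZl measurableT _ lm_weight_integrable).
- move=> x /=; rewrite in_itv/= => xB; apply: aeW => u _.
  rewrite (le_trans (fb x u))// ler_wpM2r ?lm_weight_ge0// lerD2l.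
  have /ltW xB' : (`|x| < B)%R by rewrite ltr_norml.
  rewrite -(ger0_norm (sqr_ge0 x)) normrX lerXn2r ?nnegrE//.
  by rewrite /B addr_ge0.
- by rewrite inE/= in_itv/= -ltr_norml /B ltrDl.
Qed.

Lemma continuous_re sigma : continuous (levy_exponent_re sigma nu).
Proof.
move=> s; apply: cvgD; last first.
  apply: (lm_continuous measurable_cos1 _ cos1_bound) => u x.
  apply: cvgB; last exact: cvg_cst.
  by apply: continuous_comp; [exact: mulrr_continuous|exact: continuous_cos].
apply: cvgN; apply: cvgMl; apply: cvgMr; exact: exprn_continuous.
Qed.

Lemma continuous_im b : continuous (levy_exponent_im b nu).
Proof.
move=> s; apply: cvgD; first exact: mulrl_continuous.
apply: (lm_continuous measurable_sin1 _ sin1_bound) => u x.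
apply: cvgB.
  by apply: continuous_comp; [exact: mulrr_continuous|exact: continuous_sin].
case: ifPn => _; [exact: mulrr_continuous|exact: cvg_cst].
Qed.

Lemma levy_exponent_re0 sigma : levy_exponent_re sigma nu 0 = 0%R.
Proof.
rewrite /levy_exponent_re expr0n mulr0 mul0r oppr0 add0r.
by under eq_Rintegral do rewrite mul0r cos0 subrr; rewrite /Rintegral integral0.
Qed.

Lemma levy_exponent_im0 b : levy_exponent_im b nu 0 = 0%R.
Proof.
rewrite /levy_exponent_im mulr0 add0r.
by under eq_Rintegral do rewrite mul0r sin0 if_same subrr; rewrite /Rintegral integral0.
Qed.

Lemma levy_exponent_reN sigma s :
  levy_exponent_re sigma nu (- s) = levy_exponent_re sigma nu s.
Proof.
rewrite /levy_exponent_re sqrrN; congr (_ + _)%R.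
by apply: eq_Rintegral => u _; rewrite mulNr cosN.
Qed.

Lemma levy_exponent_imN b s : levy_exponent_im b nu (- s) = (- levy_exponent_im b nu s)%R.
Proof.
rewrite /levy_exponent_im mulrN opprD; congr (_ + _)%R.
rewrite -[in RHS]mulN1r -RintegralZl//; last exact: (sin1_integrable s).
apply: eq_Rintegral => u _; rewrite mulNr sinN; case: ifP => _; ring.
Qed.

Lemma lm_weight_gt0 (u : R) : u != 0%R -> (0 < lm_weight u)%R.
Proof. by move=> u0; rewrite /lm_weight lt_min ltr01 exprn_even_gt0. Qed.

Lemma levy_ae_neq0 : {ae nu, forall u : R, u != 0%R}.
Proof.
exists [set 0%R]; split => //; first by have [] := nu_levy.
by move=> u /= /negP; rewrite negbK => /eqP.
Qed.

Lemma lm_weight_big_finite (a : R) : (0 < a)%R ->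
  nu [set u | a <= lm_weight u]%R < +oo.
Proof.
move=> a0; have [mw iw] := integrableP _ _ _ lm_weight_integrable.
have := le_integral_abse nu measurableT mw a0.
rewrite setTI (_ : [set x | a%:E <= `|(EFin \o lm_weight (R:=R)) x|] =
  [set u | a <= lm_weight u]%R); last first.
  by apply/seteqP; split => u /=; rewrite lee_fin ger0_norm ?lm_weight_ge0.
move=> /le_lt_trans/(_ iw).
case: (nu _) => [r| |]; rewrite ?ltry// ?ltNyr//.
by rewrite gt0_muley ?lte_fin// ltxx.
Qed.

Lemma measurable_lm_weight_ge (a : R) : measurable [set u | a <= lm_weight u]%R.
Proof.
rewrite -[X in measurable X]setTI.
have : measurable_fun setT (fun u : R => a <= lm_weight u)%R.
  by apply: measurable_fun_ler => //; exact: measurable_lm_weight.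
by move=> /(_ measurableT [set true]); apply.
Qed.

(** Fubini with nu requires this. Off the null set {0}, the line is exhausted by the sets where the
    weight is at least 1 / (k + 1), which have finite measure by Markov's inequality. *)
Lemma levy_sigma_finite : sigma_finite setT nu.
Proof.
have [nu0 _] := nu_levy.
exists (fun k => [set 0%R] `|` [set u | k.+1%:R^-1 <= lm_weight u]%R).
  apply/seteqP; split => // u _; have [->|u0] := eqVneq u 0%R.
    by exists 0%N => //; left.
  have w0 := lm_weight_gt0 u0.
  exists (Num.truncn ((lm_weight u)^-1)) => //; right => /=.
  rewrite -[leRHS]invrK lef_pV2 ?posrE ?invr_gt0 ?ltr0n//.
  by rewrite ltW// truncnS_gt.
move=> k; split; first by apply: measurableU => //; exact: measurable_lm_weight_ge.
rewrite (le_lt_trans (measureU2 _ _ _))//; first exact: measurable_lm_weight_ge.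
rewrite [X in X + _]nu0 add0e; apply: lm_weight_big_finite.
by rewrite invr_gt0 ltr0n.
Qed.

End levy_measure_facts.

Section characteristic_function.
Context (R : realType).

Definition chcos (m : probability R R) (s : R) : R := (\int[m]_x cos (s * x))%R.
Definition chsin (m : probability R R) (s : R) : R := (\int[m]_x sin (s * x))%R.

Lemma bmeas_cos (s th : R) : bmeas (fun x : R => cos (s * x + th)%R).
Proof.
split; last by exists 1%R => x; exact: cos_max.
apply: (measurableT_comp (@measurable_cos R)).
by apply: measurable_funD => //; exact: measurable_funM.
Qed.

Lemma bmeas_cos0 (s : R) : bmeas (fun x : R => cos (s * x)%R).
Proof. by have := bmeas_cos s 0; under eq_fun do rewrite addr0. Qed.

Lemma bmeas_sin0 (s : R) : bmeas (fun x : R => sin (s * x)%R).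
Proof.
split; last by exists 1%R => x; exact: sin_max.
by apply: (measurableT_comp (@measurable_sin R)); exact: measurable_funM.
Qed.

Lemma chcos_continuous m : continuous (chcos m).
Proof.
move=> s; apply: (@continuity_under_integral _ _ _ m (fun s x => cos (s * x)) setT
  measurableT (s - 1)%R (s + 1)%R _ _ (fun=> 1%R)).
- by move=> x _; exact/bmeas_integrable/bmeas_cos0.
- apply: aeW => u _ x _; apply: continuous_comp; first exact: mulrr_continuous.
  exact: continuous_cos.
- exact/bmeas_integrable/bmeas_cst.
- by move=> x _; apply: aeW => u _; exact: cos_max.
- by rewrite inE/= in_itv/= ltrBlDr ltrDl ltr01.
Qed.

Lemma chsin_continuous m : continuous (chsin m).
Proof.
move=> s; apply: (@continuity_under_integral _ _ _ m (fun s x => sin (s * x)) setT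
  measurableT (s - 1)%R (s + 1)%R _ _ (fun=> 1%R)).
- by move=> x _; exact/bmeas_integrable/bmeas_sin0.
- apply: aeW => u _ x _; apply: continuous_comp; first exact: mulrr_continuous.
  exact: continuous_sin.
- exact/bmeas_integrable/bmeas_cst.
- by move=> x _; apply: aeW => u _; exact: sin_max.
- by rewrite inE/= in_itv/= ltrBlDr ltrDl ltr01.
Qed.

Lemma Rint_cos_shift (m : probability R R) (s th : R) :
  (\int[m]_x cos (s * x + th) = chcos m s * cos th - chsin m s * sin th)%R.
Proof.
transitivity (\int[m]_x (cos th * cos (s * x) - sin th * sin (s * x)))%R.
  by apply: eq_Rintegral => x _; rewrite cosD; ring.
rewrite RintB; [|exact/bmeasZ/bmeas_cos0|exact/bmeasZ/bmeas_sin0].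
by rewrite (RintZ _ _ (bmeas_cos0 s)) (RintZ _ _ (bmeas_sin0 s)) -/(chcos m s) -/(chsin m s); ring.
Qed.

Lemma Rint_sin_shift (m : probability R R) (s th : R) :
  (\int[m]_x sin (s * x + th) = chsin m s * cos th + chcos m s * sin th)%R.
Proof.
transitivity (\int[m]_x (cos th * sin (s * x) + sin th * cos (s * x)))%R.
  by apply: eq_Rintegral => x _; rewrite sinD; ring.
rewrite RintD; [|exact/bmeasZ/bmeas_sin0|exact/bmeasZ/bmeas_cos0].
by rewrite (RintZ _ _ (bmeas_cos0 s)) (RintZ _ _ (bmeas_sin0 s)) -/(chcos m s) -/(chsin m s); ring.
Qed.

Variables (mu : R -> probability R R) (mu_conv : conv_semigroup mu).

Lemma chcos_conv t u s : (0 <= t)%R -> (0 <= u)%R ->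
  (chcos (mu (t + u)) s = chcos (mu t) s * chcos (mu u) s - chsin (mu t) s * chsin (mu u) s)%R.
Proof.
move=> t0 u0; apply: (etrans (conv_Rint mu_conv t0 u0 (bmeas_cos0 s))).
have e x : (\int[mu u]_y cos (s * (x + y)) =
    chcos (mu u) s * cos (s * x) - chsin (mu u) s * sin (s * x))%R.
  rewrite -Rint_cos_shift; apply: eq_Rintegral => y _; congr cos; ring.
under eq_Rintegral do rewrite e.
rewrite RintB; [|exact/bmeasZ/bmeas_cos0|exact/bmeasZ/bmeas_sin0].
by rewrite (RintZ _ _ (bmeas_cos0 s)) (RintZ _ _ (bmeas_sin0 s)) -/(chcos _ s) -/(chsin _ s); ring.
Qed.

Lemma chsin_conv t u s : (0 <= t)%R -> (0 <= u)%R ->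
  (chsin (mu (t + u)) s = chsin (mu t) s * chcos (mu u) s + chcos (mu t) s * chsin (mu u) s)%R.
Proof.
move=> t0 u0; apply: (etrans (conv_Rint mu_conv t0 u0 (bmeas_sin0 s))).
have e x : (\int[mu u]_y sin (s * (x + y)) =
    chsin (mu u) s * cos (s * x) + chcos (mu u) s * sin (s * x))%R.
  rewrite -Rint_sin_shift; apply: eq_Rintegral => y _; congr sin; ring.
under eq_Rintegral do rewrite e.
rewrite RintD; [|exact/bmeasZ/bmeas_cos0|exact/bmeasZ/bmeas_sin0].
by rewrite (RintZ _ _ (bmeas_cos0 s)) (RintZ _ _ (bmeas_sin0 s)) -/(chcos _ s) -/(chsin _ s); ring.
Qed.

Variables (re im : R -> R).
Hypotheses (re_cont : continuous re) (im_cont : continuous im).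
Hypotheses (re0 : re 0 = 0%R) (im0 : im 0 = 0%R).

Definition chf (t : R) := forall s, (chcos (mu t) s = expR (t * re s) * cos (t * im s))%R /\
  (chsin (mu t) s = expR (t * re s) * sin (t * im s))%R.

Lemma chf_add (t u : R) : (0 <= t)%R -> (0 <= u)%R -> chf t -> chf u -> chf (t + u).
Proof.
move=> t0 u0 ht hu s; rewrite chcos_conv// chsin_conv//.
have [-> ->] := ht s; have [-> ->] := hu s.
by rewrite !mulrDl expRD cosD sinD; split; ring.
Qed.

(* The quotient z of the two candidates for the characteristic function at time
   t satisfies z^2 = 1 and z(0) = 1, and it is continuous, hence z = 1. *)
Lemma chf_half (t : R) : (0 <= t)%R -> chf (t + t) -> chf t.
Proof.
move=> t0 h2.
pose e s := expR (- (t * re s)).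
pose c s := (e s * (chcos (mu t) s * cos (t * im s) + chsin (mu t) s * sin (t * im s)))%R.
pose d s := (e s * (chsin (mu t) s * cos (t * im s) - chcos (mu t) s * sin (t * im s)))%R.
have cs2 x : (cos x ^+ 2 + sin x ^+ 2 = 1 :> R)%R by exact: cos2Dsin2.
have ee s : (e s * expR (t * re s) = 1)%R by rewrite -expRD addNr expR0.
(* With z = c + i d, these are the real and imaginary parts of z^2 = 1. *)
have cd s : (c s ^+ 2 - d s ^+ 2 = 1)%R /\ (c s * d s = 0)%R.
  have [hc hs] := h2 s; move: hc hs; rewrite chcos_conv// chsin_conv// !mulrDl expRD cosD sinD.
  move: (cs2 (t * im s)%R) (ee s); rewrite /c /d.
  move: (chcos _ s) (chsin _ s) (cos _) (sin _) (e s) (expR _) => C S x y E X xy EX h1 h2'.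
  split.
    have -> : ((E * (C * x + S * y)) ^+ 2 - (E * (S * x - C * y)) ^+ 2 =
      E ^+ 2 * ((C * C - S * S) * (x * x - y * y) + (S * C + C * S) * (x * y + x * y)))%R by ring.
    rewrite h1 h2'.
    transitivity ((E * X) ^+ 2 * (x ^+ 2 + y ^+ 2) ^+ 2)%R; first by ring.
    by rewrite EX xy; ring.
  have -> : (E * (C * x + S * y) * (E * (S * x - C * y)) =
      E ^+ 2 / 2 * ((S * C + C * S) * (x * x - y * y) - (C * C - S * S) * (x * y + x * y)))%R by field.
  by rewrite h1 h2'; ring.
have c_cont : continuous c.
  move=> s; apply: cvgM.
    apply: (@continuous_comp _ _ _ (fun s => - (t * re s))%R (@expR R)); last exact: continuous_expR.
    by apply: cvgN; apply: cvgMr; exact: re_cont.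
  apply: cvgD; apply: cvgM.
  - exact: chcos_continuous.
  - apply: (@continuous_comp _ _ _ (fun s => t * im s)%R (@cos R)); last exact: continuous_cos.
    by apply: cvgMr; exact: im_cont.
  - exact: chsin_continuous.
  - apply: (@continuous_comp _ _ _ (fun s => t * im s)%R (@sin R)); last exact: continuous_sin.
    by apply: cvgMr; exact: im_cont.
(* A zero of c would give -(d s)^2 = 1. A continuous c without zeros and with c 0 = 1 stays positive
   by the intermediate value theorem; then c d = 0 forces d = 0, and c^2 = 1 forces c = 1. *)
have c0 s : c s != 0%R.
  apply/eqP => cs0; have [+ _] := cd s; rewrite cs0 expr0n sub0r => h.
  have := sqr_ge0 (d s); lra.
have cst0 : c 0%R = 1%R.
  rewrite /c /e /chcos /chsin im0 re0 !mulr0 oppr0 expR0 cos0 sin0 mulr0 addr0 mul1r mulr1.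
  by under eq_Rintegral do rewrite mul0r cos0; rewrite Rint_cst.
have cpos s : (0 < c s)%R.
  rewrite lt_neqAle eq_sym c0/= leNgt; apply/negP => cs.
  have [|s0|s0] := ltgtP s 0%R; last 2 first.
  - have [//|r _ cr] := @IVT _ c 0%R s 0%R (ltW s0) (continuous_subspaceT c_cont).
      by rewrite cst0 (min_r (ltW (lt_trans cs ltr01))) (max_l (ltW (lt_trans cs ltr01))) ltW// ler01.
    by move: (c0 r); rewrite cr eqxx.
  - by move: cs; rewrite s0 cst0 ltNge ler01.
  move=> s0; have [//|r _ cr] := @IVT _ c s 0%R 0%R (ltW s0) (continuous_subspaceT c_cont).
    by rewrite cst0 (min_l (ltW (lt_trans cs ltr01))) (max_r (ltW (lt_trans cs ltr01))) ltW// ler01.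
  by move: (c0 r); rewrite cr eqxx.
move=> s; have [cd1 cd0] := cd s.
have d0 : d s = 0%R.
  by move/eqP: cd0; rewrite mulf_eq0 (negbTE (c0 s)) => /eqP.
have c1 : c s = 1%R.
  move: cd1; rewrite d0 expr0n subr0 => /eqP; rewrite sqrf_eq1 => /orP[/eqP//|/eqP cN].
  by move: (cpos s); rewrite cN; lra.
move: (cs2 (t * im s)%R) (ee s) c1 d0; rewrite /c /d.
move: (chcos _ s) (chsin _ s) (cos _) (sin _) (e s) (expR _) => C S x y E X xy EX h1 h2'.
split.
  transitivity (X * x * (E * (C * x + S * y)) - X * y * (E * (S * x - C * y)))%R.
    transitivity ((E * X) * (C * (x ^+ 2 + y ^+ 2)))%R; first by rewrite EX xy; ring.
    by ring.
  by rewrite h1 h2'; ring.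
transitivity (X * y * (E * (C * x + S * y)) + X * x * (E * (S * x - C * y)))%R.
  transitivity ((E * X) * (S * (x ^+ 2 + y ^+ 2)))%R; first by rewrite EX xy; ring.
  by ring.
by rewrite h1 h2'; ring.
Qed.

Hypothesis chf1 : chf 1.

Lemma chf_dyadic (j k : nat) : chf (j.+1%:R / 2 ^+ k).
Proof.
have p2 i : (0 <= (2 ^+ i)^-1 :> R)%R by rewrite invr_ge0 exprn_ge0.
have hk : chf (2 ^+ k)^-1.
  elim: k => [|k ih]; first by rewrite expr0 invr1.
  apply: chf_half => //; rewrite (_ : _ + _ = (2 ^+ k)^-1)%R//.
  by rewrite exprS invfM -mulrDl; field.
elim: j => [|j ih]; first by rewrite mul1r.
rewrite -natr1 mulrDl mul1r; by apply: chf_add => //; rewrite mulr_ge0.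

Qed.

Hypothesis mu_right_cont : forall (t : R) (u : nat -> R) (s : R), (0 <= t)%R ->
  (forall k, t < u k)%R -> u k @[k --> \oo] --> t ->
  chcos (mu (u k)) s @[k --> \oo] --> chcos (mu t) s /\
  chsin (mu (u k)) s @[k --> \oo] --> chsin (mu t) s.

Lemma chfT t : (0 <= t)%R -> chf t.
Proof.
move=> t0 s.
(* The successor makes the dyadic approximation strictly larger than t, as right continuity
   demands. *)
pose u k : R := ((Num.truncn (t * 2 ^+ k)).+1%:R / 2 ^+ k)%R.
have p2 k : (0 < 2 ^+ k :> R)%R by rewrite exprn_gt0.
have tu k : (t < u k)%R by rewrite ltr_pdivlMr// truncnS_gt.
have ut k : (u k <= t + (2 ^+ k)^-1)%R.
  rewrite ler_pdivrMr// mulrDl mulVf ?gt_eqF// -natr1 lerD2r.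
  by rewrite truncn_le// mulr_ge0// ltW.
have cu : u k @[k --> \oo] --> t.
  apply: (@squeeze_cvgr _ _ _ _ (fun=> t) (fun k => t + (2 ^+ k)^-1)%R).
  - by apply: nearW => k; rewrite ltW//= ut.
  - exact: cvg_cst.
  rewrite -[X in _ --> X]addr0; apply: cvgD; first exact: cvg_cst.
  under eq_fun do rewrite -exprVn.
  by apply: cvg_expr; rewrite ger0_norm// invf_lt1// ltr1n.
have [hc hs] := mu_right_cont s t0 tu cu.
have ce : expR (u k * re s)%R @[k --> \oo] --> expR (t * re s)%R.
  apply: continuous_cvg; first exact: continuous_expR.
  exact: cvgMl.
have cc : cos (u k * im s)%R @[k --> \oo] --> cos (t * im s)%R.
  apply: continuous_cvg; first exact: continuous_cos.
  exact: cvgMl.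
have csn : sin (u k * im s)%R @[k --> \oo] --> sin (t * im s)%R.
  apply: continuous_cvg; first exact: continuous_sin.
  exact: cvgMl.
split.
  apply: (cvg_unique _ hc) => //.
  rewrite (_ : (fun k => _) = (fun k => expR (u k * re s) * cos (u k * im s))%R); first exact: cvgM.
  by apply/funext => k; rewrite (chf_dyadic _ _ s).1.
apply: (cvg_unique _ hs) => //.
rewrite (_ : (fun k => _) = (fun k => expR (u k * re s) * sin (u k * im s))%R); first exact: cvgM.
  by apply/funext => k; rewrite (chf_dyadic _ _ s).2.
Qed.

Lemma Rint_cos_mu t s th : (0 <= t)%R ->
  (\int[mu t]_x cos (s * x + th) = expR (t * re s) * cos (t * im s + th))%R.
Proof.
move=> t0; rewrite Rint_cos_shift (chfT t0 s).1 (chfT t0 s).2 cosD; ring.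
Qed.

End characteristic_function.

Lemma levy_conv_semigroup (R : realType) d (T : measurableType d) (P : probability T R)
    (Y : R -> {RV P >-> R}) : levy_process Y ->
  conv_semigroup (fun t => distribution P (Y t)).
Proof.
move=> YL; split => [s t s0 t0 E mE|f mf f0]; first exact: levy_conv.
exact: levy_zero.
Qed.

Lemma Rint_distribution (R : realType) d (T : measurableType d) (P : probability T R)
    (X : {RV P >-> R}) (F : R -> R) : measurable_fun setT F ->
  (\int[distribution P X]_x F x = \int[P]_w F (X w))%R.
Proof.
move=> mF; congr fine; apply/esym.
have mX : measurable_fun setT X by [].
apply: (integral_law mX (m := distribution P X)) => //; exact/measurable_EFinP.
Qed.

(** Right continuity of the paths passes to the characteristic functions by dominated
    convergence. *)
Lemma levy_right_cont (R : realType) d (T : measurableType d) (P : probability T R)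
    (Y : R -> {RV P >-> R}) : levy_process Y ->
  forall (t : R) (u : nat -> R) (s : R), (0 <= t)%R ->
    (forall k, t < u k)%R -> u k @[k --> \oo] --> t ->
    chcos (distribution P (Y (u k))) s @[k --> \oo] --> chcos (distribution P (Y t)) s /\
    chsin (distribution P (Y (u k))) s @[k --> \oo] --> chsin (distribution P (Y t)) s.
Proof.
move=> [_ _ _ YC] t u s t0 tu ut.
have cY : {ae P, forall w, Y (u k) w @[k --> \oo] --> Y t w}.
  apply: aeS YC => w [rc _]; have /cvg_at_rightP := rc t t0; exact.
have mc := bmeas_measurable (bmeas_cos0 s); have ms := bmeas_measurable (bmeas_sin0 s).
split.
  under eq_fun do rewrite /chcos (Rint_distribution _ mc).
  rewrite /chcos Rint_distribution//; apply: (@Rint_dct _ _ _ _ _ _ (fun=> 1%R)).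
  - by move=> k; exact: (measurableT_comp mc).
  - exact: (measurableT_comp mc).
  - exact/bmeas_integrable/bmeas_cst.
  - apply: aeS cY => w cw; apply: continuous_cvg; first exact: continuous_cos.
    exact: cvgMr.
  - by move=> k w; exact: cos_max.
under eq_fun do rewrite /chsin (Rint_distribution _ ms).
rewrite /chsin Rint_distribution//; apply: (@Rint_dct _ _ _ _ _ _ (fun=> 1%R)).
- by move=> k; exact: (measurableT_comp ms).
- exact: (measurableT_comp ms).
- exact/bmeas_integrable/bmeas_cst.
- apply: aeS cY => w cw; apply: continuous_cvg; first exact: continuous_sin.
  exact: cvgMr.
- by move=> k w; exact: sin_max.
Qed.

(** * Approximation by trigonometric polynomials *)

Section bernstein.
Context (R : realType).
Implicit Types (f g : nat -> R) (y : R).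
Local Open Scope ring_scope.

(* The expectation of f under the binomial law with parameters N and 'X. *)
Fixpoint bern (N : nat) (f : nat -> R) : {poly R} :=
  if N is N'.+1 then 'X * bern N' (fun k => f k.+1) + (1 - 'X) * bern N' f
  else (f 0%N)%:P.

Lemma bernS N f y :
  (bern N.+1 f).[y] = y * (bern N (fun k => f k.+1)).[y] + (1 - y) * (bern N f).[y].
Proof. by rewrite /= !hornerE. Qed.

Lemma bern_lin N f g (a : R) y :
  (bern N (fun k => f k + a * g k)).[y] = (bern N f).[y] + a * (bern N g).[y].
Proof.
elim: N f g => [|N ih] f g; first by rewrite /= !hornerC.
by rewrite !bernS (ih (fun k => f k.+1) (fun k => g k.+1)) ih; ring.
Qed.

Lemma bern_cst N (c : R) y : (bern N (fun=> c)).[y] = c.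
Proof. by elim: N => [|N ih]; rewrite ?hornerC// bernS ih; ring. Qed.

Lemma bern_le N f g y : 0 <= y <= 1 -> (forall k, (k <= N)%N -> f k <= g k) ->
  (bern N f).[y] <= (bern N g).[y].
Proof.
move=> /andP[y0 y1]; elim: N f g => [|N ih] f g fg; first by rewrite !hornerC fg.
rewrite !bernS lerD// ler_wpM2l ?subr_ge0//; apply: ih => k kN; apply: fg => //.
exact: leqW.
Qed.

(** Squared bias plus variance of the binomial law. The centre a is arbitrary because conditioning
    on the first trial moves it by 1. *)
Lemma bern_var N (a : R) y :
  (bern N (fun k => (k%:R - a) ^+ 2)).[y] = (N%:R * y - a) ^+ 2 + N%:R * y * (1 - y).
Proof.
elim: N a => [|N ih] a; first by rewrite hornerC; ring.
rewrite bernS ih.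
rewrite (_ : (fun k => (k.+1%:R - a) ^+ 2) = (fun k => (k%:R - (a - 1)) ^+ 2)).
  by rewrite ih -natr1; ring.
by apply/funext => k; rewrite -natr1; congr (_ ^+ 2); ring.
Qed.

(** Heine-Cantor with x in [0, 1] and y free, by the near-covering form of compactness: the radius
    runs along the filter of positive reals tending to 0. *)
Lemma uniform_continuity01 (g : R -> R) (e : R) : continuous g -> 0 < e ->
  exists2 dl : R, 0 < dl & forall x y, 0 <= x <= 1 -> `|x - y| < dl -> `|g x - g y| < e.
Proof.
move=> cg e0.
have /compact_near_coveringP cov := @segment_compact R 0 1.
have H (x : R) : `[0, 1]%classic x ->
    \forall x' \near x & dl \near 0^'+, forall y, `|x' - y| < dl -> `|g x' - g y| < e.
  move=> _; have /cvgrPdist_lt /(_ _ (divr_gt0 e0 (ltr0n R 2))) := cg x.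
  move=> /nbhs_ballP[r /= r0 xr].
  exists (ball x (r / 2), [set dl | dl < r / 2]) => /=.
    split; first by apply: nbhsx_ballx; rewrite divr_gt0.
    by apply: nbhs_right_lt; rewrite divr_gt0.
  move=> [x' dl] /= [xx' dlr] y x'y.
  have h1 : `|g x - g x'| < e / 2.
    by apply: xr; apply: lt_trans xx' _; rewrite ltr_pdivrMr// ltr_pMr// ltr1n.
  have h2 : `|g x - g y| < e / 2.
    apply: xr; rewrite /ball/= -(subrKA x') (le_lt_trans (ler_normD _ _))//.
    by rewrite [r]splitr ltrD//; exact: lt_trans dlr.
  rewrite -(subrKA (g x)) (le_lt_trans (ler_normD _ _))// [e]splitr ltrD//.
  by rewrite distrC.
have h : \forall dl \near (0 : R)^'+, `[0, 1]%classic `<=`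
    (fun x => forall y, `|x - y| < dl -> `|g x - g y| < e).
  by apply: (cov R (0 : R)^'+ (fun dl x => forall y, `|x - y| < dl -> `|g x - g y| < e)).
near (0 : R)^'+ => dl.
exists dl; first by near: dl; exact: nbhs_right_gt.
move=> x y x01; have hdl : `[0, 1]%classic `<=`
    (fun x => forall y, `|x - y| < dl -> `|g x - g y| < e) by near: dl.
by apply: hdl; rewrite /= in_itv.
Unshelve. all: by end_near. Qed.

Lemma weierstrass01 (g : R -> R) (e : R) : continuous g -> 0 < e ->
  exists q : {poly R}, forall y, 0 <= y <= 1 -> `|q.[y] - g y| <= e.
Proof.
move=> cg e0.
have [M gM] : exists M, forall x, 0 <= x <= 1 -> `|g x| <= M.
  have := @EVT_max R (fun x => `|g x|) 0 1 ler01.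
  case; first by apply: continuous_subspaceT => x; apply: cvg_norm; exact: cg.
  move=> c _ h; exists `|g c| => x x01; apply: h; by rewrite in_itv.
have M0 : 0 <= M by apply: le_trans (gM 0 _); rewrite ?lexx ?ler01.
have [dl dl0 gd] := uniform_continuity01 cg (divr_gt0 e0 (ltr0n R 2)).
(* N is large enough for the Chebyshev term 2 M / (dl^2 N) to be at most e / 2. *)
pose N := (Num.truncn (4 * M / (e * dl ^+ 2))).+1.
have N0 : (0 < N%:R :> R) by rewrite ltr0n.
exists (bern N (fun k => g (k%:R / N%:R))) => y y01.
(* Nodes close to y cost e / 2 by uniform continuity. For the others |k / N - y| / dl is at least 1,
   so its square can multiply the trivial bound 2 M; averaging that square gives the binomial
   variance. *)
have key k : (k <= N)%N ->
    `|g (k%:R / N%:R) - g y| <= e / 2 + 2 * M / dl ^+ 2 / N%:R ^+ 2 * (k%:R - N%:R * y) ^+ 2.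
  move=> kN; have k01 : 0 <= (k%:R / N%:R : R) <= 1.
    by rewrite divr_ge0//= ler_pdivrMr// mul1r ler_nat.
  have c0 : 0 <= 2 * M / dl ^+ 2 / N%:R ^+ 2 * (k%:R - N%:R * y) ^+ 2.
    by rewrite mulr_ge0 ?sqr_ge0// !divr_ge0 ?sqr_ge0// mulr_ge0.
  have [kd|kd] := ltP `|k%:R / N%:R - y| dl.
    by rewrite (le_trans (ltW (gd _ _ k01 kd)))// lerDl.
  rewrite (le_trans (ler_normB _ _))// (le_trans (lerD (gM _ k01) (gM _ y01)))//.
  have -> : 2 * M / dl ^+ 2 / N%:R ^+ 2 * (k%:R - N%:R * y) ^+ 2 =
      2 * M * ((`|k%:R / N%:R - y| / dl) ^+ 2).
    rewrite expr_div_n real_normK ?num_real//; field.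
    by rewrite !gt_eqF.
  have : 1 <= (`|k%:R / N%:R - y| / dl) ^+ 2 by rewrite exprn_ege1// ler_pdivlMr// mul1r.
  by nra.
have bnd : (bern N (fun k => e / 2 + 2 * M / dl ^+ 2 / N%:R ^+ 2 * (k%:R - N%:R * y) ^+ 2)).[y] <= e.
  rewrite (bern_lin N (fun=> e / 2)) bern_cst bern_var subrr expr0n add0r.
  have yy : y * (1 - y) <= 1 by nra.
  have NN : 4 * M / (e * dl ^+ 2) <= N%:R by rewrite ltW// truncnS_gt.
  have -> : 2 * M / dl ^+ 2 / N%:R ^+ 2 * (N%:R * y * (1 - y)) =
      (2 * M / dl ^+ 2 / N%:R) * (y * (1 - y)) by field; rewrite !gt_eqF.
  have h : 2 * M / dl ^+ 2 / N%:R <= e / 2.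
    rewrite ler_pdivrMr// ler_pdivrMr ?exprn_gt0//.
    move: NN; rewrite ler_pdivrMr; last by rewrite mulr_gt0// exprn_gt0.
    by nra.
  have h0 : 0 <= 2 * M / dl ^+ 2 / N%:R by rewrite !mulr_ge0// ?invr_ge0 ?sqr_ge0// ltW.
  by nra.
have dist : (bern N (fun k => g (k%:R / N%:R))).[y] - g y =
    (bern N (fun k => g (k%:R / N%:R) + -1 * g y)).[y].
  by rewrite (bern_lin N _ (fun=> g y)) bern_cst mulN1r.
rewrite dist ler_norml; apply/andP; split; last first.
  apply: le_trans bnd; apply: bern_le => // k kN.
  by rewrite mulN1r (le_trans (ler_norm _))// key.
rewrite lerNl; apply: le_trans bnd.
set u := fun k : nat => _.
have -> : - (bern N u).[y] = (bern N (fun k => 0 + -1 * u k)).[y].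
  by rewrite (bern_lin N (fun=> 0) u) bern_cst add0r mulN1r.
apply: bern_le => // k kN; rewrite /u add0r !mulN1r opprB.
by rewrite (le_trans (ler_norm _))// distrC key.
Qed.

Lemma antiderivative (q : {poly R}) : exists p : {poly R}, p^`() = q.
Proof.
exists (\poly_(i < (size q).+1) (q`_i.-1 / i%:R)).
apply/polyP => i; rewrite coef_deriv coef_poly ltnS /=.
case: ltnP => iq; last by rewrite mul0rn nth_default.
by rewrite -[LHS]mulr_natr mulfVK// pnatr_eq0.
Qed.

Lemma is_derive_horner (p : {poly R}) (x : R) :
  is_derive x 1 (fun x => p.[x]) (p^`().[x]).
Proof.
elim/poly_ind: p => [|p c ih].
  rewrite deriv0 horner0 (_ : (fun _ => _) = cst 0); first exact: is_derive_cst.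
  by apply/funext => y; rewrite horner0.
rewrite (_ : (fun _ => _) = (fun y => p.[y] * y + c)); last first.
  by apply/funext => y; rewrite !hornerE.
have h := is_deriveD (is_deriveM ih (is_derive_id x 1)) (is_derive_cst c x 1).
refine (is_derive_eq h _).
rewrite addr0 derivD derivC addr0 derivM derivX mulr1 !hornerE addrC.
by congr (_ + _); [exact: mulrC|exact: mulr1].
Qed.

End bernstein.

Section trigonometric_polynomials.
Context (R : realType).
Local Open Scope ring_scope.

(* A list of triples (a, s, th) stands for the sum of the waves
   x |-> a cos (s x + th). *)
Definition trig (l : seq (R * R * R)) (x : R) : R :=
  \sum_(p <- l) p.1.1 * cos (p.1.2 * x + p.2).

(** The formal derivative: -sin is cos advanced by pi / 2, which keeps derivatives within the same
    encoding. *)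
Definition dtrig (l : seq (R * R * R)) : seq (R * R * R) :=
  [seq (p.1.1 * p.1.2, p.1.2, p.2 + pi / 2) | p <- l].

Lemma cosDpihalf (x : R) : cos (x + pi / 2) = - sin x.
Proof. by rewrite cosD cos_pihalf sin_pihalf mulr0 mulr1 sub0r. Qed.

Lemma trig_nil x : trig [::] x = 0. Proof. by rewrite /trig big_nil. Qed.

Lemma trig_cons p l x : trig (p :: l) x = p.1.1 * cos (p.1.2 * x + p.2) + trig l x.
Proof. by rewrite /trig big_cons. Qed.

Lemma trig_cat l l' x : trig (l ++ l') x = trig l x + trig l' x.
Proof. by rewrite /trig big_cat. Qed.

Lemma is_derive_wave (a s th x : R) :
  is_derive x 1 (fun x => a * cos (s * x + th)) (a * s * cos (s * x + (th + pi / 2))).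
Proof.
have h1 : is_derive x 1 (fun x => s * x + th) (s * 1 + 0).
  by apply: is_deriveD; apply: is_deriveZ.
have h2 := is_derive1_comp (is_derive_cos _) h1.
have h3 := is_deriveZ a h2.
refine (is_derive_eq h3 _).
by rewrite addrA cosDpihalf mulr1 addr0 /=; change (a * (- sin (s * x + th) * s) = a * s * - sin (s * x + th)); ring.
Qed.

Lemma is_derive_trig l (x : R) : is_derive x 1 (trig l) (trig (dtrig l) x).
Proof.
elim: l => [|[[a s] th] l ih].
  rewrite trig_nil (_ : trig [::] = cst 0); first exact: is_derive_cst.
  by apply/funext => y; rewrite trig_nil.
rewrite (_ : trig _ = (fun y => a * cos (s * y + th)) + trig l); last first.
  by apply/funext => y; rewrite trig_cons.
rewrite /= trig_cons /=; apply: is_deriveD; exact: is_derive_wave.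
Qed.

Definition is_trig (F : R -> R) := exists l, forall x, F x = trig l x.

Lemma is_trig_cst c : is_trig (fun=> c).
Proof. by exists [:: (c, 0, 0)] => x; rewrite trig_cons trig_nil /= mul0r add0r cos0 mulr1 addr0. Qed.

Lemma is_trigD F H : is_trig F -> is_trig H -> is_trig (fun x => F x + H x).
Proof. by move=> [l Fl] [k Hk]; exists (l ++ k) => x; rewrite trig_cat Fl Hk. Qed.

Lemma is_trig_sum (I : Type) (r : seq I) (F : I -> R -> R) : (forall i, is_trig (F i)) ->
  is_trig (fun x => \sum_(i <- r) F i x).
Proof.
move=> tF; elim: r => [|i r ih].
  by under eq_fun do rewrite big_nil; exact: is_trig_cst.
by under eq_fun do rewrite big_cons; exact: is_trigD.
Qed.

Lemma cosMcos (a b : R) : cos a * cos b = (cos (a + b) + cos (a - b)) / 2.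
Proof. by rewrite cosD cosB; field. Qed.

Lemma is_trigM F H : is_trig F -> is_trig H -> is_trig (fun x => F x * H x).
Proof.
move=> [l Fl] [k Hk].
rewrite (_ : (fun _ => _) = (fun x => \sum_(p <- l) \sum_(q <- k)
    (p.1.1 * cos (p.1.2 * x + p.2)) * (q.1.1 * cos (q.1.2 * x + q.2)))); last first.
  apply/funext => x; rewrite Fl Hk /trig mulr_suml; apply: eq_bigr => p _.
  by rewrite mulr_sumr.
apply: is_trig_sum => p; apply: is_trig_sum => q.
exists [:: (p.1.1 * q.1.1 / 2, p.1.2 + q.1.2, p.2 + q.2);
           (p.1.1 * q.1.1 / 2, p.1.2 - q.1.2, p.2 - q.2)] => x.
rewrite !trig_cons trig_nil /= addr0.
rewrite (_ : (p.1.2 + q.1.2) * x + (p.2 + q.2) = (p.1.2 * x + p.2) + (q.1.2 * x + q.2)); last by ring.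
rewrite (_ : (p.1.2 - q.1.2) * x + (p.2 - q.2) = (p.1.2 * x + p.2) - (q.1.2 * x + q.2)); last by ring.
by rewrite mulrACA cosMcos; ring.
Qed.

Lemma is_trig_sin (s : R) : is_trig (fun x => sin (s * x)).
Proof.
exists [:: (1, s, - (pi / 2))] => x; rewrite trig_cons trig_nil /= addr0 mul1r.
by rewrite cosB cos_pihalf sin_pihalf mulr0 mulr1 add0r.
Qed.

Lemma is_trig_poly (p : {poly R}) (F : R -> R) : is_trig F -> is_trig (fun x => p.[F x]).
Proof.
move=> tF; elim/poly_ind: p => [|p c ih].
  by under eq_fun do rewrite horner0; exact: is_trig_cst.
under eq_fun do rewrite hornerMXaddC.
by apply: is_trigD; [exact: is_trigM|exact: is_trig_cst].
Qed.

(* The function t sin (x / t) stays in [-t, t], is close to x for large t, and a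
   polynomial in it is trigonometric. *)
Lemma trig_approx1 (F F' : R -> R) (t : R) : (0 < t) ->
  (forall x : R, is_derive x 1 F (F' x)) -> continuous F' ->
  exists l, forall x,
    `|trig l x - F (t * sin (t^-1 * x))| <= t^-1 /\
    `|trig (dtrig l) x - F' (t * sin (t^-1 * x)) * cos (t^-1 * x)| <= t^-1.
Proof.
move=> t0 dF cF'.
(* The error 1 / t controls the values, through the mean value theorem on [-1, 1]; the error 1
   suffices for the derivative, where the chain rule contributes a factor 1 / t. *)
have [q hq] : exists q : {poly R}, forall y : R, -1 <= y <= 1 -> `|q.[y] - t * F' (t * y)| <= Num.min 1 t^-1.
  have cg : continuous (fun x : R => t * F' (t * (2 * x - 1))).
    move=> x; apply: cvgMr; apply: (@continuous_comp _ _ _ (fun x : R => t * (2 * x - 1)) F'); last exact: cF'.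
    by apply: cvgMr; apply: cvgB; [exact: mulrl_continuous|exact: cvg_cst].
  have e0 : 0 < Num.min 1 t^-1 by rewrite lt_min ltr01 invr_gt0.
  have [q hq] := weierstrass01 cg e0.
  (* The affine map y |-> (y + 1) / 2 carries [-1, 1] to the interval [0, 1] of [weierstrass01]. *)
  exists (q \Po (2^-1 *: ('X + 1))) => y y1.
  have y01 : 0 <= 2^-1 * (y + 1) <= 1 by lra.
  have -> : (q \Po (2^-1 *: ('X + 1))).[y] = q.[2^-1 * (y + 1)].
    by rewrite horner_comp !hornerE.
  have := hq _ y01.
  by rewrite (_ : 2 * (2^-1 * (y + 1)) - 1 = y) //; field.
have [p0 dp0] := antiderivative q.
(* The constant of integration makes p and F (t y) agree at y = 0, where the mean value theorem
   starts. *)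
pose p := p0 + (F 0 - p0.[0])%:P.
have dp : p^`() = q by rewrite /p derivD derivC addr0.
have p00 : p.[0] = F 0 by rewrite /p hornerD hornerC addrC subrK.
have sin1 (x : R) : -1 <= sin x <= 1 by rewrite sin_geN1 sin_le1.
have pF y : -1 <= y <= 1 -> `|p.[y] - F (t * y)| <= t^-1.
  move=> y1.
  have d (z : R) : is_derive z 1 (fun y : R => p.[y] - F (t * y)) (q.[z] - t * F' (t * z)).
    apply: is_deriveB; first by rewrite -dp; exact: is_derive_horner.
    have h1 : is_derive (z : R) 1 (fun y : R => t * y) (t * 1) by apply: is_deriveZ.
    by have := is_derive1_comp (dF _) h1; rewrite mulr1 mulrC.
  have [c cy] := @mvt_between _ _ _ 0 y d.
  rewrite mulr0 p00 subrr !subr0 => ->.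
  have c1 : -1 <= c <= 1.
    move: cy; rewrite minEle maxEle; case: ifP => y0; lra.
  have := hq _ c1; rewrite le_min normrM => /andP[_ h].
  by rewrite -[leRHS]mulr1; apply: ler_pM => //; rewrite ler_norml.
have [l hl] := is_trig_poly p (is_trig_sin t^-1).
exists l => x; split; first by rewrite -hl; exact: pF.
have d1 : is_derive (x : R) 1 (trig l) (q.[sin (t^-1 * x)] * (cos (t^-1 * x) * t^-1)).
  rewrite (_ : trig l = (fun x : R => p.[x]) \o (fun x : R => sin (t^-1 * x))); last first.
    by apply/funext => y /=; rewrite -hl.
  apply: is_derive1_comp; first by rewrite -dp; exact: is_derive_horner.
  have h1 : is_derive (x : R) 1 (fun y : R => t^-1 * y) (t^-1 * 1) by apply: is_deriveZ.
  by have := is_derive1_comp (is_derive_sin _) h1; rewrite mulr1.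
have -> : trig (dtrig l) x = q.[sin (t^-1 * x)] * (cos (t^-1 * x) * t^-1).
  by have [_ <-] := is_derive_trig l x; have [_ <-] := d1.
have -> : q.[sin (t^-1 * x)] * (cos (t^-1 * x) * t^-1) -
    F' (t * sin (t^-1 * x)) * cos (t^-1 * x) =
    (q.[sin (t^-1 * x)] - t * F' (t * sin (t^-1 * x))) * cos (t^-1 * x) * t^-1.
  by field; rewrite gt_eqF.
have tn : `|t^-1| = t^-1 by rewrite ger0_norm// invr_ge0 ltW.
rewrite normrM tn.
rewrite -[leRHS]mul1r; apply: ler_wpM2r; first by rewrite invr_ge0 ltW.
rewrite normrM -[leRHS]mulr1; apply: ler_pM => //; last exact: cos_max.
by have := hq _ (sin1 (t^-1 * x)); rewrite le_min => /andP[].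
Qed.

End trigonometric_polynomials.

Section trig_approximation.
Context (R : realType).
Local Open Scope ring_scope.

Lemma cvg_invS : (fun j : nat => j.+1%:R^-1 : R) @ \oo --> (0 : R).
Proof. exact: cvg_harmonic. Qed.

(** Bounded pointwise convergence of the functions and of their derivatives is what dominated
    convergence asks for. The bound M + 1 comes from the errors 1 / t <= 1 for t = j + 1. *)
Lemma trig_approx (F F' : R -> R) (M : R) :
  (forall x : R, is_derive x 1 F (F' x)) -> continuous F' ->
  (forall x, `|F x| <= M) -> (forall x, `|F' x| <= M) ->
  exists l_ : nat -> seq (R * R * R),
    [/\ forall j x, `|trig (l_ j) x| <= M + 1,
        forall j x, `|trig (dtrig (l_ j)) x| <= M + 1,
        forall x, trig (l_ j) x @[j --> \oo] --> F x &
        forall x, trig (dtrig (l_ j)) x @[j --> \oo] --> F' x].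
Proof.
move=> dF cF' FM F'M.
have cF : continuous F.
  by move=> x; apply: differentiable_continuous; apply/derivable1_diffP; have [] := dF x.
pose t (j : nat) : R := j.+1%:R.
have t0 j : 0 < t j by rewrite ltr0n.
have [l_ hl] := choice (fun j => trig_approx1 (t0 j) dF cF').
have t1 j : (t j)^-1 <= 1 by rewrite invf_le1 ?ltr0n// ler1n.
(* The error is at most x^2 / t, by |sin y - y| <= y^2 at y = x / t. *)
have yx (x : R) : t j * sin ((t j)^-1 * x) @[j --> \oo] --> x.
  apply/cvgrPdist_le => e e0.
  have h : (fun j => x ^+ 2 * (t j)^-1) @ \oo --> (0 : R).
    by rewrite -[X in _ --> X](mulr0 (x ^+ 2)); apply: cvgMr; exact: cvg_invS.
  move/cvgrPdist_le : h => /(_ e e0); apply: filterS => j.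
  rewrite sub0r normrN; apply: le_trans; rewrite distrC.
  have -> : t j * sin ((t j)^-1 * x) - x = t j * (sin ((t j)^-1 * x) - (t j)^-1 * x).
    by rewrite mulrBr mulrA divff ?mul1r// gt_eqF.
  rewrite normrM (ger0_norm (ltW (t0 j))).
  have x2 : 0 <= x ^+ 2 * (t j)^-1 by rewrite mulr_ge0 ?sqr_ge0// invr_ge0 ltW.
  rewrite (ger0_norm x2).
  apply: (@le_trans _ _ (t j * ((t j)^-1 * x) ^+ 2)).
    by apply: ler_wpM2l; [exact: ltW|exact: ler_norm_sin_sub].
  by rewrite le_eqVlt; apply/orP; left; apply/eqP; field; rewrite gt_eqF.
have cx (x : R) : cos ((t j)^-1 * x) @[j --> \oo] --> (1 : R).
  rewrite -cos0; apply: continuous_cvg; first exact: continuous_cos.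
  by rewrite -[X in _ --> X](mul0r x); apply: cvgMl; exact: cvg_invS.
exists l_; split.
- move=> j x; have [h _] := hl j x.
  rewrite -(subrK (F (t j * sin ((t j)^-1 * x))) (trig (l_ j) x)).
  by rewrite (le_trans (ler_normD _ _))// addrC lerD// (le_trans h).
- move=> j x; have [_ h] := hl j x.
  rewrite -(subrK (F' (t j * sin ((t j)^-1 * x)) * cos ((t j)^-1 * x)) (trig (dtrig (l_ j)) x)).
  rewrite (le_trans (ler_normD _ _))// addrC lerD// ?(le_trans h)//.
  by rewrite normrM -[leRHS]mulr1; apply: ler_pM => //; exact: cos_max.
- move=> x.
  have h : F (t j * sin ((t j)^-1 * x)) @[j --> \oo] --> F x.
    by apply: continuous_cvg; [exact: cF|exact: yx].
  rewrite -[X in _ --> X](subr0 (F x)).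
  rewrite (_ : (fun j => _) = (fun j => F (t j * sin ((t j)^-1 * x)) -
     (F (t j * sin ((t j)^-1 * x)) - trig (l_ j) x))); last first.
    by apply/funext => j; rewrite opprB addrC subrK.
  apply: cvgB => //; apply/cvgrPdist_le => e e0.
  have := cvg_invS; move/cvgrPdist_le => /(_ e e0); apply: filterS => j.
  rewrite !sub0r !normrN; apply: le_trans; rewrite distrC.
  by have [h1 _] := hl j x; rewrite (le_trans h1)// ler_norm.
- move=> x.
  have h : F' (t j * sin ((t j)^-1 * x)) * cos ((t j)^-1 * x) @[j --> \oo] --> F' x.
    rewrite -[X in _ --> X]mulr1; apply: cvgM => //.
    by apply: continuous_cvg; [exact: cF'|exact: yx].
  rewrite -[X in _ --> X](subr0 (F' x)).
  rewrite (_ : (fun j => _) = (fun j => F' (t j * sin ((t j)^-1 * x)) * cos ((t j)^-1 * x) -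
     (F' (t j * sin ((t j)^-1 * x)) * cos ((t j)^-1 * x) - trig (dtrig (l_ j)) x))); last first.
    by apply/funext => j; rewrite opprB addrC subrK.
  apply: cvgB => //; apply/cvgrPdist_le => e e0.
  have := cvg_invS; move/cvgrPdist_le => /(_ e e0); apply: filterS => j.
  rewrite !sub0r !normrN; apply: le_trans; rewrite distrC.
  by have [_ h1] := hl j x; rewrite (le_trans h1)// ler_norm.
Qed.

End trig_approximation.

(** * The limit for trigonometric polynomials *)

Section has_integral.
Context (R : realType) d (T : measurableType d) (m : {measure set T -> \bar R}).
Implicit Types F H : T -> R.
Local Open Scope ring_scope.

(** Integrability travels with the value, so linear combinations are evaluated without separate side
    conditions. This matters under nu, where nonzero constants may fail to be integrable. *)
Definition has_int F (v : R) := m.-integrable setT (EFin \o F) /\ \int[m]_x F x = v.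

Lemma has_intD F H v w : has_int F v -> has_int H w ->
  has_int (fun x => F x + H x) (v + w).
Proof.
move=> [iF <-] [iH <-]; split; last by rewrite RintegralD.
have := integrableD measurableT iF iH.
by apply: eq_integrable.
Qed.

Lemma has_intZ F v k : has_int F v -> has_int (fun x => k * F x) (k * v).
Proof.
move=> [iF <-]; split; last by rewrite RintegralZl.
have := integrableZl measurableT k iF.
by apply: eq_integrable.
Qed.

Lemma has_intB F H v w : has_int F v -> has_int H w ->
  has_int (fun x => F x - H x) (v - w).
Proof.
move=> hF /(has_intZ (-1)) hH; have := has_intD hF hH.
by rewrite mulN1r; under eq_fun do rewrite mulN1r.
Qed.

Lemma has_int_sum (I : Type) (r : seq I) (F : I -> T -> R) (v : I -> R) :
  (forall i, has_int (F i) (v i)) ->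
  has_int (fun x => \sum_(i <- r) F i x) (\sum_(i <- r) v i).
Proof.
move=> hF; elim: r => [|i r ih].
  rewrite big_nil; under eq_fun do rewrite big_nil.
  by split; [exact: integrable0|rewrite /Rintegral integral0].
by rewrite big_cons; under eq_fun do rewrite big_cons; exact: has_intD.
Qed.

Lemma has_intE F v : has_int F v -> (\int[m]_x (F x)%:E = v%:E)%E.
Proof.
by move=> [iF <-]; rewrite /Rintegral fineK//; exact: integrable_fin_num.
Qed.

End has_integral.

Section difference_quotient.
Context (R : realType).
Local Open Scope ring_scope.

(** The base point s m moves, so the derivative is taken at an intermediate point of
    [s m, s m + h m], which tends to a; continuity of [df] at a concludes. *)
Lemma cvg_difference_quotient (f df : R -> R) (a : R) (s h c : nat -> R) :
  (forall x : R, is_derive x 1 f (df x)) -> {for a, continuous df} ->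
  (forall m, 0 <= h m) ->
  s @ \oo --> a -> h @ \oo --> (0 : R) -> c m * h m @[m --> \oo] --> (1 : R) ->
  c m * (f (s m) - f (s m + h m)) @[m --> \oo] --> - df a.
Proof.
move=> fdf cdf h_ge0 sa h0 ch.
have /choice[xi hxi] : forall m, exists xi, s m <= xi <= s m + h m /\
    f (s m + h m) - f (s m) = df xi * h m.
  move=> m; have [xi] := @mvt_between _ f df (s m) (s m + h m) fdf.
  rewrite min_l ?lerDl// max_r ?lerDl// => xim e; exists xi; split => //.
  by rewrite e; congr (_ * _); ring.
have xia : xi @ \oo --> a.
  apply: (@squeeze_cvgr _ _ _ _ s (fun m => s m + h m)) => //.
    by apply: nearW => m; have [] := hxi m.
  by rewrite -[X in _ --> X]addr0; exact: cvgD.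
rewrite (_ : (fun m => _) = (fun m => - (df (xi m) * (c m * h m)))); last first.
  by apply/funext => m; rewrite -opprB (hxi m).2; ring.
apply: cvgN; rewrite -[X in _ --> X]mulr1; apply: cvgM => //.
by apply: continuous_cvg; [exact: cdf|exact: xia].
Qed.

End difference_quotient.

Section trig_forms.
Context (R : realType) (mu : R -> probability R R) (mu_conv : conv_semigroup mu).
Variables (nu : {measure set R -> \bar R}) (nu_levy : levy_measure nu) (b sigma : R).
Let re := levy_exponent_re sigma nu.
Let im := levy_exponent_im b nu.
Hypothesis mu_cos : forall t s th : R, (0 <= t)%R ->
  (\int[mu t]_x cos (s * x + th) = expR (t * re s) * cos (t * im s + th))%R.
Local Open Scope ring_scope.

Let reN s : re (- s) = re s. Proof. exact: levy_exponent_reN. Qed.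
Let imN s : im (- s) = - im s. Proof. exact: levy_exponent_imN. Qed.

(** Complex exponentials are eigenfunctions of P_t with eigenvalue exp (t psi s): on a wave, the
    real part of t psi rescales the amplitude and the imaginary part shifts the phase. *)
Definition ptrig (t : R) (l : seq (R * R * R)) : seq (R * R * R) :=
  [seq (p.1.1 * expR (t * re p.1.2), p.1.2, p.2 + t * im p.1.2) | p <- l].

Lemma bmeas_trig (l : seq (R * R * R)) : bmeas (trig l).
Proof. by apply: bmeas_sum => p; apply: bmeasZ; exact: bmeas_cos. Qed.

Lemma Pop_trig t l c : 0 <= t -> Pop (mu t) (trig l) c = trig (ptrig t l) c.
Proof.
move=> t0; rewrite /Pop /trig Rint_sum; last first.
  move=> p; apply: bmeasZ.
  rewrite (_ : (fun _ => _) = (fun x => cos (p.1.2 * x + (p.1.2 * c + p.2)))); first exact: bmeas_cos.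
  by apply/funext => x; rewrite mulrDr addrA.
rewrite big_map; apply: eq_bigr => p _ /=.
rewrite (_ : (fun x => p.1.1 * cos (p.1.2 * (x + c) + p.2)) =
  (fun x => p.1.1 * cos (p.1.2 * x + (p.1.2 * c + p.2)))); last first.
  by apply/funext => x; rewrite mulrDr addrA.
rewrite RintZ; last exact: bmeas_cos.
by rewrite mu_cos// -mulrA; congr (_ * (_ * cos _)); ring.
Qed.

(* For X, X' independent copies of Y_t and Z of Y_(1-t), this is the value of
   E cos (s (X + Z) + s' (X' + Z) + z). *)
Definition cexp (s s' t : R) : R := t * re s + t * re s' + (1 - t) * re (s + s').
Definition cang (s s' z t : R) : R := z + t * im s + t * im s' + (1 - t) * im (s + s').
Definition cPhi (s s' z t : R) : R := expR (cexp s s' t) * cos (cang s s' z t).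

Definition cdPhi (s s' z t : R) : R :=
  expR (cexp s s' t) * ((re s + re s' - re (s + s')) * cos (cang s s' z t) -
    (im s + im s' - im (s + s')) * sin (cang s s' z t)).

Lemma is_derive_cPhi s s' z (t : R) : is_derive t 1 (cPhi s s' z) (cdPhi s s' z t).
Proof.
have he : is_derive t 1 (cexp s s') (re s + re s' - re (s + s')).
  rewrite (_ : cexp s s' = (fun t => (re s + re s' - re (s + s')) * t + re (s + s'))); last first.
    by apply/funext => x; rewrite /cexp; ring.
  rewrite -[X in is_derive _ _ _ X]addr0; apply: is_deriveD.
  by rewrite -[X in is_derive _ _ _ X]mulr1; apply: is_deriveZ.
have ha : is_derive t 1 (cang s s' z) (im s + im s' - im (s + s')).
  rewrite (_ : cang s s' z = (fun t => (im s + im s' - im (s + s')) * t + (z + im (s + s')))); last first.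
    by apply/funext => x; rewrite /cang; ring.
  rewrite -[X in is_derive _ _ _ X]addr0; apply: is_deriveD.
  by rewrite -[X in is_derive _ _ _ X]mulr1; apply: is_deriveZ.
have h1 := is_derive1_comp (is_derive_expR _) he.
have h2 := is_derive1_comp (is_derive_cos _) ha.
refine (is_derive_eq (is_deriveM h1 h2) _).
rewrite /cdPhi /=.
change (expR (cexp s s' t) * (- sin (cang s s' z t) * (im s + im s' - im (s + s'))) +
  cos (cang s s' z t) * (expR (cexp s s' t) * (re s + re s' - re (s + s'))) = 
  expR (cexp s s' t) * ((re s + re s' - re (s + s')) * cos (cang s s' z t) -
    (im s + im s' - im (s + s')) * sin (cang s s' z t))).
by ring.
Qed.

Lemma continuous_cdPhi s s' z : continuous (cdPhi s s' z).
Proof.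
move=> t.
have ce : continuous (cexp s s').
  move=> x; apply: cvgD; [apply: cvgD; apply: cvgMl; exact: cvg_id|].
  by apply: cvgMl; apply: cvgB; [exact: cvg_cst|exact: cvg_id].
have ca : continuous (cang s s' z).
  move=> x; apply: cvgD; last by apply: cvgMl; apply: cvgB; [exact: cvg_cst|exact: cvg_id].
  apply: cvgD; last by apply: cvgMl; exact: cvg_id.
  by apply: cvgD; [exact: cvg_cst|apply: cvgMl; exact: cvg_id].
apply: cvgM; first by apply: continuous_comp; [exact: ce|exact: continuous_expR].
apply: cvgB; apply: cvgMr.
  by apply: continuous_comp; [exact: ca|exact: continuous_cos].
by apply: continuous_comp; [exact: ca|exact: continuous_sin].
Qed.

(** A bilinear functional evaluated on two trigonometric polynomials: by the product formula for
    cosines, each pair of waves contributes at the frequencies s + s' and s - s', the latter written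
    as V at -s'. *)
Definition pairsum (l k : seq (R * R * R)) (V : R -> R -> R -> R) : R :=
  \sum_(p <- l) \sum_(q <- k) p.1.1 * q.1.1 / 2 *
    (V p.1.2 q.1.2 (p.2 + q.2) + V p.1.2 (- q.1.2) (p.2 - q.2)).

Lemma trig_prod_int l t : 0 <= t -> t <= 1 ->
  \int[mu (1 - t)]_c (Pop (mu t) (trig l) c) ^+ 2 =
  pairsum l l (fun s s' z => cPhi s s' z t).
Proof.
move=> t0 t1.
pose w (p : R * R * R) (x : R) := p.1.1 * cos (p.1.2 * x + p.2).
have bw p : bmeas (w p) by apply: bmeasZ; exact: bmeas_cos.
rewrite (_ : (fun c => (Pop (mu t) (trig l) c) ^+ 2) = (fun c =>
    \sum_(p <- ptrig t l) \sum_(q <- ptrig t l) w p c * w q c)); last first.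
  apply/funext => c; rewrite Pop_trig// expr2 {1}/trig mulr_suml; apply: eq_bigr => p _.
  by rewrite mulr_sumr.
rewrite Rint_sum; last by move=> p; apply: bmeas_sum => q; exact: bmeasM.
rewrite /pairsum big_map; apply: eq_bigr => -[[a s] th] _ /=.
rewrite Rint_sum; last by move=> q; exact: bmeasM.
rewrite big_map; apply: eq_bigr => -[[a' s'] th'] _ /=.
rewrite /w /=.
set A := a * _; set A' := a' * _; set T1 := th + _; set T2 := th' + _.
transitivity (\int[mu (1 - t)]_x (A * A' / 2 * (cos ((s + s') * x + (T1 + T2)) +
    cos ((s - s') * x + (T1 - T2)))))%R.
  apply: eq_Rintegral => x _; rewrite mulrACA cosMcos.
  rewrite (_ : (s + s') * x + (T1 + T2) = (s * x + T1) + (s' * x + T2)); last by ring.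
  by rewrite (_ : (s - s') * x + (T1 - T2) = (s * x + T1) - (s' * x + T2)); [field|ring].
rewrite RintZ; last by apply: bmeasD; exact: bmeas_cos.
rewrite RintD; [|exact: bmeas_cos|exact: bmeas_cos].
rewrite !mu_cos ?subr_ge0// /cPhi /cexp reN.
rewrite (_ : (1 - t) * im (s + s') + (T1 + T2) = cang s s' (th + th') t); last first.
  by rewrite /cang /T1 /T2; ring.
rewrite (_ : (1 - t) * im (s - s') + (T1 - T2) = cang s (- s') (th - th') t); last first.
  by rewrite /cang /T1 /T2 imN; ring.
by rewrite /A /A' !expRD; ring.
Qed.

Lemma eq_pairsum l k V W : (forall s s' z, V s s' z = W s s' z) ->
  pairsum l k V = pairsum l k W.
Proof.
by move=> VW; apply: eq_bigr => p _; apply: eq_bigr => q _; rewrite !VW.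
Qed.

Lemma pairsumD l k V W :
  pairsum l k V + pairsum l k W = pairsum l k (fun s s' z => V s s' z + W s s' z).
Proof.
rewrite /pairsum -big_split; apply: eq_bigr => p _.
by rewrite -big_split; apply: eq_bigr => q _ /=; ring.
Qed.

Lemma pairsumZ c l k V : c * pairsum l k V = pairsum l k (fun s s' z => c * V s s' z).
Proof.
rewrite /pairsum mulr_sumr; apply: eq_bigr => p _.
by rewrite mulr_sumr; apply: eq_bigr => q _; ring.
Qed.

Let cvg_seqsum (I : Type) (r : seq I) (f : nat -> I -> R) (g : I -> R) :
  (forall i, f m i @[m --> \oo] --> g i) ->
  \sum_(i <- r) f m i @[m --> \oo] --> \sum_(i <- r) g i.
Proof.
move=> fg; elim: r => [|i r ih].
  by rewrite big_nil; under eq_fun do rewrite big_nil; exact: cvg_cst.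
by rewrite big_cons; under eq_fun do rewrite big_cons; exact: cvgD.
Qed.

Lemma cvg_pairsum l k (V : nat -> R -> R -> R -> R) W :
  (forall s s' z, V m s s' z @[m --> \oo] --> (W s s' z : R)) ->
  pairsum l k (V m) @[m --> \oo] --> pairsum l k W.
Proof.
move=> VW; apply: cvg_seqsum => p; apply: cvg_seqsum => q.
by apply: cvgMr; apply: cvgD; exact: VW.
Qed.

Lemma has_int_pairsum l k (V : R -> R -> R -> R -> R) W :
  (forall s s' z, has_int nu (fun u => V u s s' z) (W s s' z)) ->
  has_int nu (fun u => pairsum l k (V u)) (pairsum l k W).
Proof.
move=> VW; apply: has_int_sum => p; apply: has_int_sum => q.
by apply: has_intZ; exact: has_intD.
Qed.

Lemma Vform_trig l s h : 0 <= s -> 0 <= h -> s + h <= 1 ->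
  Vform mu s h (trig l) =
  (pairsum l l (fun s1 s2 z => cPhi s1 s2 z s - cPhi s1 s2 z (s + h)))%:E.
Proof.
move=> s0 h0 sh.
have phiE t : 0 <= t -> t <= 1 ->
    phi mu t (trig l) = (pairsum l l (fun s s' z => cPhi s s' z t))%:E.
  move=> t0 t1; rewrite -trig_prod_int// EFin_Rint//.
  by apply: bmeasX; apply: Pop_bmeas; exact: bmeas_trig.
have := phi_V mu_conv s0 h0 sh (bmeas_trig l).
rewrite !phiE// ?addr_ge0//; last by rewrite (le_trans _ sh)// lerDl.
move=> e; have : (Vform mu s h (trig l) \is a fin_num)%E.
  rewrite ge0_fin_numE ?Vform_ge0// ltey; apply/eqP => V.
  by move: e; rewrite V.
move=> /fineK V; move: e; rewrite -V -EFinD => -[e]; congr EFin.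
rewrite (_ : pairsum l l _ = pairsum l l (fun s1 s2 z => cPhi s1 s2 z s) +
  -1 * pairsum l l (fun s1 s2 z => cPhi s1 s2 z (s + h))).
  by rewrite e; ring.
by rewrite pairsumZ pairsumD; apply: eq_pairsum => *; rewrite mulN1r.
Qed.

Lemma trig_limit l (a : R) (s h c : nat -> R) :
  (forall m, 0 <= s m) -> (forall m, 0 <= h m) -> (forall m, s m + h m <= 1) ->
  s @ \oo --> a -> h @ \oo --> (0 : R) -> c m * h m @[m --> \oo] --> (1 : R) ->
  ((c m)%:E * Vform mu (s m) (h m) (trig l))%E @[m --> \oo] -->
  (pairsum l l (fun s s' z => - cdPhi s s' z a))%:E.
Proof.
move=> s0 h0 sh sa ha ch.
rewrite (_ : (fun m => _) = (fun m => (pairsum l l (fun s1 s2 z =>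
   c m * (cPhi s1 s2 z (s m) - cPhi s1 s2 z (s m + h m))))%:E)); last first.
  by apply/funext => m; rewrite Vform_trig// -EFinM pairsumZ.
apply: cvg_EFin; first exact: nearW.
apply: cvg_pairsum => s1 s2 z.
apply: cvg_difference_quotient => //; first exact: is_derive_cPhi.
exact: continuous_cdPhi.
Qed.

(** Given the common part c, distributed as Y''_(1-a), the variables Y_a and Y'_a are independent
    with the same law, so the expectation of F (Y_a + c) F (Y'_a + c) is a squared [Pop]. [Lgauss]
    and [Ljump] are the two parts of the limit in this form. *)
Definition Lgauss (a : R) (F' : R -> R) : \bar R :=
  (sigma%:E * \int[mu (1 - a)]_c ((Pop (mu a) F' c) ^+ 2)%:E)%E.

Definition Ljump (a : R) (F : R -> R) : \bar R :=
  (\int[nu]_u \int[mu (1 - a)]_c ((Pop (mu a) (Delta u F) c) ^+ 2)%:E)%E.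

Lemma cPhi_pi s s' z t : cPhi s s' (z + pi) t = - cPhi s s' z t.
Proof.
rewrite /cPhi (_ : cang s s' (z + pi) t = cang s s' z t + pi); last by rewrite /cang; ring.
by rewrite cosD cospi sinpi mulr0 subr0 mulrN1 mulrN.
Qed.

Lemma phi_trigE l a : 0 <= a -> a <= 1 ->
  (\int[mu (1 - a)]_c ((Pop (mu a) (trig l) c) ^+ 2)%:E =
   (pairsum l l (fun s s' z => cPhi s s' z a))%:E)%E.
Proof.
move=> a0 a1; rewrite -trig_prod_int// EFin_Rint//.
by apply: bmeasX; apply: Pop_bmeas; exact: bmeas_trig.
Qed.

(** The two phase shifts pi / 2 add up to pi at frequency s + s', which changes the sign, and cancel
    at s - s', where the sign is that of -s'. Both cases are covered by the factor - sigma s s'. *)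
Lemma Lgauss_trig l a : 0 <= a -> a <= 1 ->
  Lgauss a (trig (dtrig l)) = (pairsum l l (fun s s' z => - (sigma * s * s') * cPhi s s' z a))%:E.
Proof.
move=> a0 a1; rewrite /Lgauss phi_trigE// -EFinM; congr EFin.
rewrite /pairsum big_map mulr_sumr; apply: eq_bigr => -[[x s] th] _.
rewrite big_map mulr_sumr; apply: eq_bigr => -[[y s'] th'] _ /=.
rewrite (_ : th + pi / 2 + (th' + pi / 2) = th + th' + pi); last by field.
rewrite (_ : th + pi / 2 - (th' + pi / 2) = th - th'); last by ring.
by rewrite cPhi_pi; ring.
Qed.

(** The list k is a shifted copy of l followed by a negated copy; the four terms are the products of
    shifted and unshifted waves. *)
Lemma Delta_trig l u : exists k, Delta u (trig l) = trig k /\ forall V,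
  pairsum k k V = pairsum l l (fun s s' z =>
    V s s' (z + (s + s') * u) - V s s' (z + s * u) - V s s' (z + s' * u) + V s s' z).
Proof.
pose sh (p : R * R * R) := (p.1.1, p.1.2, p.2 + p.1.2 * u).
pose ng (p : R * R * R) := (- p.1.1, p.1.2, p.2).
exists (map sh l ++ map ng l); split.
  apply/funext => x; rewrite /Delta trig_cat /trig !big_map; congr (_ + _).
    by apply: eq_bigr => p _ /=; congr (_ * cos _); ring.
  by rewrite -sumrN; apply: eq_bigr => p _ /=; rewrite mulNr.
move=> V; rewrite /pairsum big_cat/= !big_map -big_split/=; apply: eq_bigr => -[[x s] th] _ /=.
rewrite !big_cat/= !big_map -!big_split/=; apply: eq_bigr => -[[y s'] th'] _ /=.
rewrite (_ : th + s * u + (th' + s' * u) = th + th' + (s + s') * u); last by ring.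
rewrite (_ : th + s * u + th' = th + th' + s * u); last by ring.
rewrite (_ : th + (th' + s' * u) = th + th' + s' * u); last by ring.
rewrite (_ : th + s * u - (th' + s' * u) = th - th' + (s - s') * u); last by ring.
rewrite (_ : th + s * u - th' = th - th' + s * u); last by ring.
rewrite (_ : th - (th' + s' * u) = th - th' + (- s') * u); last by ring.
by ring.
Qed.

Lemma has_int_cos1 s : has_int nu (cos1 s) (re s + sigma * s ^+ 2 / 2).
Proof.
split; first exact: cos1_integrable.
by rewrite /re /levy_exponent_re -/(cos1 s); ring.
Qed.

Lemma has_int_sin1 s : has_int nu (sin1 s) (im s - b * s).
Proof.
split; first exact: sin1_integrable.
by rewrite /im /levy_exponent_im -/(sin1 s); ring.
Qed.

(** The identity that produces the limit. Expanding the cosines around the common angle leaves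
    second differences in s of the integrands of [re] and [im]. The compensators and the drift b are
    linear in s and cancel, while the Gaussian term leaves (s + s')^2 - s^2 - s'^2 = 2 s s', the
    cross term that [Lgauss_trig] compensates. *)
Lemma has_int_jump_term s s' z a : has_int nu
  (fun u => cPhi s s' (z + (s + s') * u) a - cPhi s s' (z + s * u) a -
            cPhi s s' (z + s' * u) a + cPhi s s' z a)
  (- cdPhi s s' z a + sigma * s * s' * cPhi s s' z a).
Proof.
set E := expR (cexp s s' a); set Z := cang s s' z a.
have angD v : cang s s' (z + v) a = Z + v by rewrite /Z /cang; ring.
have h := has_intB
  (has_intZ (E * cos Z) (has_intB (has_intB (has_int_cos1 (s + s')) (has_int_cos1 s)) (has_int_cos1 s')))
  (has_intZ (E * sin Z) (has_intB (has_intB (has_int_sin1 (s + s')) (has_int_sin1 s)) (has_int_sin1 s'))).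
move: h; set F := (fun x => _); set v := (_ - _).
rewrite (_ : (fun u => _ + cPhi s s' z a) = F); last first.
  apply/funext => u; rewrite /F /cPhi -/E !angD !cosD -/Z /cos1 /sin1.
  by case: ifP => _; ring.
move=> h; rewrite [X in has_int _ _ X](_ : _ = v)//.
by rewrite /v /cdPhi /cPhi -/E -/Z; field.
Qed.

Lemma Ljump_trig l a : 0 <= a -> a <= 1 ->
  Ljump a (trig l) =
  (pairsum l l (fun s s' z => - cdPhi s s' z a + sigma * s * s' * cPhi s s' z a))%:E.
Proof.
move=> a0 a1; rewrite /Ljump.
rewrite (eq_integral (fun u => (pairsum l l (fun s s' z =>
   cPhi s s' (z + (s + s') * u) a - cPhi s s' (z + s * u) a -
            cPhi s s' (z + s' * u) a + cPhi s s' z a))%:E)).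
  apply: has_intE; apply: has_int_pairsum => s s' z; exact: has_int_jump_term.
move=> u _; have [k [-> e]] := Delta_trig l u.
by rewrite phi_trigE// e.
Qed.

Lemma L_trig l a : 0 <= a -> a <= 1 ->
  (Lgauss a (trig (dtrig l)) + Ljump a (trig l))%E =
  (pairsum l l (fun s s' z => - cdPhi s s' z a))%:E.
Proof.
move=> a0 a1; rewrite Lgauss_trig// Ljump_trig// -EFinD pairsumD; congr EFin.
by apply: eq_pairsum => s s' z; ring.
Qed.

End trig_forms.

(** * Extension by density *)

Section square_forms.
Context (R : realType).

Lemma limn_einf_le (u v : nat -> \bar R) (l : \bar R) : (forall n, u n <= v n) ->
  v @ \oo --> l -> limn_einf u <= l.
Proof.
move=> uv vl; rewrite limn_einf_lim -(cvg_lim _ vl)//.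
apply: lee_lim.
- exact: is_cvg_einfs.
- by apply/cvg_ex; exists l.
- apply: nearW => n; apply: le_trans (uv n).
  by apply: ereal_inf_lbound; exists n => /=.
Qed.

Lemma cvg_sqr_EFin (u : nat -> R) (l : R) :
  u @ \oo --> l -> ((u n) ^+ 2)%:E @[n --> \oo] --> (l ^+ 2)%:E.
Proof.
move=> ul; apply: cvg_EFin; first exact: nearW.
rewrite /comp /= (_ : (fun n => _) = (fun n => u n * u n)%R); first by rewrite expr2; exact: cvgM.
by apply/funext => n; rewrite expr2.
Qed.

Context d (T : measurableType d) (M : {measure set T -> \bar R}).
Implicit Types g h : T -> R.

Lemma fatou_cvg (f_ : nat -> T -> \bar R) (f : T -> \bar R) (v : nat -> \bar R) (l : \bar R) :
  (forall n, measurable_fun setT (f_ n)) -> measurable_fun setT f ->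
  (forall n x, 0 <= f_ n x) -> (forall x, 0 <= f x) ->
  {ae M, forall x, f_ n x @[n --> \oo] --> f x} ->
  (forall n, \int[M]_x f_ n x <= v n) -> v @ \oo --> l ->
  \int[M]_x f x <= l.
Proof.
move=> mf_ mf f_0 f0 [N [mN N0 subN]] fv vl.
have mNC : measurable (setT `\` N) by exact: measurableD.
rewrite (ge0_negligible_integral mN measurableT mf (fun x _ => f0 x) N0).
rewrite (eq_integral (fun x => limn_einf (f_ ^~ x))); last first.
  move=> x; rewrite inE /= => -[_ Nx].
  have fx : f_ n x @[n --> \oo] --> f x by apply: contrapT => h; apply: Nx; exact: subN.
  by rewrite (cvg_limn_einf_sup fx).1.
apply: le_trans (fatou M mNC (fun n => measurable_funTS (mf_ n)) (fun n x _ => f_0 n x)) _.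
apply: limn_einf_le vl => n; apply: le_trans (fv n).
by apply: ge0_subset_integral.
Qed.

Definition sqform g : \bar R := \int[M]_x ((g x) ^+ 2)%:E.

Lemma sqform_ge0 g : 0 <= sqform g.
Proof. by apply: integral_ge0 => x _; rewrite lee_fin sqr_ge0. Qed.

Lemma measurable_sqform g : measurable_fun setT g ->
  measurable_fun setT (fun x => ((g x) ^+ 2)%:E).
Proof. by move=> mg; apply/measurable_EFinP; exact: measurable_funX. Qed.

(** Completeness of L2 in the form used here: with i fixed, let j tend to infinity in the Cauchy
    bound. Its additive shape e i + e j then leaves e i. *)
Lemma sqform_fatou (g_ : nat -> T -> R) g (e : nat -> R) :
  (forall n, measurable_fun setT (g_ n)) -> measurable_fun setT g ->
  {ae M, forall x, g_ n x @[n --> \oo] --> g x} ->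
  e @ \oo --> (0 : R)%R ->
  (forall i j, sqform (fun x => g_ i x - g_ j x)%R <= (e i + e j)%:E) ->
  forall i, sqform (fun x => g_ i x - g x)%R <= (e i)%:E.
Proof.
move=> mg_ mg gg e0 ge i.
apply: (@fatou_cvg (fun n x => ((g_ i x - g_ n x) ^+ 2)%:E) _ (fun n => (e i + e n)%:E)).
- by move=> n; apply: measurable_sqform; exact: measurable_funB.
- by apply: measurable_sqform; exact: measurable_funB.
- by move=> n x; rewrite lee_fin sqr_ge0.
- by move=> x; rewrite lee_fin sqr_ge0.
- by apply: aeS gg => x gx; apply: cvg_sqr_EFin; apply: cvgB => //; exact: cvg_cst.
- by move=> n; exact: ge.
- apply: cvg_EFin; first exact: nearW.
  by rewrite -[X in _ --> X]addr0; apply: cvgD => //; exact: cvg_cst.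
Qed.

Lemma sqform_le g h : measurable_fun setT g -> measurable_fun setT h ->
  {ae M, forall x, `|g x| <= `|h x|}%R -> sqform g <= sqform h.
Proof.
move=> mg mh gh; apply: ae_ge0_le_integral.
- exact: measurableT.
- by move=> x _; rewrite lee_fin sqr_ge0.
- exact: measurable_sqform.
- by move=> x _; rewrite lee_fin sqr_ge0.
- exact: measurable_sqform.
apply: aeS gh => x gx _; rewrite lee_fin -(real_normK (num_real (g x))).
by rewrite -(real_normK (num_real (h x))) lerXn2r ?nnegrE.
Qed.

Lemma sqform_lim_le (g_ : nat -> T -> R) g (l : \bar R) :
  (forall n, measurable_fun setT (g_ n)) -> measurable_fun setT g ->
  {ae M, forall x, g_ n x @[n --> \oo] --> g x} ->
  (forall n, sqform (g_ n) <= l) -> sqform g <= l.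
Proof.
move=> mg_ mg gg gl; apply: (@fatou_cvg (fun n x => (g_ n x ^+ 2)%:E) _ (fun=> l)) => //.
- by move=> n; exact: measurable_sqform.
- exact: measurable_sqform.
- by move=> n x; rewrite lee_fin sqr_ge0.
- by move=> x; rewrite lee_fin sqr_ge0.
- by apply: aeS gg => x; exact: cvg_sqr_EFin.
- exact: cvg_cst.
Qed.

Lemma sqform_fin g : sqform g < +oo -> sqform g \is a fin_num.
Proof. by move=> g2; rewrite ge0_fin_numE// sqform_ge0. Qed.

(* Both A and B are squared seminorms of elements at squared distance at most
   e; this is the triangle inequality freed of square roots. *)
Definition near_sq (e : R) (A B : \bar R) := forall k : R, (0 < k)%R ->
  A <= (1 + k)%:E * B + ((1 + k^-1) * e)%:E /\
  B <= (1 + k)%:E * A + ((1 + k^-1) * e)%:E.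

(** Pointwise Young inequality: with a = g x and c = h x, the defect (1 + k) c^2 + (1 + 1/k) (a -
    c)^2 - a^2 equals k (c - (a - c) / k)^2. *)
Lemma sqform_triangle g h k : measurable_fun setT g -> measurable_fun setT h -> (0 < k)%R ->
  sqform g <= (1 + k)%:E * sqform h + (1 + k^-1)%:E * sqform (fun x => g x - h x)%R.
Proof.
move=> mg mh k0.
have k1 : (0 <= 1 + k)%R by rewrite addr_ge0// ltW.
have k2 : (0 <= 1 + k^-1)%R by rewrite addr_ge0// invr_ge0 ltW.
have mgh : measurable_fun setT (fun x => g x - h x)%R by exact: measurable_funB.
rewrite /sqform -!ge0_integralZl//; last first.
- by move=> x _; rewrite lee_fin sqr_ge0.
- exact: measurable_sqform.
- by move=> x _; rewrite lee_fin sqr_ge0.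
- exact: measurable_sqform.
rewrite -ge0_integralD//; last first.
- by apply: measurable_funeM; exact: measurable_sqform.
- by move=> x _; rewrite mule_ge0// lee_fin sqr_ge0.
- by apply: measurable_funeM; exact: measurable_sqform.
- by move=> x _; rewrite mule_ge0// lee_fin sqr_ge0.
apply: ge0_le_integral.
- exact: measurableT.
- by move=> x _; rewrite lee_fin sqr_ge0.
- exact: measurable_sqform.
- by apply: emeasurable_funD; apply: measurable_funeM; exact: measurable_sqform.
move=> x _; rewrite -!EFinM -EFinD lee_fin.
move: (g x) (h x) => a c.
rewrite -subr_ge0 (_ : _ - _ = k * (c - k^-1 * (a - c)) ^+ 2)%R.
  by rewrite mulr_ge0 ?sqr_ge0// ltW.
by field; rewrite gt_eqF.
Qed.

Lemma sqform_near g h e : measurable_fun setT g -> measurable_fun setT h ->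
  sqform (fun x => g x - h x)%R <= e%:E -> near_sq e (sqform g) (sqform h).
Proof.
move=> mg mh ge k k0.
have k2 : (0 <= 1 + k^-1)%R by rewrite addr_ge0// invr_ge0 ltW.
have H : (1 + k^-1)%:E * sqform (fun x => g x - h x)%R <= ((1 + k^-1) * e)%:E.
  by rewrite EFinM; apply: lee_wpmul2l.
split; first by apply: le_trans (sqform_triangle mg mh k0) _; exact: leeD2l.
apply: le_trans (sqform_triangle mh mg k0) _; apply: leeD2l.
rewrite (_ : sqform (fun x => h x - g x)%R = sqform (fun x => g x - h x)%R)//.
by apply: eq_integral => x _; congr EFin; ring.
Qed.

End square_forms.

Section energy_increment.
Context (R : realType) (mu : R -> probability R R).
Implicit Types F : R -> R.

Definition Vstep s h F (p : R * R) : R :=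
  (Pop (mu s) F (p.1 + p.2) - Pop (mu (s + h)) F p.1)%R.

Lemma measurable_Vstep s h F : measurable_fun setT F -> measurable_fun setT (Vstep s h F).
Proof.
move=> mF; apply: measurable_funB.
  exact: (measurableT_comp (Pop_measurable (mu s) mF) (@measurable_add R)).
exact: (measurableT_comp (Pop_measurable (mu (s + h)) mF)).
Qed.

Lemma Vform_sqform s h F : measurable_fun setT F ->
  Vform mu s h F = sqform (mu (1 - (s + h))%R \x mu h) (Vstep s h F).
Proof.
move=> mF; rewrite /sqform fubini_tonelli1//; last by move=> x; rewrite lee_fin sqr_ge0.
by apply: measurable_sqform; apply: measurable_Vstep.
Qed.

End energy_increment.

Section near_sq_theory.
Context (R : realType).

Lemma near_sqD (e e' : R) (A A' B B' : \bar R) : 0 <= A -> 0 <= A' -> 0 <= B -> 0 <= B' ->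
  near_sq e A B -> near_sq e' A' B' -> near_sq (e + e') (A + A') (B + B').
Proof.
move=> A0 A'0 B0 B'0 h h' k k0; have [h1 h2] := h k k0; have [h1' h2'] := h' k k0.
have k1 : (0 <= 1 + k)%R by rewrite addr_ge0// ltW.
have eE : ((1 + k^-1) * (e + e'))%:E = ((1 + k^-1) * e)%:E + ((1 + k^-1) * e')%:E.
  by rewrite mulrDr EFinD.
rewrite !ge0_muleDr// eE.
by split; rewrite addeACA; exact: leeD.
Qed.

Lemma near_sqZ (e c : R) (A B : \bar R) : (0 <= c)%R ->
  near_sq e A B -> near_sq (c * e) (c%:E * A) (c%:E * B).
Proof.
move=> c0 h k k0; have [h1 h2] := h k k0.
have eE X : (1 + k)%:E * (c%:E * X) + ((1 + k^-1) * (c * e))%:E =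
    c%:E * ((1 + k)%:E * X + ((1 + k^-1) * e)%:E).
  by rewrite muleDr ?fin_num_adde_defl// muleCA -EFinM mulrCA.
by split; rewrite eE lee_wpmul2l// lee_fin.
Qed.

Lemma near_sq_fin (e : R) (A B : \bar R) : 0 <= A -> near_sq e A B -> B \is a fin_num ->
  A \is a fin_num.
Proof.
move=> A0 /(_ 1%R ltr01)[h _] /fineK Bf; rewrite ge0_fin_numE//.
by apply: le_lt_trans h _; rewrite -Bf -EFinM -EFinD ltry.
Qed.

(** The chain l, x, y, a has three links, each with an error of order k (l + 1); 12 l + 20 dominates
    the total. The products with k are bounded one by one, after which the goal is linear. *)
Local Lemma near_sq_real (l k d x y a ee : R) : (0 <= l -> 0 < k -> k <= 1 ->
  k * (12 * l + 20) <= d -> `|x - y| <= k -> ee <= k -> 0 <= x -> 0 <= a ->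
  l <= (1 + k) * x + ee -> x <= (1 + k) * l + ee ->
  a <= (1 + k) * y + ee -> y <= (1 + k) * a + ee -> `|l - a| <= d)%R.
Proof.
move=> l0 k0 k1 kd; rewrite ler_distl => /andP[h1 h2] h3 x0 a0 La Lb Ma Mb.
rewrite ler_distl.
have kl : (0 <= k * l)%R by rewrite mulr_ge0// ltW.
have kkl : (k * (k * l) <= k * l)%R by rewrite ler_piMl.
have kk : (k * k <= k)%R by rewrite ler_piMr// ltW.
have kk0 : (0 <= k * k)%R by rewrite mulr_ge0// ltW.
have kW := ltW k0.
have kx : (k * x <= k * ((1 + k) * l + k))%R by apply: ler_wpM2l; lra.
have kx0 : (0 <= k * x)%R by rewrite mulr_ge0.
have ky : (k * y <= k * (x + k))%R by apply: ler_wpM2l; lra.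
have kkk : (k * (k * k) <= k * k)%R by apply: ler_wpM2l; lra.
have ka : (k * a <= k * ((1 + k) * y + k))%R by apply: ler_wpM2l; lra.
have kkx : (k * (k * x) <= k * x)%R by rewrite ler_piMl.
have kkx2 : (k * (k * y) <= k * (k * x + k * k))%R by apply: ler_wpM2l; lra.
have kka : (k * (k * a) <= k * a)%R by rewrite ler_piMl// mulr_ge0.
apply/andP; split.
  have aup : (a <= l + k * (3 * l + 5))%R by lra.
  by lra.
have xlow : (x <= (1 + k) * a + 2 * k)%R by lra.
have kxl : (k * x <= k * ((1 + k) * a + 2 * k))%R by apply: ler_wpM2l.
by lra.
Qed.

(** An exchange of limits: the error e j between A and its j-th approximation does not depend on
    m. *)
Lemma near_sq_lim (A : nat -> \bar R) (L : \bar R) (Aj : nat -> nat -> \bar R)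
    (Lj : nat -> \bar R) (e : nat -> R) :
  (forall m, 0 <= A m) -> 0 <= L -> (forall j, 0 <= Lj j) -> (forall j, (0 <= e j)%R) ->
  e @ \oo --> (0 : R)%R ->
  (forall j m, near_sq (e j) (A m) (Aj j m)) ->
  (forall j, near_sq (e j) L (Lj j)) ->
  (forall j, Lj j \is a fin_num) ->
  (forall j, Aj j m @[m --> \oo] --> Lj j) ->
  L \is a fin_num /\ A @ \oo --> L.
Proof.
move=> A0 L0 Lj0 e0 ecvg AAj LLj Ljfin AjLj.
have Lfin : L \is a fin_num by exact: near_sq_fin (LLj 0%N) (Ljfin 0%N).
split=> //; rewrite -(fineK Lfin); set l := fine L.
have l0 : (0 <= l)%R by exact: fine_ge0.
suff H (d : R) : (0 < d)%R -> \forall m \near \oo, A m \is a fin_num /\ (`|l - fine (A m)| <= d)%R.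
  apply/fine_cvgP; split; first by move: (H 1%R ltr01); apply: filterS => m [].
  by apply/cvgrPdist_le => d d0; move: (H d d0); apply: filterS => m [].
move=> d0.
(* Order of the choices: k from d and l, then j with (1 + 1/k) e j <= k, then m large for this j. *)
pose k := Num.min 1%R (d / (12 * l + 20))%R.
have c0 : (0 < 12 * l + 20)%R by lra.
have k0 : (0 < k)%R by rewrite lt_min ltr01 divr_gt0.
have k1 : (k <= 1)%R by rewrite ge_min lexx.
have kd : (k * (12 * l + 20) <= d)%R by rewrite -ler_pdivlMr// ge_min lexx orbT.
have [j ej] : exists j, ((1 + k^-1) * e j <= k)%R.
  have : ((1 + k^-1) * e j)%R @[j --> \oo] --> (0 : R)%R.
    by rewrite -[X in _ --> X](mulr0 (1 + k^-1)%R); exact: cvgMr.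
  move/cvgrPdist_le => /(_ k k0)[j _ hj]; exists j.
  have := hj j (leqnn j); rewrite /= sub0r normrN; apply: le_trans; exact: ler_norm.
have := AjLj j; rewrite -(fineK (Ljfin j)) => /fine_cvgP[Ajfin].
move=> /cvgrPdist_le/(_ k k0) Ajl.
have [La Lb] := LLj j k k0.
near=> m.
have Ajf : Aj j m \is a fin_num by near: m.
have Ajm : (`|fine (Lj j) - fine (Aj j m)| <= k)%R by near: m.
have [Ma Mb] := AAj j m k k0.
have Amf : A m \is a fin_num by exact: near_sq_fin (AAj j m) Ajf.
split=> //.
move: La Lb Ma Mb; rewrite -(fineK Lfin) -(fineK (Ljfin j)) -(fineK Ajf) -(fineK Amf) -/l.
rewrite -!EFinM -!EFinD !lee_fin.
have := fine_ge0 (A0 m); have := fine_ge0 (Lj0 j).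
move=> x0 a0 La Lb Ma Mb.
exact: near_sq_real k0 k1 kd Ajm ej x0 a0 La Lb Ma Mb.
Unshelve. all: by end_near. Qed.

End near_sq_theory.

Lemma near_sq_sym (R : realType) (e : R) (A B : \bar R) : near_sq e A B -> near_sq e B A.
Proof. by move=> h k k0; have [? ?] := h k k0; split. Qed.

Lemma near_sq_dist (R : realType) (x y : R) : (0 <= x)%R -> (0 <= y)%R ->
  near_sq `|x - y|%R x%:E y%:E.
Proof.
move=> x0 y0 k k0; rewrite -!EFinM -!EFinD !lee_fin.
have kd : (0 <= k^-1 * `|x - y|)%R by rewrite mulr_ge0// invr_ge0 ltW.
have kx : (0 <= k * x)%R by rewrite mulr_ge0// ltW.
have ky : (0 <= k * y)%R by rewrite mulr_ge0// ltW.
have h1 := ler_norm (x - y)%R; have h2 := ler_norm (y - x)%R; rewrite distrC in h2.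
by split; lra.
Qed.

Lemma near_sq_le (R : realType) (e e' : R) (A B : \bar R) : (e <= e')%R ->
  near_sq e A B -> near_sq e' A B.
Proof.
move=> ee h k k0; have [h1 h2] := h k k0.
have k2 : (0 <= 1 + k^-1)%R by rewrite addr_ge0// invr_ge0 ltW.
have H : ((1 + k^-1) * e)%:E <= ((1 + k^-1) * e')%:E by rewrite lee_fin ler_wpM2l.
by split; [apply: le_trans h1 _|apply: le_trans h2 _]; exact: leeD2l.
Qed.

(** Dominated convergence in L2, where r n is twice the squared distance to the limit because (y -
    z)^2 <= 2 (y - w)^2 + 2 (z - w)^2. The conclusion is phrased for pairs since it is the Cauchy
    property that the bounds transport to V and L. *)
Lemma l2_cauchy (R : realType) d (T : measurableType d) (m : {measure set T -> \bar R})
    (F_ : nat -> T -> R) (F H : T -> R) :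
  (forall n, measurable_fun setT (F_ n)) -> measurable_fun setT F -> measurable_fun setT H ->
  (forall n x, `|F_ n x| <= H x)%R -> (forall x, F_ n x @[n --> \oo] --> F x) ->
  sqform m H < +oo ->
  exists r : nat -> R, [/\ r @ \oo --> (0 : R)%R, forall n, (0 <= r n)%R &
    forall i j, sqform m (fun x => F_ i x - F_ j x)%R <= (r i + r j)%:E].
Proof.
move=> mF_ mF mH FH FF H2.
have FHl x : (`|F x| <= H x)%R.
  have h : (`|F_ n x| @[n --> \oo] --> `|F x|)%R by apply: cvg_norm; exact: FF.
  rewrite -(cvg_lim _ h)//; apply: limr_le; first by apply/cvg_ex; exists `|F x|%R.
  by apply: nearW => n; exact: FH.
have mD n : measurable_fun setT (fun x => (F_ n x - F x) ^+ 2)%R.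
  by apply: measurable_funX; exact: measurable_funB.
have iH : m.-integrable setT (EFin \o (fun x => 4 * H x ^+ 2)%R).
  apply: (integrableZl measurableT 4 (f := fun x => (H x ^+ 2)%:E)).
  apply/integrableP; split; first exact: measurable_sqform.
  rewrite (eq_integral (fun x => (H x ^+ 2)%:E)) // => x _.
  by rewrite gee0_abs// lee_fin sqr_ge0.
have Hb n x : (`|(F_ n x - F x) ^+ 2| <= 4 * H x ^+ 2)%R.
  rewrite ger0_norm ?sqr_ge0// -(real_normK (num_real (F_ n x - F x)%R)).
  rewrite (_ : 4 * H x ^+ 2 = (2 * H x) ^+ 2)%R; last by ring.
  have H0 : (0 <= H x)%R by exact: le_trans (FH n x).
  rewrite lerXn2r ?nnegrE// ?mulr_ge0//.
  rewrite (le_trans (ler_normB _ _))//; have := FH n x; have := FHl x; lra.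
have iD n : m.-integrable setT (EFin \o (fun x => (F_ n x - F x) ^+ 2)%R).
  apply: (le_integrable measurableT _ _ iH); first exact/measurable_EFinP.
  by move=> x _; rewrite /= lee_fin (le_trans (Hb n x))// ler_norm.
pose q n := (\int[m]_x (F_ n x - F x) ^+ 2)%R.
have q0 : q @ \oo --> (0 : R)%R.
  have m0 : measurable_fun setT (fun _ : T => 0%R : R) by [].
  have ae0 : {ae m, forall x, ((F_ n x - F x) ^+ 2)%R @[n --> \oo] --> (0 : R)%R}.
    apply: aeW => x.
    rewrite (_ : (fun n => _) = (fun n => (F_ n x - F x) * (F_ n x - F x))%R); last first.
      by apply/funext => n; rewrite expr2.
    have h : (F_ n x - F x)%R @[n --> \oo] --> (0 : R)%R.
      by rewrite -(subrr (F x)); apply: cvgB => //; exact: cvg_cst.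
    by rewrite -[X in _ --> X](mulr0 (0 : R)%R); exact: cvgM.
  have := Rint_dct mD m0 iH ae0 Hb.
  by rewrite {2}/Rintegral integral0.
exists (fun n => 2 * q n)%R; split.
- by rewrite -[X in _ --> X](mulr0 (2 : R)%R); exact: cvgMr.
- by move=> n; rewrite mulr_ge0//; apply: Rintegral_ge0 => x _; exact: sqr_ge0.
move=> i j; rewrite EFinD !EFinM.
have qE n : (q n)%:E = \int[m]_x ((F_ n x - F x) ^+ 2)%:E.
  by rewrite /q /Rintegral fineK//; exact: (integrable_fin_num measurableT (iD n)).
rewrite !qE -!ge0_integralZl//; last first.
- by move=> x _; rewrite lee_fin sqr_ge0.
- exact/measurable_EFinP.
- by move=> x _; rewrite lee_fin sqr_ge0.
- exact/measurable_EFinP.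
have m2 n : measurable_fun setT (fun x => 2%:E * ((F_ n x - F x) ^+ 2)%:E).
  by apply: measurable_funeM; exact/measurable_EFinP.
have p2 n x : 0 <= 2%:E * ((F_ n x - F x) ^+ 2)%:E by rewrite -EFinM lee_fin mulr_ge0// sqr_ge0.
rewrite -ge0_integralD//.
apply: ge0_le_integral.
- exact: measurableT.
- by move=> x _; rewrite lee_fin sqr_ge0.
- by apply: measurable_sqform; exact: measurable_funB.
- exact: emeasurable_funD.
move=> x _; rewrite -!EFinM -EFinD lee_fin.
move: (F_ i x) (F_ j x) (F x) => y z w.
rewrite -subr_ge0 (_ : _ - _ = (y - w + (z - w)) ^+ 2)%R; first exact: sqr_ge0.
by ring.
Qed.

Lemma Pop_dct (R : realType) (m : probability R R) (F_ : nat -> R -> R) (F H : R -> R) (c : R) :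
  (forall n, measurable_fun setT (F_ n)) -> measurable_fun setT F ->
  m.-integrable setT (fun x => (H (x + c)%R)%:E) ->
  (forall n x, `|F_ n x| <= H x)%R -> (forall x, F_ n x @[n --> \oo] --> F x) ->
  Pop m (F_ n) c @[n --> \oo] --> Pop m F c.
Proof.
move=> mF_ mF iH FH FF.
apply: (@Rint_dct _ _ _ m (fun n x => F_ n (x + c)%R) (fun x => F (x + c)%R) (fun x => H (x + c)%R)) => //.
- by move=> n; apply: (measurableT_comp (mF_ n)); exact: measurable_addr.
- by apply: (measurableT_comp mF); exact: measurable_addr.
- exact: aeW.
Qed.

Lemma bmeas_Delta (R : realType) (u : R) (F : R -> R) : bmeas F -> bmeas (Delta u F).
Proof. by move=> bF; apply: bmeasB => //; apply: bmeas_comp bF; exact: measurable_addr. Qed.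

Lemma DeltaB (R : realType) (u : R) (F H : R -> R) :
  Delta u (fun x => F x - H x)%R = (fun x => Delta u F x - Delta u H x)%R.
Proof. by apply/funext => x; rewrite /Delta; ring. Qed.

(** * Cutoffs and square-integrable functions *)

Section cutoff.
Context (R : realType).
Local Open Scope ring_scope.

(** The square makes the positive part continuously differentiable at 0, which gives an explicit C^1
    bump. *)
Definition ramp2 (y : R) : R := (Num.max 0 y) ^+ 2.

Lemma is_derive_ramp2 (y : R) : is_derive y 1 ramp2 (2 * Num.max 0 y).
Proof.
have H : h^-1 *: ((ramp2 \o shift y) h - ramp2 y) @[h --> 0^'] --> 2 * Num.max 0 y.
  apply/cvgrPdist_le => e e0; near=> h.
  have h0 : h != 0 by near: h; exact: nbhs_dnbhs_neq.
  have he : `|h| <= e.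
    near: h; apply: nbhs_dnbhs; apply: filterS (nbhsx_ballx (0 : R) e e0) => z.
    by rewrite /ball/= sub0r normrN => /ltW.
  rewrite /= /ramp2.
  have -> : 2 * Num.max 0 y - h^-1 *: ((Num.max 0 (h + y)) ^+ 2 - (Num.max 0 y) ^+ 2) =
      h^-1 * (2 * Num.max 0 y * h - (Num.max 0 (h + y)) ^+ 2 + (Num.max 0 y) ^+ 2).
    by rewrite /GRing.scale/=; field.
  rewrite normrM normfV ler_pdivrMl ?normr_gt0//.
  apply: (@le_trans _ _ (`|h| * `|h|)); last by rewrite ler_wpM2l.
  have hh : `|h| * `|h| = h * h by rewrite -!expr2 real_normK ?num_real.
  rewrite hh ler_norml.
  (* In each of the four sign cases the defect of the linear approximation is at most h^2. *)
  have [y0|y0] := leP y 0; have [z0|z0] := leP (h + y) 0; apply/andP; split; nra.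
have HE : (fun h : R => h^-1 *: ((ramp2 \o shift y) (h *: (1 : R)) - ramp2 y)) =
    (fun h : R => h^-1 *: ((ramp2 \o shift y) h - ramp2 y)).
  by apply/funext => h; rewrite [h *: 1]mulr1.
apply: DeriveDef.
  by apply/cvg_ex; exists (2 * Num.max 0 y); rewrite HE.
by rewrite /derive HE; exact: cvg_lim.
Unshelve. all: by end_near. Qed.

Lemma cvg_max0 (T : Type) (F : set_system T) (FF : Filter F) (u : T -> R) (l : R) :
  u @ F --> l -> (Num.max 0 (u x)) @[x --> F] --> Num.max 0 l.
Proof.
move=> ul; rewrite maxr_absE; under eq_fun do rewrite maxr_absE.
apply: cvgM; last exact: cvg_cst.
apply: cvgD; first by apply: cvgD => //; exact: cvg_cst.
by apply: cvg_norm; apply: cvgB => //; exact: cvg_cst.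
Qed.

(** A C^1 bump supported in [-t, t] which increases with t, so that truncations of nonnegative
    functions converge monotonically. *)
Definition cutoff (t x : R) : R := ramp2 (1 - (x / t) ^+ 2).
Definition dcutoff (t x : R) : R := 2 * Num.max 0 (1 - (x / t) ^+ 2) * - (2 * (x / t) / t).

Lemma is_derive_cutoff (t x : R) : is_derive x 1 (cutoff t) (dcutoff t x).
Proof.
have hz : is_derive x 1 (fun x : R => t^-1 * x) (t^-1 * 1) by exact: is_deriveZ.
have h1 := is_deriveB (is_derive_cst (1 : R) x 1) (is_deriveM hz hz).
rewrite (_ : cutoff t = ramp2 \o (cst 1 - (fun x : R => t^-1 * x) * (fun x : R => t^-1 * x))); last first.
  by apply/funext => y; rewrite /cutoff /= expr2 [y / t]mulrC.
refine (is_derive_eq (is_derive1_comp (is_derive_ramp2 _) h1) _).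
rewrite /dcutoff /GRing.scale /= (_ : (cst 1 - (fun x : R => t^-1 * x) * (fun x : R => t^-1 * x)) x = 1 - (x / t) ^+ 2).
  by ring.
by rewrite expr2 [x / t]mulrC.
Qed.

Lemma continuous_dcutoff t : continuous (dcutoff t).
Proof.
have c1 : continuous (fun x : R => x / t) by move=> x; apply: cvgM; [exact: cvg_id|exact: cvg_cst].
move=> x; apply: cvgM; last first.
  apply: cvgN; apply: cvgM; last exact: cvg_cst.
  by apply: cvgM; [exact: cvg_cst|exact: c1].
apply: cvgM; first exact: cvg_cst.
apply: cvg_max0.
apply: cvgB; first exact: cvg_cst.
rewrite expr2 (_ : (fun y => (y / t) ^+ 2) = (fun y => (y / t) * (y / t))).
  by apply: cvgM; exact: c1.
by apply/funext => y; rewrite expr2.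
Qed.

Lemma cutoff_ge0 t x : 0 <= cutoff t x. Proof. exact: sqr_ge0. Qed.

Lemma ramp_le1 (z : R) : 0 <= Num.max 0 (1 - z ^+ 2) <= 1.
Proof. by rewrite le_max lexx/= ge_max ler01 gerBl sqr_ge0. Qed.

Lemma cutoff_le1 t x : cutoff t x <= 1.
Proof. by have /andP[h0 h1] := ramp_le1 (x / t); rewrite /cutoff /ramp2 expr_le1. Qed.

Lemma ramp_out (t x : R) : 1 <= t -> t <= `|x| -> Num.max 0 (1 - (x / t) ^+ 2) = 0.
Proof.
move=> t1 tx; have t0 : 0 < t by exact: lt_le_trans t1.
apply/max_idPl; rewrite subr_le0 -(real_normK (num_real (x / t))) expr_ge1 ?normr_ge0//.
by rewrite normrM normfV (gtr0_norm t0) ler_pdivlMr ?mul1r.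
Qed.

Lemma cutoff_out t x : 1 <= t -> t <= `|x| -> cutoff t x = 0.
Proof. by move=> t1 tx; rewrite /cutoff /ramp2 ramp_out// expr0n. Qed.

Lemma dcutoff_out t x : 1 <= t -> t <= `|x| -> dcutoff t x = 0.
Proof. by move=> t1 tx; rewrite /dcutoff ramp_out// mulr0 mul0r. Qed.

Lemma dcutoff_le t x : 1 <= t -> `|dcutoff t x| <= 4.
Proof.
move=> t1; have [tx|/ltW xt] := leP t `|x|; first by rewrite dcutoff_out// normr0.
have t0 : 0 < t by exact: lt_le_trans t1.
have /andP[h0 h1] := ramp_le1 (x / t).
have h2 : `|x / t| <= 1 by rewrite normrM normfV (gtr0_norm t0) ler_pdivrMr ?mul1r.
have h3 : `|t^-1| <= 1 by rewrite normfV (gtr0_norm t0) invf_le1.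
have h4 : `|2 * Num.max 0 (1 - (x / t) ^+ 2)| <= 2.
  by rewrite normrM normr_nat (ger0_norm h0); lra.
have h5 : `|2 * (x / t) / t| <= 2.
  rewrite normrM [`|2 * _|]normrM normr_nat -mulrA -[leRHS]mulr1 ler_wpM2l//.
  by rewrite -[leRHS]mulr1 ler_pM.
rewrite /dcutoff normrM normrN (_ : 4 = 2 * 2); last by ring.
by rewrite ler_pM.
Qed.

Lemma cutoff_mono t t' x : 1 <= t -> t <= t' -> cutoff t x <= cutoff t' x.
Proof.
move=> t1 tt'; have t0 : 0 < t by exact: lt_le_trans t1.
have t0' : 0 < t' by exact: lt_le_trans tt'.
have /andP[h0 h1] := ramp_le1 (x / t); have /andP[h0' h1'] := ramp_le1 (x / t').
rewrite /cutoff /ramp2 lerXn2r ?nnegrE// le_max2// lerD2l lerN2.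
rewrite !expr_div_n ler_wpM2l ?sqr_ge0// lef_pV2 ?posrE ?exprn_gt0//.
by rewrite lerXn2r ?nnegrE// ltW.
Qed.

Let cvg_ramp x : Num.max 0 (1 - (x / j.+1%:R) ^+ 2) @[j --> \oo] --> (1 : R).
Proof.
rewrite [X in _ --> X](_ : 1 = Num.max 0 (1 - (x * 0) * (x * 0))); last first.
  by rewrite mulr0 mulr0 subr0; apply/esym/max_idPr.
apply: cvg_max0.
apply: cvgB; first exact: cvg_cst.
rewrite (_ : (fun j => _) = (fun j : nat => (x * j.+1%:R^-1) * (x * j.+1%:R^-1))); last first.
  by apply/funext => j; rewrite expr2.
by apply: cvgM; apply: cvgMr; exact: cvg_harmonic.
Qed.

Lemma cvg_cutoff x : cutoff j.+1%:R x @[j --> \oo] --> (1 : R).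
Proof.
rewrite (_ : (fun j => _) = (fun j : nat => Num.max 0 (1 - (x / j.+1%:R) ^+ 2) * Num.max 0 (1 - (x / j.+1%:R) ^+ 2))).
  by rewrite -[X in _ --> X]mulr1; apply: cvgM; exact: cvg_ramp.
by apply/funext => j; rewrite /cutoff /ramp2 expr2.
Qed.

Lemma cvg_dcutoff x : dcutoff j.+1%:R x @[j --> \oo] --> (0 : R).
Proof.
rewrite (_ : 0 = 2 * 1 * - (2 * (x * 0) * 0)); last by ring.
apply: cvgM; first by apply: cvgM; [exact: cvg_cst|exact: cvg_ramp].
apply: cvgN; apply: cvgM; last exact: cvg_harmonic.
by apply: cvgM; [exact: cvg_cst|apply: cvgMr; exact: cvg_harmonic].
Qed.

Lemma continuous_bounded_on (F : R -> R) (r : R) : continuous F ->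
  exists2 C, 0 <= C & forall x, `|x| <= r -> `|F x| <= C.
Proof.
move=> cF.
have : compact (F @` `[- r, r]).
  apply: continuous_compact; last exact: segment_compact.
  exact: continuous_subspaceT.
move=> /compact_bounded [M [_ /(_ (Num.max 0 M + 1))]].
rewrite (le_lt_trans (_ : M <= Num.max 0 M)) ?le_max ?lexx ?orbT ?ltrDl// => /(_ isT) FM.
exists (Num.max 0 M + 1); first by rewrite addr_ge0// le_max lexx.
by move=> x xr; apply: FM; exists x => //=; rewrite in_itv/= -ler_norml.
Qed.

Lemma compact_support_bounded (F : R -> R) t : continuous F -> (forall x, t <= `|x| -> F x = 0) ->
  exists M, forall x, `|F x| <= M.
Proof.
move=> cF F0; have [M M0 HM] := continuous_bounded_on t cF.
exists M => x; have [tx|/ltW xt] := leP t `|x|; last exact: HM.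
by rewrite F0// normr0.
Qed.

End cutoff.

Lemma deriv_continuous (R : realType) (f f' : R -> R) :
  (forall x : R, is_derive x 1%R f (f' x)) -> continuous f.
Proof. by move=> df x; apply: differentiable_continuous; apply/derivable1_diffP; have [] := df x. Qed.

Section truncation.
Context (R : realType) (F F' : R -> R).
Hypotheses (dF : forall x : R, is_derive x 1%R F (F' x)) (cF' : continuous F').
Local Open Scope ring_scope.

Definition ctrunc (i : nat) (x : R) : R := F x * cutoff i.+1%:R x.
Definition dctrunc (i : nat) (x : R) : R := F' x * cutoff i.+1%:R x + F x * dcutoff i.+1%:R x.

Let t1 i : 1 <= (i.+1%:R : R). Proof. by rewrite ler1n. Qed.

Lemma is_derive_ctrunc i (x : R) : is_derive x 1 (ctrunc i) (dctrunc i x).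
Proof.
have h := is_deriveM (dF x) (is_derive_cutoff i.+1%:R x).
apply: (is_derive_eq h).
by rewrite /dctrunc /GRing.scale/= addrC [cutoff _ x * _]mulrC.
Qed.

Lemma continuous_dctrunc i : continuous (dctrunc i).
Proof.
move=> x; apply: cvgD; apply: cvgM.
- exact: cF'.
- exact: (deriv_continuous (is_derive_cutoff _)).
- exact: (deriv_continuous dF).
- exact: continuous_dcutoff.
Qed.

Lemma ctrunc_bounded i : exists M, forall x, `|ctrunc i x| <= M /\ `|dctrunc i x| <= M.
Proof.
have [M HM] : exists M, forall x, `|ctrunc i x| <= M.
  apply: (@compact_support_bounded _ _ i.+1%:R).
    exact: (deriv_continuous (is_derive_ctrunc i)).
  by move=> x ix; rewrite /ctrunc cutoff_out// mulr0.
have [M' HM'] : exists M, forall x, `|dctrunc i x| <= M.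
  apply: (@compact_support_bounded _ _ i.+1%:R); first exact: continuous_dctrunc.
  by move=> x ix; rewrite /dctrunc cutoff_out// dcutoff_out// !mulr0 addr0.
by exists (Num.max M M') => x; rewrite !le_max HM HM' orbT.
Qed.

Lemma ctrunc_le i x : `|ctrunc i x| <= `|F x|.
Proof. by rewrite normrM ler_piMr// ger0_norm ?cutoff_ge0// cutoff_le1. Qed.

(** A majorant independent of i, square integrable under Y as soon as F and F' are. *)
Lemma dctrunc_le i x : `|dctrunc i x| <= `|F' x| + 4 * `|F x|.
Proof.
rewrite (le_trans (ler_normD _ _))// lerD// normrM.
  by rewrite ler_piMr// ger0_norm ?cutoff_ge0// cutoff_le1.
by rewrite mulrC ler_wpM2r// dcutoff_le.
Qed.

Lemma cvg_ctrunc x : ctrunc i x @[i --> \oo] --> F x.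
Proof. by rewrite -[X in _ --> X]mulr1; apply: cvgMr; exact: cvg_cutoff. Qed.

Lemma cvg_dctrunc x : dctrunc i x @[i --> \oo] --> F' x.
Proof.
rewrite -[X in _ --> X]addr0 -[X in _ --> X + _]mulr1 -(mulr0 (F x)).
by apply: cvgD; apply: cvgMr; [exact: cvg_cutoff|exact: cvg_dcutoff].
Qed.

End truncation.

Section ae_tools.
Context (R : realType) d (T : measurableType d) (m : {measure set T -> \bar R}).

Lemma ae_lty (f : T -> \bar R) : measurable_fun setT f -> (forall x, 0 <= f x) ->
  \int[m]_x f x < +oo -> {ae m, forall x, f x < +oo}.
Proof.
move=> mf f0 fi.
have fint : m.-integrable setT f.
  apply/integrableP; split => //.
  by rewrite (eq_integral f)// => x _; rewrite gee0_abs.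
apply: aeS (integrable_ae measurableT fint) => x /(_ Logic.I).
by rewrite ge0_fin_numE.
Qed.

Lemma sqform_dct (g_ : nat -> T -> R) (g B : T -> R) :
  (forall n, measurable_fun setT (g_ n)) -> measurable_fun setT g -> measurable_fun setT B ->
  {ae m, forall x, g_ n x @[n --> \oo] --> g x} ->
  {ae m, forall x, forall n, (`|g_ n x| <= B x)%R} ->
  sqform m B < +oo -> sqform m (g_ n) @[n --> \oo] --> sqform m g.
Proof.
move=> mg_ mg mB gg gB B2.
have iB : m.-integrable setT (fun x => ((B x) ^+ 2)%:E).
  apply/integrableP; split; first exact: measurable_sqform.
  rewrite (eq_integral (fun x => (B x ^+ 2)%:E)) // => x _.
  by rewrite gee0_abs// lee_fin sqr_ge0.
have := @dominated_convergence _ _ _ m setT measurableT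
  (fun n x => ((g_ n x) ^+ 2)%:E) (fun x => ((g x) ^+ 2)%:E) (fun x => ((B x) ^+ 2)%:E).
case=> //.
- by move=> n; exact: measurable_sqform.
- exact: measurable_sqform.
- by apply: aeS gg => x gx _; exact: cvg_sqr_EFin.
- apply: aeS gB => x gx n _; rewrite gee0_abs ?lee_fin ?sqr_ge0//.
  rewrite -(real_normK (num_real (g_ n x))) lerXn2r ?nnegrE//.
  exact: le_trans (gx n).
Qed.

Lemma sqformD_lty (g h : T -> R) : measurable_fun setT g -> measurable_fun setT h ->
  sqform m g < +oo -> sqform m h < +oo -> sqform m (fun x => g x + h x)%R < +oo.
Proof.
move=> mg mh g2 h2.
have mgh : measurable_fun setT (fun x => g x + h x)%R by exact: measurable_funD.
apply: le_lt_trans (sqform_triangle m mgh mg ltr01) _.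
rewrite (_ : sqform m (fun x => g x + h x - g x)%R = sqform m h); last first.
  by apply: eq_integral => x _; congr (_ ^+ 2)%:E; ring.
by apply: lte_add_pinfty; apply: lte_mul_pinfty; rewrite ?lee_fin ?addr_ge0 ?invr_ge0// ?sqform_ge0.
Qed.

End ae_tools.

(** This decides whether [Pop m H c] is a genuine expectation: as an [Rintegral], [Pop] returns 0
    when the integral is infinite. *)
Definition absint (R : realType) (m : probability R R) (H : R -> R) (c : R) : \bar R :=
  \int[m]_x (`|H (x + c)|)%:E.

Section absolute_integral.
Context (R : realType) (m : probability R R) (H : R -> R).
Hypothesis mH : measurable_fun setT H.

Lemma absint_ge0 c : 0 <= absint m H c.
Proof. exact: integral_ge0. Qed.

Lemma measurable_absint : measurable_fun setT (absint m H).
Proof.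
apply: (@measurable_integral _ _ _ _ _ m (fun p : R * R => (`|H (p.2 + p.1)|)%:E)).
apply/measurable_EFinP; apply: measurableT_comp => //; apply: (measurableT_comp mH).
exact: measurable_funD.
Qed.

Lemma absint_integrable c : absint m H c < +oo -> m.-integrable setT (fun x : R => (H (x + c))%:E).
Proof.
move=> Hc; apply/integrableP; split => //.
by apply/measurable_EFinP; apply: (measurableT_comp mH); exact: measurable_addr.
Qed.

Lemma absint_Pop c : absint m H c < +oo -> absint m H c = (Pop m (fun x => `|H x|%R) c)%:E.
Proof.
move=> Hc; rewrite /Pop /Rintegral fineK//.
by rewrite ge0_fin_numE ?absint_ge0.
Qed.

Lemma Pop_dominated (F_ : nat -> R -> R) c : (forall n, measurable_fun setT (F_ n)) ->
  (forall n x, `|F_ n x| <= `|H x|)%R -> (forall x, F_ n x @[n --> \oo] --> H x) ->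
  absint m H c < +oo -> Pop m (F_ n) c @[n --> \oo] --> Pop m H c.
Proof.
move=> mF FH FF Hc; apply: (@Pop_dct _ _ _ _ (fun x => `|H x|%R)) => //.
apply/integrableP; split.
  apply/measurable_EFinP; apply: measurableT_comp => //; apply: (measurableT_comp mH).
  exact: measurable_addr.
rewrite (eq_integral (fun x : R => (`|H (x + c)|)%:E))// => x _.
by rewrite gee0_abs// lee_fin.
Qed.

Lemma Pop_abs_le (F : R -> R) c : measurable_fun setT F -> (forall x, `|F x| <= `|H x|)%R ->
  absint m H c < +oo -> (`|Pop m F c| <= Pop m (fun x => `|H x|) c)%R.
Proof.
move=> mF FH Hc.
have iH := integrable_abse (absint_integrable Hc).
have mFc : measurable_fun setT (fun x : R => F (x + c)%R).
  by apply: (measurableT_comp mF); exact: measurable_addr.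
have iF : m.-integrable setT (EFin \o (fun x : R => F (x + c)%R)).
  apply: (le_integrable measurableT _ _ iH); first exact/measurable_EFinP.
  by move=> x _; rewrite /= lee_fin normr_id.
apply: le_trans (le_normr_Rintegral measurableT iF) _.
apply: le_Rintegral => //; first exact: integrable_norm.
Qed.

Lemma Pop_abs_ge0 c : (0 <= Pop m (fun x => `|H x|) c)%R.
Proof. exact: Rintegral_ge0. Qed.

End absolute_integral.

(** Truncation by value. It destroys continuity, which is harmless for the identities between [phi]
    and [Vform]; [ctrunc] is the truncation that preserves differentiability. *)
Definition clip (R : realType) (H : R -> R) (n : nat) (x : R) : R :=
  if (`|H x| <= n%:R)%R then H x else 0%R.

Section clipping.
Context (R : realType) (H : R -> R).

Lemma clip_le n x : (`|clip H n x| <= `|H x|)%R.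
Proof. by rewrite /clip; case: ifP => // _; rewrite normr0. Qed.

Lemma bmeas_clip n : measurable_fun setT H -> bmeas (clip H n).
Proof.
move=> mH; split.
  apply: measurable_fun_ifT => //; apply: measurable_fun_ler => //.
  exact: measurableT_comp.
by exists n%:R => x; rewrite /clip; case: ifP => // _; rewrite normr0.
Qed.

Lemma cvg_clip x : clip H n x @[n --> \oo] --> H x.
Proof.
apply: cvg_near_cst; exists (Num.truncn `|H x|).+1 => // n /= hn.
rewrite /clip ifT//; apply: le_trans (ltW (truncnS_gt _)) _.
by rewrite ler_nat.
Qed.

End clipping.

Section semigroup_l2.
Context (R : realType) (mu : R -> probability R R) (mu_conv : conv_semigroup mu).
Implicit Types H : R -> R.

Let madd := @measurable_add R.

Lemma absint_total H t : measurable_fun setT H -> (0 <= t)%R -> (t <= 1)%R ->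
  \int[mu (1 - t)%R]_c absint (mu t) H c = \int[mu 1%R]_x (`|H x|)%:E.
Proof.
move=> mH t0 t1; have t1' : (0 <= 1 - t)%R by rewrite subr_ge0.
rewrite -[in RHS](subrK t 1%R) [RHS](conv_int mu_conv t1' t0).
- by apply: eq_integral => c _; rewrite /absint; apply: eq_integral => x _; rewrite addrC.
- by apply/measurable_EFinP; exact: measurableT_comp.
- by [].
Qed.

Lemma absint_ae H t : measurable_fun setT H -> (0 <= t)%R -> (t <= 1)%R ->
  \int[mu 1%R]_x (`|H x|)%:E < +oo -> {ae mu (1 - t)%R, forall c, absint (mu t) H c < +oo}.
Proof.
move=> mH t0 t1 Hi; apply: ae_lty.
- exact: measurable_absint.
- by move=> x; exact: absint_ge0.
- by rewrite absint_total.
Qed.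

(* The sum of the two coordinates and the first coordinate have laws
   [mu (1 - s)] and [mu (1 - (s + h))]. *)
Lemma ae_pair_add s h (A : R -> \bar R) : (0 <= h)%R -> (s + h <= 1)%R ->
  measurable_fun setT A -> (forall x, 0 <= A x) ->
  \int[mu (1 - (s + h))%R \x mu h]_p A (p.1 + p.2)%R = \int[mu (1 - s)%R]_x A x.
Proof.
move=> h0 sh mA A0; rewrite (_ : 1 - s = (1 - (s + h)) + h)%R; last by ring.
have sh' : (0 <= 1 - (s + h))%R by rewrite subr_ge0.
exact: (ge0_integral_law madd (conv_law mu_conv sh' h0)).
Qed.

Lemma int_pair_fst t h (A : R -> \bar R) :
  measurable_fun setT A -> (forall x, 0 <= A x) ->
  \int[mu t \x mu h]_p A p.1 = \int[mu t]_x A x.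
Proof.
move=> mA A0; rewrite (@fubini_tonelli1 _ _ _ _ _ _ _ (fun p : R * R => A p.1))//; last first.
  by apply: measurableT_comp.
apply: eq_integral => x _; rewrite /fubini_F /= integral_cst//.
by rewrite [X in _ * X](probability_setT (mu h)) mule1.
Qed.

Lemma absint_ae_pair H s h : measurable_fun setT H -> (0 <= s)%R -> (0 <= h)%R -> (s + h <= 1)%R ->
  \int[mu 1%R]_x (`|H x|)%:E < +oo ->
  {ae mu (1 - (s + h))%R \x mu h, forall p : R * R,
    absint (mu s) H (p.1 + p.2) < +oo /\ absint (mu (s + h)) H p.1 < +oo}.
Proof.
move=> mH s0 h0 sh Hi.
have sh0 : (0 <= s + h)%R by rewrite addr_ge0.
have s1 : (s <= 1)%R by apply: le_trans sh; rewrite lerDl.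
apply: (@aeS2 _ _ _ _ (fun p : R * R => absint (mu s) H (p.1 + p.2)%R < +oo)
  (fun p : R * R => absint (mu (s + h)) H p.1 < +oo)) => //.
- apply: (ae_lty (f := fun p : R * R => absint (mu s) H (p.1 + p.2)%R)).
  + exact: (measurableT_comp (measurable_absint _ mH) madd).
  + by move=> x; exact: absint_ge0.
  + by rewrite (@ae_pair_add s h (absint (mu s) H))// ?absint_total//; [exact: measurable_absint|exact: absint_ge0].
- apply: (ae_lty (f := fun p : R * R => absint (mu (s + h)) H p.1)).
  + exact: (measurableT_comp (measurable_absint _ mH)).
  + by move=> x; exact: absint_ge0.
  + by rewrite (@int_pair_fst _ _ (absint (mu (s + h)) H))// ?absint_total//; [exact: measurable_absint|exact: absint_ge0].
Qed.

Lemma abs_int_lty H : measurable_fun setT H -> sqform (mu 1%R) H < +oo ->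
  \int[mu 1%R]_x (`|H x|)%:E < +oo.
Proof.
move=> mH H2.
have m2 := measurable_sqform mH.
apply: (@le_lt_trans _ _ (\int[mu 1%R]_x (1 + (H x ^+ 2)%:E))).
  apply: ge0_le_integral.
  - exact: measurableT.
  - by [].
  - by apply/measurable_EFinP; exact: measurableT_comp.
  - by apply: emeasurable_funD => //; exact: measurable_cst.
  move=> x _; rewrite -EFinD lee_fin -(real_normK (num_real (H x))).
  have := normr_ge0 (H x); set y := (`|_|)%R; nra.
rewrite ge0_integralD//; last by move=> x _; rewrite lee_fin sqr_ge0.
rewrite integral_cst// mul1e [X in X + _](probability_setT (mu 1%R)).
by apply: lte_add_pinfty; rewrite ?ltry.
Qed.

Lemma phi_bound F t : bmeas F -> (0 <= t)%R -> (t <= 1)%R -> phi mu t F <= sqform (mu 1%R) F.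
Proof.
move=> bF t0 t1; rewrite /sqform -(phi0 mu_conv); last exact: bmeas_measurable.
by rewrite [leRHS](phi_V mu_conv (lexx 0%R) t0)// add0r// leeDr// Vform_ge0.
Qed.

(** For bounded functions this is phi 0 = V + phi t with V nonnegative; clipping and Fatou's lemma
    give the general case. *)
Lemma phi_le_L2 H t : measurable_fun setT H -> (0 <= t)%R -> (t <= 1)%R ->
  sqform (mu 1%R) H < +oo -> phi mu t H <= sqform (mu 1%R) H.
Proof.
move=> mH t0 t1 H2.
have mc n : measurable_fun setT (clip H n) by case: (bmeas_clip n mH).
apply: (@sqform_lim_le _ _ _ _ (fun n => Pop (mu t) (clip H n))).
- by move=> n; exact: Pop_measurable.
- exact: Pop_measurable.
- apply: aeS (absint_ae mH t0 t1 (abs_int_lty mH H2)) => c Hc.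
  apply: Pop_dominated => //; last by move=> x; exact: cvg_clip.
  by move=> n x; exact: clip_le.
- move=> n; apply: le_trans (phi_bound (bmeas_clip n mH) t0 t1) _.
  by apply: sqform_le => //; apply: aeW => x; exact: clip_le.
Qed.

Lemma sqform_abs d (T : measurableType d) (m : {measure set T -> \bar R}) (H : T -> R) :
  sqform m (fun x => `|H x|)%R = sqform m H.
Proof. by apply: eq_integral => x _; rewrite real_normK ?num_real. Qed.

Lemma phi_abs_L2 H t : measurable_fun setT H -> (0 <= t)%R -> (t <= 1)%R ->
  sqform (mu 1%R) H < +oo -> phi mu t (fun x => `|H x|%R) <= sqform (mu 1%R) H.
Proof.
move=> mH t0 t1 H2; have mH' : measurable_fun setT (fun x => `|H x|)%R by exact: measurableT_comp.
by rewrite -(sqform_abs _ H); apply: phi_le_L2 => //; rewrite sqform_abs.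
Qed.

(** The three terms of [phi_V] are passed to the limit separately along the clipped functions, each
    by dominated convergence in L2. *)
Lemma phi_V_L2 s h H : measurable_fun setT H -> sqform (mu 1%R) H < +oo ->
  (0 <= s)%R -> (0 <= h)%R -> (s + h <= 1)%R -> phi mu s H = Vform mu s h H + phi mu (s + h) H.
Proof.
move=> mH H2 s0 h0 sh.
have sh0 : (0 <= s + h)%R by rewrite addr_ge0.
have s1 : (s <= 1)%R by apply: le_trans sh; rewrite lerDl.
have mH' : measurable_fun setT (fun x => `|H x|)%R by exact: measurableT_comp.
have Hi := abs_int_lty mH H2.
have mc n : measurable_fun setT (clip H n) by case: (bmeas_clip n mH).
have PC m c : absint m H c < +oo -> Pop m (clip H n) c @[n --> \oo] --> Pop m H c.
  move=> Hc; apply: Pop_dominated => //.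
  + by move=> n x; exact: clip_le.
  + by move=> x; exact: cvg_clip.
have PB m c n : absint m H c < +oo -> (`|Pop m (clip H n) c| <= Pop m (fun x => `|H x|) c)%R.
  by move=> Hc; apply: Pop_abs_le => // x; exact: clip_le.
have phiC t : (0 <= t)%R -> (t <= 1)%R -> phi mu t (clip H n) @[n --> \oo] --> phi mu t H.
  move=> t0 t1; apply: (@sqform_dct _ _ _ (mu (1 - t)%R) (fun n => Pop (mu t) (clip H n)) _
    (Pop (mu t) (fun x => `|H x|)%R)).
  - by move=> n; exact: Pop_measurable.
  - exact: Pop_measurable.
  - exact: Pop_measurable.
  - by apply: aeS (absint_ae mH t0 t1 Hi) => c; exact: PC.
  - by apply: aeS (absint_ae mH t0 t1 Hi) => c Hc n; exact: PB.
  - by apply: (le_lt_trans _ H2); exact: phi_abs_L2.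
have phif t : (0 <= t)%R -> (t <= 1)%R -> phi mu t H \is a fin_num.
  move=> t0 t1; rewrite ge0_fin_numE ?phi_ge0//.
  by apply: (le_lt_trans _ H2); exact: phi_le_L2.
have mP m : measurable_fun setT (Pop m (fun x => `|H x|)%R) by exact: Pop_measurable.
have VC : Vform mu s h (clip H n) @[n --> \oo] --> Vform mu s h H.
  rewrite Vform_sqform//; under eq_fun do rewrite Vform_sqform//.
  (* The dominating function is the sum of two terms whose arguments have laws mu (1 - s) and mu (1
     - (s + h)); [phi_abs_L2] makes each of them square integrable. *)
  apply: (@sqform_dct _ _ _ _ (fun n => Vstep mu s h (clip H n)) _ (fun p : R * R =>
    Pop (mu s) (fun x => `|H x|) (p.1 + p.2) + Pop (mu (s + h)) (fun x => `|H x|) p.1)%R).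
  - by move=> n; exact: measurable_Vstep.
  - exact: measurable_Vstep.
  - apply: measurable_funD; first exact: (measurableT_comp (mP _) madd).
    exact: (measurableT_comp (mP _)).
  - apply: aeS (absint_ae_pair mH s0 h0 sh Hi) => p [p1 p2].
    by apply: cvgB; exact: PC.
  - apply: aeS (absint_ae_pair mH s0 h0 sh Hi) => p [p1 p2] n.
    by rewrite (le_trans (ler_normB _ _))// lerD// PB.
  - apply: sqformD_lty.
    + exact: (measurableT_comp (mP _) madd).
    + exact: (measurableT_comp (mP _)).
    + rewrite /sqform (@ae_pair_add s h (fun x => ((Pop (mu s) (fun x => `|H x|) x) ^+ 2)%:E))//.
      * by apply: (le_lt_trans _ H2); exact: phi_abs_L2.
      * by apply: measurable_sqform.
      * by move=> x; rewrite lee_fin sqr_ge0.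
    + rewrite /sqform (@int_pair_fst _ _ (fun x => ((Pop (mu (s + h)) (fun x => `|H x|) x) ^+ 2)%:E))//.
      * by apply: (le_lt_trans _ H2); exact: phi_abs_L2.
      * by apply: measurable_sqform.
      * by move=> x; rewrite lee_fin sqr_ge0.
have L1 := phiC s s0 s1.
have L2 : Vform mu s h (clip H n) + phi mu (s + h) (clip H n) @[n --> \oo] -->
    Vform mu s h H + phi mu (s + h) H.
  by apply: cvgeD => //; [apply: fin_num_adde_defl; exact: phif|exact: phiC].
have E : (fun n => Vform mu s h (clip H n) + phi mu (s + h) (clip H n)) = (fun n => phi mu s (clip H n)).
  by apply/funext => n; rewrite -(phi_V mu_conv)//; exact: bmeas_clip.
by rewrite E in L2; exact: (cvg_unique _ L1 L2).
Qed.

End semigroup_l2.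

Section product_ae.
Context (R : realType) d1 d2 (T1 : measurableType d1) (T2 : measurableType d2).
Variables (m1 : {sigma_finite_measure set T1 -> \bar R}) (m2 : {sigma_finite_measure set T2 -> \bar R}).

Lemma ae_prod_fst (A : T1 -> Prop) : {ae m1, forall x, A x} -> {ae m1 \x m2, forall p, A p.1}.
Proof.
move=> [N [mN N0 subN]]; exists (N `*` setT); split.
- exact: measurableX.
- by apply: (etrans (product_measure1E _ _ mN measurableT)); rewrite [X in X * _]N0 mul0e.
- by move=> p /= hp; split => //; apply: subN.
Qed.

Lemma ae_prod_snd (A : T2 -> Prop) : {ae m2, forall x, A x} -> {ae m1 \x m2, forall p, A p.2}.
Proof.
move=> [N [mN N0 subN]]; exists (setT `*` N); split.
- exact: measurableX.
- by apply: (etrans (product_measure1E _ _ measurableT mN)); rewrite [X in _ * X]N0 mule0.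
- by move=> p /= hp; split => //; apply: subN.
Qed.

Lemma int_prodM (f : T1 -> \bar R) (g : T2 -> \bar R) :
  measurable_fun setT f -> measurable_fun setT g -> (forall x, 0 <= f x) -> (forall x, 0 <= g x) ->
  \int[m1 \x m2]_p (f p.1 * g p.2) = \int[m1]_x f x * \int[m2]_y g y.
Proof.
move=> mf mg f0 g0.
rewrite (@fubini_tonelli1 _ _ _ _ _ _ _ (fun p => f p.1 * g p.2)); last 2 first.
- by apply: emeasurable_funM; apply: measurableT_comp.
- by move=> p; exact: mule_ge0.
rewrite /fubini_F /= -ge0_integralZr//; last exact: integral_ge0.
by apply: eq_integral => x _; rewrite ge0_integralZl.
Qed.

End product_ae.

Section weight.
Context (R : realType).
(* A C^1 majorant of |G| with the same integrability; the bound on its jump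
   form makes P_alpha |G| (c + u) finite almost everywhere. *)
Definition soft_abs (G : R -> R) (x : R) : R := Num.sqrt (1 + G x ^+ 2)%R.
Definition dsoft_abs (G G' : R -> R) (x : R) : R := (G x * G' x / soft_abs G x)%R.
Local Open Scope ring_scope.

Lemma soft_abs_gt0 G x : 0 < soft_abs G x.
Proof. by rewrite sqrtr_gt0 ltr_pwDl// sqr_ge0. Qed.

Lemma soft_abs_sqr G x : soft_abs G x ^+ 2 = 1 + G x ^+ 2.
Proof. by rewrite sqr_sqrtr// addr_ge0// sqr_ge0. Qed.

Lemma le_soft_abs G x : `|G x| <= soft_abs G x.
Proof. by rewrite -sqrtr_sqr; apply: ler_wsqrtr; rewrite lerDr. Qed.

Lemma is_derive_soft_abs (G G' : R -> R) : (forall x : R, is_derive x 1 G (G' x)) ->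
  forall x : R, is_derive x 1 (soft_abs G) (dsoft_abs G G' x).
Proof.
move=> dG x.
have h1 := is_deriveD (is_derive_cst (1 : R) x 1) (is_deriveM (dG x) (dG x)).
have p : 0 < (cst 1 + G * G) x by rewrite /= -[X in _ < X]/(1 + G x * G x) -expr2 ltr_pwDl// sqr_ge0.
rewrite (_ : soft_abs G = Num.sqrt \o (cst 1 + G * G)); last first.
  by apply/funext => y; rewrite /soft_abs /= expr2.
refine (is_derive_eq (is_derive1_comp (is_derive1_sqrt p) h1) _).
have -> : Num.sqrt ((cst 1 + G * G) x) = soft_abs G x by rewrite /soft_abs expr2.
rewrite /dsoft_abs /GRing.scale /=; field; rewrite gt_eqF//; exact: soft_abs_gt0.
Qed.

Lemma continuous_dsoft_abs (G G' : R -> R) : continuous G -> continuous G' ->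
  continuous (soft_abs G) -> continuous (dsoft_abs G G').
Proof.
move=> cG cG' cA x; apply: cvgM; first by apply: cvgM; [exact: cG|exact: cG'].
by apply: cvgV; [rewrite gt_eqF// soft_abs_gt0|exact: cA].
Qed.

Lemma ctrunc_mono (F : R -> R) x : (forall x, 0 <= F x) ->
  {homo (fun i => ctrunc F i x) : n m / (n <= m)%N >-> n <= m}.
Proof.
by move=> F0 n m nm; rewrite /ctrunc ler_wpM2l// cutoff_mono// ?ler1n// ler_nat.
Qed.

End weight.

Section trig_difference.
Context (R : realType).
Local Open Scope ring_scope.

Definition ntrig (l : seq (R * R * R)) : seq (R * R * R) := [seq (- p.1.1, p.1.2, p.2) | p <- l].

Lemma trigN l x : trig (ntrig l) x = - trig l x.
Proof.
rewrite /trig /ntrig big_map -sumrN; apply: eq_bigr => p _ /=; ring.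
Qed.

Lemma dtrigN l x : trig (dtrig (ntrig l)) x = - trig (dtrig l) x.
Proof.
rewrite /trig /dtrig /ntrig !big_map -sumrN; apply: eq_bigr => p _ /=; ring.
Qed.

Lemma trigB l l' : trig (l ++ ntrig l') = (fun x => trig l x - trig l' x).
Proof. by apply/funext => x; rewrite trig_cat trigN. Qed.

Lemma dtrigB l l' : trig (dtrig (l ++ ntrig l')) = (fun x => trig (dtrig l) x - trig (dtrig l') x).
Proof. by apply/funext => x; rewrite /dtrig map_cat trig_cat -/(dtrig _) dtrigN. Qed.

End trig_difference.

(** * Convergence of the quadratic forms *)

Section quadratic_forms.
Context (R : realType) (mu : R -> probability R R) (mu_conv : conv_semigroup mu).
Variables (nu : {sigma_finite_measure set R -> \bar R}) (nu_levy : levy_measure nu).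
Variables (b sigma : R) (sigma0 : (0 <= sigma)%R).
Let re := levy_exponent_re sigma nu.
Let im := levy_exponent_im b nu.
Hypothesis mu_cos : forall t s th : R, (0 <= t)%R ->
  (\int[mu t]_x cos (s * x + th) = expR (t * re s) * cos (t * im s + th))%R.
Variables (a : R) (a0 : (0 < a)%R) (a1 : (a < 1)%R).
Variables (k : nat -> nat) (h c : nat -> R).
Hypotheses (h_ge0 : forall m, (0 <= h m)%R) (c_gt0 : forall m, (0 < c m)%R).
Hypotheses (kh1 : forall m, ((k m).+1%:R * h m <= 1)%R)
  (ack : forall m, (a * c m <= (k m).+1%:R)%R).
Let s m : R := ((k m)%:R * h m)%R.
Hypotheses (s_cvg : s @ \oo --> a) (h_cvg : h @ \oo --> (0 : R)%R)
  (ch_cvg : (c m * h m)%R @[m --> \oo] --> (1 : R)%R).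

(** To be read with k m = floor (alpha 2^m), h m = 1 / n and c m = 2^m, so that [Qform m G] is the
    normalised term of the theorem. *)
Definition Qform m F := (c m)%:E * Vform mu (s m) (h m) F.
Definition Lform F F' := Lgauss mu sigma a F' + Ljump mu nu a F.

Let s_ge0 m : (0 <= s m)%R. Proof. by rewrite mulr_ge0. Qed.
Let sh1 m : (s m + h m <= 1)%R.
Proof. by apply: le_trans (kh1 m); rewrite -natr1 mulrDl mul1r. Qed.

Lemma Qform_ge0 m F : 0 <= Qform m F.
Proof. by apply: mule_ge0; [rewrite lee_fin ltW|exact: Vform_ge0]. Qed.

(** The loss of 1 / a comes from c m <= (k m + 1) / a, where k m + 1 is the number of decrements
    that [Vform_bound] controls. *)
Lemma Qform_bound m F (r : R) : bmeas F -> sqform (mu 1%R) F <= (a * r)%:E ->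
  Qform m F <= r%:E.
Proof.
move=> bF Fr; have := Vform_bound mu_conv (h_ge0 m) (kh1 m) bF.
move=> /le_trans/(_ Fr) H.
rewrite -(@lee_pmul2l _ a%:E) ?lte_fin// /Qform muleA -!EFinM.
apply: le_trans H; apply: lee_wpmul2r; first exact: Vform_ge0.
by rewrite lee_fin.
Qed.

Lemma Lgauss_ge0 F' : 0 <= Lgauss mu sigma a F'.
Proof.
by apply: mule_ge0; [rewrite lee_fin|apply: integral_ge0 => x _; rewrite lee_fin sqr_ge0].
Qed.

Lemma Ljump_ge0 F : 0 <= Ljump mu nu a F.
Proof. by apply: integral_ge0 => u _; apply: integral_ge0 => x _; rewrite lee_fin sqr_ge0. Qed.

Lemma Lform_ge0 F F' : 0 <= Lform F F'.
Proof. by apply: adde_ge0; [exact: Lgauss_ge0|exact: Ljump_ge0]. Qed.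

(** Vectors of L2 spaces whose squared norms are V, the Gaussian part and the jump part; sqrt sigma
    is put inside so that the Gaussian part too is a plain squared norm. *)
Let gV m := Vstep mu (s m) (h m).
Let gG F' (x : R) : R := (Num.sqrt sigma * Pop (mu a) F' x)%R.
Let gJ F (p : R * R) : R := Pop (mu a) (Delta p.1 F) p.2.

Let measurable_gV m F : measurable_fun setT F -> measurable_fun setT (gV m F).
Proof. exact: measurable_Vstep. Qed.

Let measurable_gG F : measurable_fun setT F -> measurable_fun setT (gG F).
Proof. by move=> mF; apply: measurable_funM => //; exact: Pop_measurable. Qed.

Let measurable_gJ F : measurable_fun setT F -> measurable_fun setT (gJ F).
Proof. exact: measurable_Pop_Delta. Qed.

Let VE m F : measurable_fun setT F ->
  Vform mu (s m) (h m) F = sqform (mu (1 - (s m + h m))%R \x mu (h m)) (gV m F).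
Proof. exact: Vform_sqform. Qed.

Let GE F' : measurable_fun setT F' -> Lgauss mu sigma a F' = sqform (mu (1 - a)%R) (gG F').
Proof.
move=> mF'; rewrite /Lgauss /sqform -ge0_integralZl//.
- by apply: eq_integral => x _; rewrite /gG exprMn sqr_sqrtr// EFinM.
- by apply: measurable_sqform; apply: Pop_measurable.
- by move=> x _; rewrite lee_fin sqr_ge0.
Qed.

Let JE F : measurable_fun setT F -> Ljump mu nu a F = sqform (nu \x mu (1 - a)%R) (gJ F).
Proof.
move=> mF; rewrite /sqform fubini_tonelli1//; last by move=> x; rewrite lee_fin sqr_ge0.
by apply: measurable_sqform; exact: measurable_Pop_Delta.
Qed.

Section closure.
Variables (Fs Fs' : nat -> R -> R) (F F' : R -> R).
Hypotheses (bFs : forall i, bmeas (Fs i)) (bFs' : forall i, bmeas (Fs' i)).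
Hypotheses (mF : measurable_fun setT F) (mF' : measurable_fun setT F').
Variable (E : nat -> R).
Hypotheses (E_cvg : E @ \oo --> (0 : R)%R) (E_ge0 : forall i, (0 <= E i)%R).
Hypothesis norm_cauchy : forall i j,
  sqform (mu 1%R) (fun x => Fs i x - Fs j x)%R <= (a * (E i + E j))%:E.
Hypothesis L_fin : forall i, Lform (Fs i) (Fs' i) \is a fin_num.
Hypothesis Q_cvg : forall i, Qform m (Fs i) @[m --> \oo] --> Lform (Fs i) (Fs' i).
Hypothesis L_cauchy : forall i j,
  Lform (fun x => Fs i x - Fs j x)%R (fun x => Fs' i x - Fs' j x)%R <= (E i + E j)%:E.
Hypothesis cvg_V : forall m, {ae mu (1 - (s m + h m))%R \x mu (h m), forall p : R * R,
  gV m (Fs i) p @[i --> \oo] --> gV m F p}.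
Hypothesis cvg_G : {ae mu (1 - a)%R, forall x,
  Pop (mu a) (Fs' i) x @[i --> \oo] --> Pop (mu a) F' x}.
Hypothesis cvg_J : {ae nu \x mu (1 - a)%R, forall p : R * R,
  Pop (mu a) (Delta p.1 (Fs i)) p.2 @[i --> \oo] --> Pop (mu a) (Delta p.1 F) p.2}.

(** In each of the three L2 spaces the vectors of the approximants are Cauchy: for V by
    [norm_cauchy] and [Qform_bound], for the two parts of L by [L_cauchy], as each part is at most
    L. Almost everywhere convergence identifies the limits, and [near_sq_lim] exchanges the limits
    in i and m. *)
Lemma closure_lim : Lform F F' \is a fin_num /\ Qform m F @[m --> \oo] --> Lform F F'.
Proof.
have mFs i := bmeas_measurable (bFs i).
have mFs' i := bmeas_measurable (bFs' i).
have nV i m : near_sq (E i) (Qform m F) (Qform m (Fs i)).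
  rewrite /Qform !VE//.
  (* [gV] represents V without the factor c m, so its vectors are compared up to E i / c m;
     multiplying by c m restores an error uniform in m. *)
  have -> : E i = (c m * (E i / c m))%R by rewrite mulrC divfK// gt_eqF.
  apply: near_sqZ; first exact: ltW.
  have cE : (fun i => E i / c m)%R @ \oo --> (0 : R)%R.
    by rewrite -[X in _ --> X](mul0r (c m)^-1%R); exact: cvgMl.
  have ij i1 j : sqform (mu (1 - (s m + h m))%R \x mu (h m))
      (fun p => gV m (Fs i1) p - gV m (Fs j) p)%R <= (E i1 / c m + E j / c m)%:E.
    have := Qform_bound m (bmeasB (bFs i1) (bFs j)) (norm_cauchy i1 j).
    rewrite /Qform VE; last exact: measurable_funB.
    rewrite -mulrDl mulrC EFinM lee_pdivlMl// => /(le_trans _); apply.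
    rewrite lee_wpmul2l ?lee_fin ?(ltW (c_gt0 m))//.
    rewrite le_eqVlt; apply/orP; left; apply/eqP; apply: eq_integral => p _.
    by rewrite /gV /Vstep !PopB//; congr (_ ^+ 2)%:E; ring.
  have := sqform_fatou (fun j => measurable_gV m (mFs j)) (measurable_gV m mF) (cvg_V m) cE ij i.
  move=> hi; exact: (@near_sq_sym _ _ _ _ (@sqform_near _ _ _ _ _ _ _ (measurable_gV m (mFs i)) (measurable_gV m mF) hi)).
have nG i : near_sq (E i) (Lgauss mu sigma a F') (Lgauss mu sigma a (Fs' i)).
  rewrite !GE//.
  have ij i1 j : sqform (mu (1 - a)%R) (fun x => gG (Fs' i1) x - gG (Fs' j) x)%R <= (E i1 + E j)%:E.
    apply: le_trans (L_cauchy i1 j); rewrite /Lform GE; last exact: measurable_funB.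
    rewrite -[leLHS]adde0; apply: leeD; last exact: Ljump_ge0.
    rewrite le_eqVlt; apply/orP; left; apply/eqP; apply: eq_integral => x _.
    by rewrite /gG PopB// mulrBr.
  have cG : {ae mu (1 - a)%R, forall x, gG (Fs' i) x @[i --> \oo] --> gG F' x}.
    by apply: aeS cvg_G => x hx; exact: cvgMr.
  have hi := sqform_fatou (fun j => measurable_gG (mFs' j)) (measurable_gG mF') cG E_cvg ij i.
  exact: (@near_sq_sym _ _ _ _ (@sqform_near _ _ _ _ _ _ _ (measurable_gG (mFs' i)) (measurable_gG mF') hi)).
have nJ i : near_sq (E i) (Ljump mu nu a F) (Ljump mu nu a (Fs i)).
  rewrite !JE//.
  have ij i1 j : sqform (nu \x mu (1 - a)%R) (fun p => gJ (Fs i1) p - gJ (Fs j) p)%R <= (E i1 + E j)%:E.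
    apply: le_trans (L_cauchy i1 j); rewrite /Lform JE; last exact: measurable_funB.
    rewrite -[leLHS]add0e; apply: leeD; first exact: Lgauss_ge0.
    rewrite le_eqVlt; apply/orP; left; apply/eqP; apply: eq_integral => x _.
    by rewrite /gJ DeltaB PopB//; exact: bmeas_Delta.
  have hi := sqform_fatou (fun j => measurable_gJ (mFs j)) (measurable_gJ mF) cvg_J E_cvg ij i.
  exact: (@near_sq_sym _ _ _ _ (@sqform_near _ _ _ _ _ _ _ (measurable_gJ (mFs i)) (measurable_gJ mF) hi)).
apply: (@near_sq_lim _ _ _ (fun i m => Qform m (Fs i)) (fun i => Lform (Fs i) (Fs' i))
  (fun i => E i + E i)%R).
- by move=> m; exact: Qform_ge0.
- exact: Lform_ge0.
- by move=> j; exact: Lform_ge0.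
- by move=> j; exact: addr_ge0.
- by rewrite -[X in _ --> X]addr0; exact: cvgD.
- by move=> j m; apply: near_sq_le (nV j m); rewrite lerDl.
- by move=> j; apply: near_sqD => //; exact: Lgauss_ge0 || exact: Ljump_ge0.
- exact: L_fin.
- exact: Q_cvg.
Qed.

End closure.

Lemma Qform_trig_cvg l : Qform m (trig l) @[m --> \oo] -->
  Lform (trig l) (trig (dtrig l)).
Proof.
rewrite /Lform (L_trig nu_levy mu_cos)//; [|exact: ltW..].
exact: (trig_limit mu_conv nu_levy mu_cos).
Qed.

Lemma Lform_trig_fin l : Lform (trig l) (trig (dtrig l)) \is a fin_num.
Proof. by rewrite /Lform (L_trig nu_levy mu_cos)//; exact: ltW. Qed.

(** L inherits the bound on Q wherever Q is known to converge to it; this is how L, which contains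
    F', is controlled by the norm of F alone. *)
Lemma Qform_lim_le F F' (r : R) : bmeas F -> sqform (mu 1%R) F <= (a * r)%:E ->
  Qform m F @[m --> \oo] --> Lform F F' ->
  Lform F F' <= r%:E.
Proof.
move=> bF Fr hl; rewrite -(cvg_lim _ hl)//; apply: lime_le.
  by apply/cvg_ex; exists (Lform F F').
by apply: nearW => m; exact: Qform_bound.
Qed.

Lemma Qform_C1_cvg (F F' : R -> R) (M : R) :
  (forall x : R, is_derive x 1%R F (F' x)) -> continuous F' ->
  (forall x, (`|F x| <= M)%R) -> (forall x, (`|F' x| <= M)%R) ->
  Lform F F' \is a fin_num /\
  Qform m F @[m --> \oo] --> Lform F F'.
Proof.
move=> dF cF' FM F'M.
have cF : continuous F.
  by move=> x; apply: differentiable_continuous; apply/derivable1_diffP; have [] := dF x.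
have mF := continuous_measurable_fun cF.
have mF' := continuous_measurable_fun cF'.
have [l_ [lM dlM lF dlF]] := trig_approx dF cF' FM F'M.
have bl j := bmeas_trig (l_ j).
have ml j := bmeas_measurable (bl j).
have mdl j := bmeas_measurable (bmeas_trig (dtrig (l_ j))).
have mM : measurable_fun setT (fun _ : R => (M + 1)%R) by exact: measurable_cst.
have iM t (e : R) : (mu t).-integrable setT (fun x : R => (e)%:E).
  exact: (finite_measure_integrable_cst (mu t) e measurableT).
have M2 : sqform (mu 1%R) (fun=> M + 1)%R < +oo.
  by apply: integrable_lty => //; exact: iM.
have [r [r0 rpos rC]] := l2_cauchy ml mF mM lM lF M2.
have ra0 : (fun i => r i / a)%R @ \oo --> (0 : R)%R.
  by rewrite -[X in _ --> X](mul0r a^-1%R); exact: cvgMl.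
have nC i j : sqform (mu 1%R) (fun x => trig (l_ i) x - trig (l_ j) x)%R <= (a * (r i / a + r j / a))%:E.
  by rewrite -mulrDl mulrC divfK ?gt_eqF//; exact: rC.
have PC t x : Pop (mu t) (trig (l_ i)) x @[i --> \oo] --> Pop (mu t) F x.
  by apply: (@Pop_dct _ _ _ _ (fun=> M + 1)%R) => //; exact: iM.
apply: (@closure_lim (fun i => trig (l_ i)) (fun i => trig (dtrig (l_ i))) F F' bl _ mF mF' (fun i => r i / a)%R ra0 _ nC).
- by move=> i; exact: bmeas_trig.
- by move=> i; rewrite divr_ge0// ltW.
- by move=> i; exact: Lform_trig_fin.
- by move=> i; exact: Qform_trig_cvg.
(* A difference of trigonometric polynomials is again one, so Q converges for it and [Qform_lim_le]
   applies. *)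
- move=> i j; rewrite -trigB -dtrigB.
  apply: Qform_lim_le; [exact: bmeas_trig|by rewrite trigB; exact: nC|exact: Qform_trig_cvg].
- by move=> m; apply: aeW => p; apply: cvgB; exact: PC.
- apply: aeW => x.
  by apply: (@Pop_dct _ _ _ _ (fun=> M + 1)%R) => //; exact: iM.
- apply: aeW => p.
  apply: (@Pop_dct _ _ (fun i => Delta p.1 (trig (l_ i))) _ (fun=> (M + 1) + (M + 1))%R).
  + by move=> n; apply: bmeas_measurable; exact: bmeas_Delta.
  + apply: measurable_funB => //; apply: (measurableT_comp mF); exact: measurable_addr.
  + exact: iM.
  + by move=> n x; rewrite /Delta (le_trans (ler_normB _ _))// lerD.
  + by move=> x; apply: cvgB.
Qed.

Section square_integrable.
Variables (G G' : R -> R).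
Hypotheses (dG : forall x : R, is_derive x 1%R G (G' x)) (cG' : continuous G').
Hypotheses (G2 : sqform (mu 1%R) G < +oo) (G'2 : sqform (mu 1%R) G' < +oo).

Let a0' : (0 <= a)%R := ltW a0.
Let a1' : (a <= 1)%R := ltW a1.
Let cG : continuous G. Proof. exact: deriv_continuous dG. Qed.
Let mG : measurable_fun setT G. Proof. exact: continuous_measurable_fun. Qed.
Let mG' : measurable_fun setT G'. Proof. exact: continuous_measurable_fun. Qed.
Let A := soft_abs G.
Let A' := dsoft_abs G G'.
Let dA (x : R) : is_derive x 1%R A (A' x). Proof. exact: is_derive_soft_abs. Qed.
Let cA : continuous A. Proof. exact: deriv_continuous dA. Qed.
Let cA' : continuous A'. Proof. exact: continuous_dsoft_abs. Qed.
Let mA : measurable_fun setT A. Proof. exact: continuous_measurable_fun. Qed.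
Let A_ge0 (x : R) : (0 <= A x)%R. Proof. exact: sqrtr_ge0. Qed.

Let A2 : sqform (mu 1%R) A < +oo.
Proof.
rewrite /sqform (eq_integral (fun x => 1 + (G x ^+ 2)%:E)); last first.
  by move=> x _; rewrite soft_abs_sqr EFinD.
rewrite ge0_integralD//.
- rewrite integral_cst// mul1e [X in X + _](probability_setT (mu 1%R)).
  by apply: lte_add_pinfty; rewrite ?ltry.
- by move=> x _; rewrite lee_fin sqr_ge0.
- exact: measurable_sqform.
Qed.

Let N := fine (sqform (mu 1%R) A).
Let NE : sqform (mu 1%R) A = N%:E.
Proof. by rewrite fineK// ge0_fin_numE// sqform_ge0. Qed.

Let cc (F : R -> R) (F' : R -> R) (dF : forall x : R, is_derive x 1%R F (F' x)) i :
  continuous (ctrunc F i).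
Proof. exact: (deriv_continuous (is_derive_ctrunc dF i)). Qed.

Let bmeas_ctrunc (F F' : R -> R) (dF : forall x : R, is_derive x 1%R F (F' x))
  (cF' : continuous F') i : bmeas (ctrunc F i).
Proof.
split; first exact: (continuous_measurable_fun (@cc F F' dF i)).
by have [M HM] := ctrunc_bounded dF cF' i; exists M => x; have [] := HM x.
Qed.

Let bA i : bmeas (ctrunc A i). Proof. exact: (bmeas_ctrunc dA cA' i). Qed.
Let mAi i : measurable_fun setT (ctrunc A i). Proof. exact: bmeas_measurable. Qed.

Let Ai_ge0 i x : (0 <= ctrunc A i x)%R. Proof. by rewrite mulr_ge0// cutoff_ge0. Qed.
Let Ai_le i x : (ctrunc A i x <= A x)%R.
Proof. by have := ctrunc_le A i x; rewrite !ger0_norm. Qed.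

Let Ai2 i : sqform (mu 1%R) (ctrunc A i) <= N%:E.
Proof.
rewrite -NE; apply: sqform_le => //; apply: aeW => x; exact: ctrunc_le.
Qed.

(** Truncations of A are bounded C^1 functions with norm at most that of A, so the bound on L holds
    for them uniformly in i. *)
Let jump_bound i : Ljump mu nu a (ctrunc A i) <= (N / a)%:E.
Proof.
have [M HM] := ctrunc_bounded dA cA' i.
have [_ Qc] := Qform_C1_cvg (is_derive_ctrunc dA i) (@continuous_dctrunc _ _ _ dA cA' i) (fun x => (HM x).1) (fun x => (HM x).2).
apply: (@le_trans _ _ (Lform (ctrunc A i) (dctrunc A A' i))).
  by rewrite /Lform leeDr// Lgauss_ge0.
apply: Qform_lim_le => //.
by rewrite mulrC divfK ?gt_eqF// Ai2.
Qed.

Let w := @lm_weight R.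
Let w0 u : (0 <= w u)%R. Proof. exact: lm_weight_ge0. Qed.
Let w1 u : (w u <= 1)%R. Proof. by rewrite /w /lm_weight ge_min lexx. Qed.
Let mw : measurable_fun setT w. Proof. exact: measurable_lm_weight. Qed.
Let W := fine (\int[nu]_u (w u)%:E).
Let WE : \int[nu]_u (w u)%:E = W%:E.
Proof.
rewrite fineK//; have [_ wi] := nu_levy.
by rewrite ge0_fin_numE//; apply: integral_ge0 => u _; rewrite lee_fin.
Qed.

Let M := nu \x mu (1 - a)%R.
(** The square root of the weight compensates the possibly infinite mass of nu near 0: squared, the
    vector carries the finite measure w d nu. *)
Let bigshift F (p : R * R) : R := (Num.sqrt (w p.1) * Pop (mu a) F (p.2 + p.1))%R.

Let madd21 : measurable_fun setT (fun p : R * R => (p.2 + p.1)%R).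
Proof. exact: measurable_funD. Qed.

Let measurable_bigshift F : measurable_fun setT F -> measurable_fun setT (bigshift F).
Proof.
move=> mF; apply: measurable_funM.
  exact: (measurableT_comp (measurableT_comp (continuous_measurable_fun (@sqrt_continuous R)) mw) measurable_fst).
exact: (measurableT_comp (Pop_measurable (mu a) mF) madd21).
Qed.

Let bigshift_sqr F p : ((bigshift F p) ^+ 2 = w p.1 * (Pop (mu a) F (p.2 + p.1)) ^+ 2)%R.
Proof. by rewrite exprMn sqr_sqrtr. Qed.

Let K := (2 * (N / a) + 2 * (W * N))%R.

(** With y and z the shifted and unshifted averages and v = w u <= 1, one has v y^2 <= 2 (y - z)^2 +
    2 v z^2, the defect being 2 (1 - v) (y - z)^2 + v (y - 2 z)^2. The two terms are bounded by
    [jump_bound] and by the contraction property of phi, which gives the constant K. *)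
Let bigshift_bound i : sqform M (bigshift (ctrunc A i)) <= K%:E.
Proof.
set F := ctrunc A i.
have mP : measurable_fun setT (Pop (mu a) F) by exact: (Pop_measurable _ (mAi i)).
have mJ := measurable_Pop_Delta (mu a) (mAi i).
apply: (@le_trans _ _ (\int[M]_p (2%:E * ((Pop (mu a) (Delta p.1 F) p.2) ^+ 2)%:E +
    2%:E * ((w p.1)%:E * ((Pop (mu a) F p.2) ^+ 2)%:E)))).
  apply: ge0_le_integral.
  - exact: measurableT.
  - by move=> x _; rewrite lee_fin sqr_ge0.
  - by apply: measurable_sqform; exact: (measurable_bigshift (mAi i)).
  - apply: emeasurable_funD; apply: measurable_funeM; first exact: measurable_sqform.
    apply: emeasurable_funM; first by apply/measurable_EFinP; exact: (measurableT_comp mw).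
    by apply: measurable_sqform; exact: (measurableT_comp mP).
  move=> p _; rewrite -!EFinM -EFinD lee_fin bigshift_sqr.
  have -> : Pop (mu a) (Delta p.1 F) p.2 = (Pop (mu a) F (p.2 + p.1) - Pop (mu a) F p.2)%R.
    rewrite /Pop /Delta RintB//; last 2 first.
    - apply: (bmeas_comp (f := fun x : R => (x + p.2 + p.1)%R)); last exact: bA.
      by apply: measurable_funD => //; exact: measurable_addr.
    - by apply: bmeas_comp; [exact: measurable_addr|exact: bA].
    by congr (_ - _)%R; apply: eq_Rintegral => x _; rewrite addrA.
  have := w0 p.1; have := w1 p.1.
  move: (w p.1) (Pop (mu a) F (p.2 + p.1)) (Pop (mu a) F p.2) => v y z v1 v0.
  rewrite -subr_ge0 (_ : _ - _ = 2 * (1 - v) * (y - z) ^+ 2 + v * (y - 2 * z) ^+ 2)%R.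
    by rewrite addr_ge0// mulr_ge0 ?sqr_ge0// mulr_ge0// subr_ge0.
  by ring.
have m2 : measurable_fun setT (fun p : R * R => (w p.1)%:E * ((Pop (mu a) F p.2) ^+ 2)%:E).
  apply: emeasurable_funM; first by apply/measurable_EFinP; exact: (measurableT_comp mw).
  by apply: measurable_sqform; exact: (measurableT_comp mP).
have p2 p : 0 <= (w p.1)%:E * ((Pop (mu a) F p.2) ^+ 2)%:E.
  by rewrite -EFinM lee_fin mulr_ge0// sqr_ge0.
rewrite ge0_integralD//; last 4 first.
- by move=> p _; rewrite -EFinM lee_fin mulr_ge0// sqr_ge0.
- by apply: measurable_funeM; exact: measurable_sqform.
- by move=> p _; rewrite mule_ge0.
- exact: measurable_funeM.
rewrite !ge0_integralZl//; last 2 first.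
- exact: measurable_sqform.
- by move=> p _; rewrite lee_fin sqr_ge0.
rewrite /K [leRHS]EFinD; apply: leeD; rewrite [leRHS]EFinM lee_wpmul2l ?lee_fin//.
  apply: le_trans (jump_bound i); rewrite /Ljump fubini_tonelli1//.
    exact: measurable_sqform.
  by move=> x; rewrite lee_fin sqr_ge0.
rewrite (@int_prodM _ _ _ _ _ nu (mu (1 - a)%R) (EFin \o w) (fun c => ((Pop (mu a) F c) ^+ 2)%:E)).
- rewrite /comp WE EFinM lee_wpmul2l//; first by rewrite -WE; apply: integral_ge0 => u _; rewrite lee_fin.
  exact: (le_trans (phi_bound mu_conv (bA i) a0' a1') (Ai2 i)).
- exact/measurable_EFinP.
- exact: measurable_sqform.
- by move=> u; rewrite lee_fin.
- by move=> u; rewrite lee_fin sqr_ge0.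
Qed.

Let nu_ae : {ae M, forall p : R * R, p.1 != 0%R}.
Proof.
apply: (@ae_prod_fst _ _ _ _ _ nu (mu (1 - a)%R) (fun u : R => u != 0%R)).
exact: levy_ae_neq0.
Qed.

Let Ai_int i x : \int[mu a]_y (ctrunc A i ((y : R) + x))%:E = (Pop (mu a) (ctrunc A i) x)%:E.
Proof. by rewrite /Pop EFin_Rint//; apply: bmeas_comp (bA i); exact: measurable_addr. Qed.

Let absA_lim x : \int[mu a]_y (ctrunc A i ((y : R) + x))%:E @[i --> \oo] --> absint (mu a) A x.
Proof.
rewrite /absint (eq_integral (fun y => limn (fun i => (ctrunc A i ((y : R) + x))%:E))); last first.
  move=> y _; apply/esym/cvg_lim => //; apply: cvg_EFin; first exact: nearW.
  by rewrite ger0_norm//; exact: cvg_ctrunc.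
apply: cvg_monotone_convergence.
- exact: measurableT.
- move=> n; apply/measurable_EFinP; apply: (measurableT_comp (mAi n)); exact: measurable_addr.
- by move=> n y _; rewrite lee_fin.
- by move=> y _ n m nm; rewrite lee_fin; exact: ctrunc_mono.
Qed.

(** From y <= 1 + y^2, the weighted shifted averages of the truncations have integrals at most W +
    K. Monotone convergence in the average and Fatou's lemma carry this to [absint], and the weight
    is positive nu-almost everywhere since nu does not charge 0. *)
Let absA_ae : {ae M, forall p : R * R, absint (mu a) A (p.2 + p.1) < +oo}.
Proof.
have mf : measurable_fun setT (fun p : R * R => (w p.1)%:E * absint (mu a) A (p.2 + p.1)%R).
  apply: emeasurable_funM; first by apply/measurable_EFinP; exact: (measurableT_comp mw).
  exact: (measurableT_comp (measurable_absint (mu a) mA) madd21).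
have : {ae M, forall p : R * R, (w p.1)%:E * absint (mu a) A (p.2 + p.1)%R < +oo}.
  apply: ae_lty => //.
    by move=> p; rewrite mule_ge0 ?lee_fin// absint_ge0.
  apply: (@le_lt_trans _ _ (W + K)%:E); last exact: ltry.
  apply: (@fatou_cvg _ _ _ M (fun i p => (w p.1)%:E * (Pop (mu a) (ctrunc A i) (p.2 + p.1))%:E)
    _ (fun=> (W + K)%:E)) => //.
  - move=> n; apply: emeasurable_funM; apply/measurable_EFinP; first exact: (measurableT_comp mw).
    exact: (measurableT_comp (Pop_measurable (mu a) (mAi n)) madd21).
  - move=> n p; rewrite -EFinM lee_fin mulr_ge0//; exact: Rintegral_ge0.
  - by move=> p; rewrite mule_ge0 ?lee_fin// absint_ge0.
  - apply: aeW => p; apply: cvgeZl => //.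
    by under eq_fun do rewrite -Ai_int; exact: absA_lim.
  - move=> n; apply: (@le_trans _ _ (\int[M]_p ((w p.1)%:E * 1 + ((bigshift (ctrunc A n) p) ^+ 2)%:E))).
      apply: ge0_le_integral.
      + exact: measurableT.
      + move=> p _; rewrite -EFinM lee_fin mulr_ge0//; exact: Rintegral_ge0.
      + apply: emeasurable_funM; apply/measurable_EFinP; first exact: (measurableT_comp mw).
        exact: (measurableT_comp (Pop_measurable (mu a) (mAi n)) madd21).
      + apply: emeasurable_funD; last by apply: measurable_sqform; exact: (measurable_bigshift (mAi n)).
        by apply: emeasurable_funM => //; apply/measurable_EFinP; exact: (measurableT_comp mw).
      move=> p _; rewrite mule1 -EFinM -EFinD lee_fin bigshift_sqr.
      rewrite -[X in (_ <= X + _)%R]mulr1 -mulrDr ler_wpM2l//.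
      set y := Pop _ _ _; nra.
    rewrite ge0_integralD//; last 4 first.
    + by move=> p _; rewrite mule1 lee_fin.
    + by apply: emeasurable_funM => //; apply/measurable_EFinP; exact: (measurableT_comp mw).
    + by move=> p _; rewrite lee_fin sqr_ge0.
    + by apply: measurable_sqform; exact: (measurable_bigshift (mAi n)).
    rewrite EFinD; apply: leeD; last exact: bigshift_bound.
    rewrite (@int_prodM _ _ _ _ _ nu (mu (1 - a)%R) (EFin \o w) (cst 1))//.
    * by rewrite integral_cst// mul1e [X in _ * X](probability_setT (mu (1 - a)%R)) mule1 -WE.
    * exact/measurable_EFinP.
  - exact: cvg_cst.
apply: aeS2 nu_ae => p p0 /=.
have wp : (0 < w p.1)%R by exact: lm_weight_gt0.
have := absint_ge0 (mu a) A (p.2 + p.1)%R.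
by case: (absint _ _ _) => [r| |] _ //; rewrite ?ltry// gt0_muley ?lte_fin.
Qed.

Lemma absint_shift_ae : {ae nu \x mu (1 - a)%R, forall p : R * R,
  absint (mu a) G (p.2 + p.1) < +oo /\ absint (mu a) G p.2 < +oo}.
Proof.
have h2 : {ae M, forall p : R * R, absint (mu a) G p.2 < +oo}.
  apply: (@ae_prod_snd _ _ _ _ _ nu (mu (1 - a)%R) (fun c => absint (mu a) G c < +oo)).
  exact: absint_ae (abs_int_lty mG G2).
apply: aeS2 absA_ae h2 => p p1 p2; split => //.
apply: le_lt_trans p1; apply: ge0_le_integral.
- exact: measurableT.
- by [].
- apply/measurable_EFinP; apply: measurableT_comp => //; apply: (measurableT_comp mG).
  exact: measurable_addr.
- apply/measurable_EFinP; apply: measurableT_comp => //; apply: (measurableT_comp mA).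
  exact: measurable_addr.
by move=> x _; rewrite lee_fin [leRHS]ger0_norm// le_soft_abs.
Qed.

(** |G| need not be C^1, so [bigshift_bound] is not applied to it directly: its cutoffs are
    dominated by those of A, and Fatou's lemma removes the cutoff. *)
Lemma shift_L2 : sqform (nu \x mu (1 - a)%R) (fun p : R * R =>
  Num.sqrt (lm_weight p.1) * Pop (mu a) (fun x => `|G x|) (p.2 + p.1))%R < +oo.
Proof.
have mG1 : measurable_fun setT (fun x => `|G x|)%R by exact: measurableT_comp.
apply: (@le_lt_trans _ _ K%:E); last exact: ltry.
pose Gi i x := (`|G x| * cutoff i.+1%:R x)%R.
have GA x : (`|G x| <= A x)%R by exact: le_soft_abs.
have mcut i : measurable_fun setT (@cutoff R i.+1%:R).
  by apply: continuous_measurable_fun; apply: deriv_continuous; exact: is_derive_cutoff.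
have mGi i : measurable_fun setT (Gi i) by exact: measurable_funM.
have Gi0 i x : (0 <= Gi i x)%R by rewrite mulr_ge0// cutoff_ge0.
have GiA i x : (Gi i x <= ctrunc A i x)%R by rewrite ler_wpM2r// cutoff_ge0.
have bGi i : bmeas (Gi i).
  split => //; have [_ [B HB]] := bA i; exists B => x.
  by apply: le_trans (HB x); rewrite !ger0_norm.
apply: (@sqform_lim_le _ _ _ M (fun i => bigshift (Gi i))).
- by move=> n; exact: (measurable_bigshift (mGi n)).
- exact: (measurable_bigshift mG1).
- apply: aeS absint_shift_ae => p [p1 _].
  apply: cvgMr; apply: (@Pop_dct _ _ _ _ (fun x => `|G x|)%R) => //.
  + exact: integrable_abse (absint_integrable mG p1).
  + by move=> n x; rewrite ger0_norm// ler_piMr// cutoff_le1.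
  + move=> x; rewrite -[X in _ --> X]mulr1; apply: cvgMr; exact: cvg_cutoff.
- move=> n; apply: le_trans (bigshift_bound n); apply: sqform_le.
  + exact: (measurable_bigshift (mGi n)).
  + exact: (measurable_bigshift (mAi n)).
  apply: aeW => p; rewrite /bigshift !normrM ler_wpM2l//.
  rewrite !ger0_norm; [|exact: Rintegral_ge0..].
  apply: le_Rintegral => //; apply: bmeas_integrable;
    by apply: bmeas_comp; [exact: measurable_addr|].
Qed.

Lemma Qform_L2_cvg : Lform G G' \is a fin_num /\
  Qform m G @[m --> \oo] --> Lform G G'.
Proof.
have bG i : bmeas (ctrunc G i) by exact: (bmeas_ctrunc dG cG' i).
have mGi i := bmeas_measurable (bG i).
have mdG i : measurable_fun setT (dctrunc G G' i).
  exact: (continuous_measurable_fun (@continuous_dctrunc _ _ _ dG cG' i)).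
have mabs : measurable_fun setT (fun x => `|G x|)%R by exact: measurableT_comp.
have G1 := abs_int_lty mG G2.
have [r [r0 rpos rC]] := l2_cauchy mGi mG mabs (ctrunc_le G) (@cvg_ctrunc _ G)
  (eq_ind_r (fun z => z < +oo) G2 (sqform_abs (mu 1%R) G)).
have ra0 : (fun i => r i / a)%R @ \oo --> (0 : R)%R.
  by rewrite -[X in _ --> X](mul0r a^-1%R); exact: cvgMl.
have nC i j : sqform (mu 1%R) (fun x => ctrunc G i x - ctrunc G j x)%R <= (a * (r i / a + r j / a))%:E.
  by rewrite -mulrDl mulrC divfK ?gt_eqF//; exact: rC.
have QC i := let: ex_intro Mi HM := ctrunc_bounded dG cG' i in
  Qform_C1_cvg (is_derive_ctrunc dG i) (@continuous_dctrunc _ _ _ dG cG' i) (fun x => (HM x).1) (fun x => (HM x).2).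
pose Wt x := (`|G' x| + 4 * `|G x|)%R.
have mW : measurable_fun setT Wt.
  apply: measurable_funD; first exact: measurableT_comp.
  by apply: measurable_funM.
have W2 : sqform (mu 1%R) Wt < +oo.
  apply: sqformD_lty.
  - exact: measurableT_comp.
  - by apply: measurable_funM.
  - by rewrite sqform_abs.
  rewrite (_ : sqform _ _ = 16%:E * sqform (mu 1%R) G); first by apply: lte_mul_pinfty => //; exact: sqform_ge0.
  rewrite /sqform -ge0_integralZl//.
  - by apply: eq_integral => x _; rewrite exprMn real_normK ?num_real// -EFinM; congr (_ * _)%:E; ring.
  - exact: measurable_sqform.
  - by move=> x _; rewrite lee_fin sqr_ge0.
apply: (@closure_lim (ctrunc G) (dctrunc G G') G G' bG _ mG mG' (fun i => r i / a)%R ra0 _ nC).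
- move=> i; split => //; have [Mi HM] := ctrunc_bounded dG cG' i.
  by exists Mi => x; have [] := HM x.
- by move=> i; rewrite divr_ge0// ltW.
- by move=> i; exact: (QC i).1.
- by move=> i; exact: (QC i).2.
(* The difference of two truncations is a bounded C^1 function with bounded derivative, so the
   convergence already proved for that class gives the bound on its L. *)
- move=> i j; have [Mi HMi] := ctrunc_bounded dG cG' i; have [Mj HMj] := ctrunc_bounded dG cG' j.
  have [] := @Qform_C1_cvg (fun x => ctrunc G i x - ctrunc G j x)%R
    (fun x => dctrunc G G' i x - dctrunc G G' j x)%R (Mi + Mj)%R.
  + by move=> x; apply: is_deriveB; exact: is_derive_ctrunc.
  + by move=> x; apply: cvgB; exact: continuous_dctrunc.
  + by move=> x; rewrite (le_trans (ler_normB _ _))// lerD//; [have [] := HMi x|have [] := HMj x].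
  + by move=> x; rewrite (le_trans (ler_normB _ _))// lerD//; [have [] := HMi x|have [] := HMj x].
  move=> _ Qc; apply: Qform_lim_le Qc => //.
  exact: bmeasB.
- move=> m.
  have s0 : (0 <= (k m)%:R * h m)%R by rewrite mulr_ge0.
  have sh : ((k m)%:R * h m + h m <= 1)%R.
    by apply: le_trans (kh1 m); rewrite -natr1 mulrDl mul1r.
  apply: aeS (absint_ae_pair mu_conv mG s0 (h_ge0 m) sh G1) => p [p1 p2].
  apply: cvgB; apply: Pop_dominated => //; try exact: ctrunc_le; exact: cvg_ctrunc.
- apply: aeS (absint_ae mu_conv mW a0' a1' (abs_int_lty mW W2)) => x Wx.
  apply: (@Pop_dct _ _ _ _ Wt) => //.
  + exact: absint_integrable.
  + by move=> n y; exact: dctrunc_le.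
  + exact: cvg_dctrunc.
- apply: aeS absint_shift_ae => p [p1 p2].
  (* The majorant is integrable for almost every pair by [absint_shift_ae]. *)
  apply: (@Pop_dct _ _ (fun i => Delta p.1 (ctrunc G i)) _ (fun x => `|G (x + p.1)| + `|G x|)%R).
  + by move=> n; apply: bmeas_measurable; exact: bmeas_Delta.
  + apply: measurable_funB => //; apply: (measurableT_comp mG); exact: measurable_addr.
  + have i1 := integrable_abse (absint_integrable mG p1).
    have i2 := integrable_abse (absint_integrable mG p2).
    have := integrableD measurableT i1 i2; apply: eq_integrable => // x _ /=.
    by rewrite addrA.
  + by move=> n x; rewrite /Delta (le_trans (ler_normB _ _))// lerD// ctrunc_le.
  + by move=> x; apply: cvgB; exact: cvg_ctrunc.
Qed.

End square_integrable.

End quadratic_forms.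

(** * Back to the processes *)

Section double_expectation.
Context (R : realType) (m0 m1 : probability R R) (g : R -> R).
Hypothesis mg : measurable_fun setT g.
Hypothesis g_ae : {ae m0, forall c, absint m1 g c < +oo}.
Hypothesis g_L2 : sqform m0 (Pop m1 (fun x => `|g x|%R)) < +oo.

Let f (p : R * (R * R)) : R := (g (p.2.1 + p.1) * g (p.2.2 + p.1))%R.

Let mf : measurable_fun setT f.
Proof.
have m1' : measurable_fun setT (fun p : R * (R * R) => p.2.1 + p.1)%R.
  by apply: measurable_funD => //; exact: measurableT_comp.
have m2' : measurable_fun setT (fun p : R * (R * R) => p.2.2 + p.1)%R.
  by apply: measurable_funD => //; exact: measurableT_comp.
by apply: measurable_funM; [exact: (measurableT_comp mg m1')|exact: (measurableT_comp mg m2')].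
Qed.

Let mgc c : measurable_fun setT (fun x : R => g (x + c)%R).
Proof. by apply: (measurableT_comp mg); exact: measurable_addr. Qed.

Let mabs : measurable_fun setT (fun x => `|g x|)%R.
Proof. exact: measurableT_comp. Qed.

Lemma double_integrable : (m0 \x (m1 \x m1)%E).-integrable setT (EFin \o f).
Proof.
apply: (iffRL (@integrable12ltyP _ _ _ _ _ m0 (m1 \x m1 : probability _ _) (EFin \o f) _)); first exact/measurable_EFinP.
rewrite (eq_integral (fun c => absint m1 g c * absint m1 g c)); last first.
  move=> c _; rewrite (eq_integral (fun q : R * R => (`|g (q.1 + c)|)%:E * (`|g (q.2 + c)|)%:E)); last first.
    by move=> q _; rewrite /f /= normrM.
  rewrite (@int_prodM _ _ _ _ _ m1 m1 (fun x => (`|g (x + c)|)%:E) (fun x => (`|g (x + c)|)%:E))//.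
  - by apply/measurable_EFinP; exact: (measurableT_comp _ (mgc c)).
  - by apply/measurable_EFinP; exact: (measurableT_comp _ (mgc c)).
rewrite (ge0_ae_eq_integral (g := fun c => ((Pop m1 (fun x => `|g x|) c) ^+ 2)%:E))//.
- by apply: emeasurable_funM; exact: measurable_absint.
- by apply: measurable_sqform; exact: Pop_measurable.
- by move=> c _; rewrite mule_ge0// absint_ge0.
- by move=> c _; rewrite lee_fin sqr_ge0.
- by apply: aeS g_ae => c gc _; rewrite absint_Pop// -EFinM expr2.
Qed.

(** Fubini with the shared variable c outermost: given c, the two factors are independent with the
    same mean. *)
Lemma double_integral : \int[m0 \x (m1 \x m1)%E]_p (f p)%:E = sqform m0 (Pop m1 g).
Proof.
rewrite -(@integral12_prod_meas1 _ _ _ _ _ m0 (m1 \x m1 : probability _ _) (EFin \o f) double_integrable).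
apply: ae_eq_integral => //.
- exact: (@measurable_fubini_F _ _ _ _ _ m0 (m1 \x m1 : probability _ _) (EFin \o f) double_integrable).
- by apply: measurable_sqform; exact: Pop_measurable.
apply: aeS g_ae => c gc _.
have ig := absint_integrable mg gc.
have H : (m1 \x m1).-integrable setT (fun q : R * R => (g (q.1 + c) * g (q.2 + c))%:E).
  apply: (iffRL (@integrable12ltyP _ _ _ _ _ m1 m1 _ _)).
    apply/measurable_EFinP; apply: measurable_funM.
      exact: (measurableT_comp (mgc c) measurable_fst).
    exact: (measurableT_comp (mgc c) measurable_snd).
  rewrite (eq_integral (fun x : R => (`|g (x + c)|)%:E * absint m1 g c)); last first.
    move=> x _; rewrite /absint -ge0_integralZl//.
    - by apply: eq_integral => y _; rewrite /= normrM.
    - by apply/measurable_EFinP; exact: (measurableT_comp _ (mgc c)).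
  rewrite ge0_integralZr//; last 2 first.
  - by apply/measurable_EFinP; exact: (measurableT_comp _ (mgc c)).
  - exact: absint_ge0.
  rewrite -/(absint m1 g c) absint_Pop// -EFinM; exact: ltry.
rewrite /fubini_F /f /= -(integral12_prod_meas1 H) /fubini_F /=.
have e : \int[m1]_x (g ((x : R) + c))%:E = (Pop m1 g c)%:E.
  by rewrite /Pop /Rintegral fineK//; exact: (integrable_fin_num measurableT ig).
rewrite (eq_integral (fun x : R => (Pop m1 g c)%:E * (g (x + c))%:E)); last first.
  move=> x _; rewrite muleC -e -integralZl//.
rewrite integralZl// e -EFinM expr2//.
Qed.

Lemma double_has_int d (T : measurableType d) (P : probability T R) (Z X X' : T -> R) :
  measurable_fun setT Z -> measurable_fun setT X -> measurable_fun setT X' ->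
  (forall E, measurable E -> P ((fun w => (Z w, (X w, X' w))) @^-1` E) = (m0 \x (m1 \x m1)%E) E) ->
  has_int P (fun w => g (X w + Z w) * g (X' w + Z w))%R (fine (sqform m0 (Pop m1 g))).
Proof.
move=> mZ mX mX' law.
have mZX : measurable_fun setT (fun w => (Z w, (X w, X' w))).
  by apply: measurable_fun_pair => //; exact: measurable_fun_pair.
pose m2 := (m0 \x (m1 \x m1 : probability _ _) : probability _ _).
have iP := @integrable_law _ _ _ _ _ P m2 _ mZX law _ double_integrable.
split; first exact: iP.
rewrite /Rintegral -double_integral; congr fine.
apply: (@integral_law _ _ _ _ _ P m2 _ mZX law (EFin \o f)); exact/measurable_EFinP.
Qed.

End double_expectation.

Section influence.
Context (R : realType) d (T : measurableType d) (P : probability T R).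
Variables (Y Y' Y'' : R -> {RV P >-> R}).
Hypotheses (Y_levy : levy_process Y) (Y'_copy : process_copy Y Y')
  (Y_indep : independent_processes3 Y Y' Y'').
Let mu (t : R) : probability R R := distribution P (Y t).
Let mu_conv : conv_semigroup mu := levy_conv_semigroup Y_levy.
Variables (G : R -> R) (mG : measurable_fun setT G) (G2 : sqform (mu 1%R) G < +oo).

Let measurable_incr (Z : R -> {RV P >-> R}) n l :
  measurable_fun setT (fun w => increments Z n w l).
Proof. by apply: measurable_funB. Qed.

Lemma replaced_has_int n (i : 'S_n) j : (0 < n)%N -> (j <= n)%N ->
  has_int P (fun w => G (\sum_(l < n) increments Y n w l) *
    G (\sum_(l < n) replaced i j (increments Y n w) (increments Y' n w) l))%R
    (fine (phi mu (j%:R / n%:R) G)).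
Proof.
move=> n0 jn.
have n0' : (0 < n%:R :> R)%R by rewrite ltr0n.
have t0 : (0 <= j%:R / n%:R :> R)%R by rewrite divr_ge0.
have t1 : (j%:R / n%:R <= 1 :> R)%R by rewrite ler_pdivrMr// mul1r ler_nat.
have mK : measurable_fun setT (fun w => kept_sum i j (increments Y n w)).
  apply: measurable_sumT => a; exact: measurable_incr.
have mM (Z : R -> {RV P >-> R}) : measurable_fun setT (fun w => moved_sum i j (increments Z n w)).
  apply: measurable_sumT => a; exact: measurable_incr.
have := double_has_int mG (absint_ae mu_conv mG t0 t1 (abs_int_lty mG G2))
  (le_lt_trans (phi_abs_L2 mu_conv mG t0 t1 G2) G2) mK (mM Y) (mM Y')
  (fun E mE => increments_triple_law Y_levy Y'_copy Y_indep n0 i jn mE).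
by under eq_fun do rewrite -sum_kept_moved -sum_replaced.
Qed.

(** The index of B starts at 1, so B_(k+1) is the decrement of phi from k / n to (k + 1) / n.
    Finiteness of phi makes the subtraction in [phi_V_L2] legitimate. *)
Lemma Bseq_Vform n k : (0 < n)%N -> (k < n)%N ->
  Bseq P (fun x : 'I_n -> R => G (\sum_(l < n) x l)%R) (increments Y n) (increments Y' n) k.+1 =
  Vform mu (k%:R * n%:R^-1) n%:R^-1 G.
Proof.
move=> n0 kn.
have n0' : (0 < n%:R :> R)%R by rewrite ltr0n.
have h0 : (0 <= n%:R^-1 :> R)%R by rewrite invr_ge0 ltW.
have s0 : (0 <= k%:R / n%:R :> R)%R by rewrite divr_ge0.
have e : (k%:R / n%:R + n%:R^-1 = k.+1%:R / n%:R :> R)%R by rewrite -natr1 mulrDl mul1r.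
have sh : (k%:R / n%:R + n%:R^-1 <= 1 :> R)%R by rewrite e ler_pdivrMr// mul1r ler_nat.
have s1 : (k%:R / n%:R <= 1 :> R)%R by rewrite ler_pdivrMr// mul1r ler_nat ltnW.
have sh0 : (0 <= k%:R / n%:R + n%:R^-1 :> R)%R by rewrite addr_ge0.
have phif t : (0 <= t)%R -> (t <= 1)%R -> phi mu t G \is a fin_num.
  move=> t0 t1; rewrite ge0_fin_numE ?phi_ge0//.
  by apply: (le_lt_trans _ G2); exact: phi_le_L2.
have HV : (fine (phi mu (k%:R / n%:R) G) - fine (phi mu (k.+1%:R / n%:R) G))%:E =
    Vform mu (k%:R * n%:R^-1) n%:R^-1 G.
  rewrite -e EFinB !fineK ?phif//.
  by rewrite (phi_V_L2 mu_conv mG G2 s0 h0 sh) addeK// phif.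
rewrite /Bseq unlock /=.
have H := has_intZ (n`!)%:R^-1%R (has_int_sum (index_enum {perm 'I_n}) (fun i =>
  has_intB (replaced_has_int i n0 (ltnW kn)) (replaced_has_int i n0 kn))).
have := has_intE H.
rewrite [X in _ = X%:E -> _](_ : _ = (fine (phi mu (k%:R / n%:R) G) - fine (phi mu (k.+1%:R / n%:R) G)))%R.
  rewrite HV => <-; apply: eq_integral => w _; congr (_ * _)%:E.
  by apply: eq_bigr => i _; rewrite mulrBr.
(* Every permutation contributes the same value, so their number cancels the factor 1 / n!. *)
have sz : size (index_enum {perm 'I_n}) = n`! by rewrite -card_Sn cardT enumT.
rewrite big_const_seq count_predT sz iter_addr_0 -[X in (_ * X)%R]mulr_natl mulrA mulVf ?mul1r//.
Qed.

End influence.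

(** * Exchange of the expectation and the integral over jumps *)

Lemma ae_slice (R : realType) d1 d2 (T1 : measurableType d1) (T2 : measurableType d2)
    (m1 : {sigma_finite_measure set T1 -> \bar R}) (m2 : {sigma_finite_measure set T2 -> \bar R})
    (A : T1 * T2 -> Prop) :
  {ae m1 \x m2, forall p, A p} -> {ae m1, forall x, {ae m2, forall y, A (x, y)}}.
Proof.
move=> [N [mN N0 subN]].
have mx : measurable_fun setT (m2 \o xsection N) by exact: measurable_fun_xsection.
have /(ae_eq_integral_abs m1 measurableT mx) h : \int[m1]_x `|(m2 \o xsection N) x| = 0.
  by rewrite (eq_integral (m2 \o xsection N))// => x _; rewrite gee0_abs.
apply: aeS h => x /(_ Logic.I) /= hx; exists (xsection N x); split => //.
- exact: measurable_xsection.
- by move=> y /= hy; rewrite /xsection/= inE; exact: subN.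
Qed.

Section jump_differences.
Context (R : realType) (m0 m1 : probability R R).
Variables (nu : {sigma_finite_measure set R -> \bar R}) (nu_levy : levy_measure nu).
Variables (G : R -> R) (mG : measurable_fun setT G).
Hypothesis G_ae : {ae nu \x m0, forall p : R * R,
  absint m1 G (p.2 + p.1) < +oo /\ absint m1 G p.2 < +oo}.
Hypothesis G_shift_L2 : sqform (nu \x m0) (fun p : R * R =>
  Num.sqrt (lm_weight p.1) * Pop m1 (fun x => `|G x|) (p.2 + p.1))%R < +oo.
Hypothesis G_L2 : sqform m0 (Pop m1 (fun x => `|G x|%R)) < +oo.

Lemma measurable_Delta u : measurable_fun setT (Delta u G).
Proof. by apply: measurable_funB => //; apply: (measurableT_comp mG); exact: measurable_addr. Qed.

Let mabs : measurable_fun setT (fun x => `|G x|)%R.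
Proof. exact: measurableT_comp. Qed.

Let mw : measurable_fun setT (fun p : R * R => Num.sqrt (lm_weight p.1))%R.
Proof.
exact: (measurableT_comp (measurableT_comp (continuous_measurable_fun (@sqrt_continuous R))
  (@measurable_lm_weight R)) measurable_fst).
Qed.

Let absint_Delta_le u c : absint m1 (Delta u G) c <= absint m1 G (c + u)%R + absint m1 G c.
Proof.
rewrite /absint -ge0_integralD//; last 2 first.
- by apply/measurable_EFinP; apply: (measurableT_comp mabs); exact: measurable_addr.
- by apply/measurable_EFinP; apply: (measurableT_comp mabs); exact: measurable_addr.
apply: ge0_le_integral.
- exact: measurableT.
- by [].
- apply/measurable_EFinP; apply: measurableT_comp => //.
  by apply: (measurableT_comp (measurable_Delta u)); exact: measurable_addr.
- apply: emeasurable_funD.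
    by apply/measurable_EFinP; apply: (measurableT_comp mabs); exact: measurable_addr.
  by apply/measurable_EFinP; apply: (measurableT_comp mabs); exact: measurable_addr.
by move=> x _; rewrite -EFinD lee_fin /Delta addrA ler_normB.
Qed.

Lemma absint_Delta_prod_ae : {ae nu \x m0, forall p : R * R, absint m1 (Delta p.1 G) p.2 < +oo /\
  (Pop m1 (fun x => `|Delta p.1 G x|) p.2 <=
   Pop m1 (fun x => `|G x|) (p.2 + p.1) + Pop m1 (fun x => `|G x|) p.2)%R}.
Proof.
apply: aeS G_ae => p [p1 p2].
have h := absint_Delta_le p.1 p.2.
have h1 : absint m1 (Delta p.1 G) p.2 < +oo by apply: (le_lt_trans h); exact: lte_add_pinfty.
split => //.
by move: h; rewrite (absint_Pop h1) (absint_Pop p1) (absint_Pop p2) -EFinD lee_fin.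
Qed.

Lemma absint_Delta_ae : {ae nu, forall u : R, {ae m0, forall c, absint m1 (Delta u G) c < +oo}}.
Proof. by apply: aeS (ae_slice absint_Delta_prod_ae) => u; apply: aeS => c []. Qed.

Lemma measurable_Pop_abs_Delta :
  measurable_fun setT (fun p : R * R => Pop m1 (fun x => `|Delta p.1 G x|)%R p.2).
Proof.
apply: (@measurable_Pop_family _ m1 (fun q => `|Delta q.1 G q.2|)%R).
by apply: measurableT_comp => //; exact: measurable_Delta2.
Qed.

(** Absolute values forbid any cancellation between G (x + u) and G x, so each is bounded
    separately; the weight makes both contributions finite. *)
Lemma abs_Delta_L2 : sqform (nu \x m0) (fun p : R * R =>
  Num.sqrt (lm_weight p.1) * Pop m1 (fun x => `|Delta p.1 G x|) p.2)%R < +oo.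
Proof.
have mP := Pop_measurable m1 mabs.
have ms : measurable_fun setT (fun p : R * R =>
    Num.sqrt (lm_weight p.1) * Pop m1 (fun x => `|G x|) (p.2 + p.1))%R.
  by apply: measurable_funM => //; apply: (measurableT_comp mP); exact: measurable_funD.
have mf : measurable_fun setT (fun p : R * R =>
    Num.sqrt (lm_weight p.1) * Pop m1 (fun x => `|G x|) p.2)%R.
  by apply: measurable_funM => //; exact: (measurableT_comp mP measurable_snd).
have f2 : sqform (nu \x m0) (fun p : R * R =>
    Num.sqrt (lm_weight p.1) * Pop m1 (fun x => `|G x|) p.2)%R < +oo.
  rewrite /sqform (eq_integral (fun p : R * R => (lm_weight p.1)%:E *
    ((Pop m1 (fun x => `|G x|) p.2) ^+ 2)%:E)); last first.
    by move=> p _; rewrite exprMn sqr_sqrtr ?lm_weight_ge0// EFinM.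
  rewrite (@int_prodM _ _ _ _ _ nu m0 (fun u => (lm_weight u)%:E)
    (fun c => ((Pop m1 (fun x => `|G x|) c) ^+ 2)%:E))//.
  - have [_ wi] := nu_levy; move: G_L2; rewrite /sqform.
    have w0 : 0 <= \int[nu]_u (lm_weight u)%:E.
      by apply: integral_ge0 => u _; rewrite lee_fin lm_weight_ge0.
    have s0 := sqform_ge0 m0 (Pop m1 (fun x => `|G x|%R)); rewrite /sqform in s0.
    move=> s2; rewrite -(@fineK _ (\int[m0]_x _)); last by rewrite ge0_fin_numE.
    rewrite -(@fineK _ (\int[nu]_x _)); last by rewrite ge0_fin_numE.
    by rewrite -EFinM ltry.
  - by apply/measurable_EFinP; exact: measurable_lm_weight.
  - exact: measurable_sqform.
  - by move=> u; rewrite lee_fin lm_weight_ge0.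
  - by move=> u; rewrite lee_fin sqr_ge0.
apply: (le_lt_trans _ (sqformD_lty ms mf G_shift_L2 f2)).
have mD := measurable_Pop_abs_Delta.
apply: sqform_le; [exact: measurable_funM|exact: measurable_funD|].
apply: aeS absint_Delta_prod_ae => p [_ hp]; rewrite -mulrDr !normrM ler_wpM2l//.
by rewrite !ger0_norm ?addr_ge0 ?Pop_abs_ge0.
Qed.

(** By Tonelli, weight times norm is finite for nu-almost every u, and the weight vanishes only at
    0, a null set. *)
Lemma abs_Delta_L2_ae : {ae nu, forall u : R, sqform m0 (Pop m1 (fun x => `|Delta u G x|%R)) < +oo}.
Proof.
have mD := measurable_Pop_abs_Delta.
have := abs_Delta_L2; rewrite /sqform.
rewrite (eq_integral (fun p : R * R => (lm_weight p.1)%:E *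
    ((Pop m1 (fun x => `|Delta p.1 G x|) p.2) ^+ 2)%:E)); last first.
  by move=> p _; rewrite exprMn sqr_sqrtr ?lm_weight_ge0// EFinM.
have mm : measurable_fun setT (fun p : R * R => (lm_weight p.1)%:E *
    ((Pop m1 (fun x => `|Delta p.1 G x|)%R p.2) ^+ 2)%:E).
  apply: emeasurable_funM; last exact: measurable_sqform.
  by apply/measurable_EFinP; exact: (measurableT_comp (@measurable_lm_weight R)).
have p0 (p : R * R) : 0 <= (lm_weight p.1)%:E * ((Pop m1 (fun x => `|Delta p.1 G x|)%R p.2) ^+ 2)%:E.
  by rewrite -EFinM lee_fin mulr_ge0 ?lm_weight_ge0// sqr_ge0.
rewrite (@fubini_tonelli1 _ _ _ _ _ nu m0 _ mm p0) /fubini_F /= => hi.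
have := ae_lty (measurable_integral m0 mm) (fun u => integral_ge0 m0 (fun c _ => p0 (u, c))) hi.
apply: aeS2 (levy_ae_neq0 nu_levy) => u u0 /=.
have wp : (0 < lm_weight u)%R by exact: lm_weight_gt0.
rewrite ge0_integralZl//; last 3 first.
- by apply: measurable_sqform; exact: (measurableT_comp mD (measurable_pair1 _)).
- by move=> c _; rewrite lee_fin sqr_ge0.
- by rewrite lee_fin ltW.
have := sqform_ge0 m0 (Pop m1 (fun x => `|Delta u G x|%R)); rewrite /sqform.
by case: (\int[m0]_x _) => [r| |] _ //; rewrite ?ltry// gt0_muley ?lte_fin.
Qed.

End jump_differences.

(** An indicator with real values: being its own square, it can be put inside a squared norm. *)
Definition small (R : realType) (u : R) : R := if (`|u| <= 1)%R then 1%R else 0%R.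

Section small_facts.
Context (R : realType).
Local Open Scope ring_scope.

Lemma small01 (u : R) : small u = 0 \/ small u = 1.
Proof. by rewrite /small; case: ifP; [right|left]. Qed.

Lemma small_sqr (u : R) : small u ^+ 2 = small u.
Proof. by case: (small01 u) => ->; rewrite ?expr0n ?expr1n. Qed.

Lemma small_ge0 (u : R) : 0 <= small u.
Proof. by case: (small01 u) => ->. Qed.

Lemma measurable_small : measurable_fun setT (@small R).
Proof.
by apply: measurable_fun_ifT => //; apply: measurable_fun_ler => //; exact: measurableT_comp.
Qed.

Lemma small_sqr_le (u : R) : small u * u ^+ 2 <= lm_weight u.
Proof.
rewrite /small; case: ifPn => u1; last by rewrite mul0r lm_weight_ge0.
rewrite mul1r /lm_weight le_min lexx andbT -(real_normK (num_real u)).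
by rewrite expr_le1.
Qed.

Lemma large_le (u : R) : 1 - small u <= lm_weight u.
Proof.
rewrite /small; case: ifPn => u1; first by rewrite subrr lm_weight_ge0.
rewrite subr0 /lm_weight le_min lexx/= -(real_normK (num_real u)) expr_ge1//.
by rewrite ltW// ltNge.
Qed.

Lemma Delta_lipschitz (G G' : R -> R) (r : R) : (forall x : R, is_derive x 1%R G (G' x)) ->
  continuous G' ->
  exists2 C, 0 <= C & forall x u, `|x| <= r -> `|u| <= 1 -> `|Delta u G x| <= C * `|u|.
Proof.
move=> dG cG'; have [C C0 HC] := continuous_bounded_on (r + 1) cG'.
exists C => // x u xr u1.
have [z /andP[z1 z2] e] := mvt_between x (x + u) dG.
rewrite /Delta e addrAC subrr add0r normrM ler_wpM2r//; apply: HC.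
move: xr u1 z1 z2; rewrite !ler_norml ge_min le_max => /andP[x1 x2] /andP[u1 u2].
by move=> /orP[] h1 /orP[] h2; apply/andP; split; lra.
Qed.

End small_facts.

Lemma absint_bmeas (R : realType) (m : probability R R) (F : R -> R) (c : R) :
  bmeas F -> absint m F c < +oo.
Proof.
move=> bF; rewrite /absint -(@EFin_Rint _ _ _ m (fun x : R => `|F (x + c)|)%R) ?ltry//.
have [mF [M HM]] := bF; split; last by exists M => x; rewrite normr_id.
by apply: measurableT_comp => //; apply: (measurableT_comp mF); exact: measurable_addr.
Qed.

Lemma bmeas_norm (R : realType) d (T : measurableType d) (F : T -> R) :
  bmeas F -> bmeas (fun x => `|F x|%R).
Proof.
move=> [mF [M HM]]; split; first exact: measurableT_comp.
by exists M => x; rewrite normr_id.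
Qed.

Lemma sqform_bmeas (R : realType) d (T : measurableType d) (m : probability T R) (F : T -> R) :
  bmeas F -> sqform m F < +oo.
Proof. by move=> bF; rewrite /sqform -EFin_Rint ?ltry//; exact: bmeasX. Qed.

Section small_jumps.
Context (R : realType) (m0 m1 : probability R R).
Variables (nu : {sigma_finite_measure set R -> \bar R}) (nu_levy : levy_measure nu).
Variables (G G' : R -> R).
Hypotheses (dG : forall x : R, is_derive x 1%R G (G' x)) (cG' : continuous G').
Context d (T : measurableType d) (P : probability T R) (Z X X' : T -> R).
Hypotheses (mZ : measurable_fun setT Z) (mX : measurable_fun setT X) (mX' : measurable_fun setT X').
Hypothesis law : forall E, measurable E ->
  P ((fun w => (Z w, (X w, X' w))) @^-1` E) = (m0 \x (m1 \x m1)%E) E.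

Let cG : continuous G. Proof. exact: deriv_continuous dG. Qed.
Let mG : measurable_fun setT G. Proof. exact: continuous_measurable_fun. Qed.
Let x w := (X w + Z w)%R.
Let y w := (X' w + Z w)%R.
Let mx : measurable_fun setT x. Proof. exact: measurable_funD. Qed.
Let my : measurable_fun setT y. Proof. exact: measurable_funD. Qed.

Let k0 (u x y : R) : R := (small u * (Delta u G x * Delta u G y))%R.
Let K0 (x y : R) : R := (\int[nu]_u k0 u x y)%R.

(** On bounded sets G is Lipschitz, so the product of two differences is of order u^2. Hence the
    small-jump kernel is finite everywhere; it is its integrability under P that is in doubt. *)
Let k0_bound (r : R) : exists2 C, (0 <= C)%R & forall u x y, (`|x| <= r)%R -> (`|y| <= r)%R ->
  (`|k0 u x y| <= C * lm_weight u)%R.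
Proof.
have [C C0 HC] := Delta_lipschitz r dG cG'.
exists (C ^+ 2)%R => [|u x1 y1 xr yr]; first exact: sqr_ge0.
apply: (@le_trans _ _ (C ^+ 2 * (small u * u ^+ 2))%R); last first.
  by rewrite ler_wpM2l ?sqr_ge0// small_sqr_le.
rewrite /k0 /small; case: ifPn => u1; last by rewrite !mul0r mulr0 normr0.
rewrite !mul1r normrM -(real_normK (num_real u)) -exprMn expr2.
by rewrite ler_pM// HC.
Qed.

Let mk0 d1 (S : measurableType d1) (f g h : S -> R) :
  measurable_fun setT f -> measurable_fun setT g -> measurable_fun setT h ->
  measurable_fun setT (fun p => k0 (f p) (g p) (h p)).
Proof.
move=> mf mg mh; apply: measurable_funM; first exact: (measurableT_comp (@measurable_small R) mf).
by apply: measurable_funM; exact: measurable_Delta2.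
Qed.

Lemma k0_integrable x1 y1 : nu.-integrable setT (fun u => (k0 u x1 y1)%:E).
Proof.
have [C C0 HC] := k0_bound (Num.max `|x1| `|y1|)%R.
apply: (lm_integrable nu_levy (C := C)); first by apply: mk0.
by move=> u; apply: HC; rewrite le_max lexx ?orbT.
Qed.

Lemma measurable_K0 : measurable_fun setT (fun w => K0 (x w) (y w)).
Proof.
apply: (@measurable_Rint _ _ _ _ _ nu (fun p : T * R => k0 p.2 (x p.1) (y p.1))).
by apply: mk0 => //; [exact: (measurableT_comp mx)|exact: (measurableT_comp my)].
Qed.

Section multiplier.
Variables (psi : R -> R) (r : R).
Hypotheses (mpsi : measurable_fun setT psi) (psi1 : forall z, (`|psi z| <= 1)%R)
  (psi0 : forall z, (r < `|z|)%R -> psi z = 0%R).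

Let g u z : R := (psi z * Delta u G z)%R.

Let bg u : bmeas (g u).
Proof.
split; first by apply: measurable_funM => //; exact: measurable_Delta2.
have [C C0 HC] := continuous_bounded_on (r + `|u|)%R cG.
exists (C + C)%R => z; have [zr|zr] := leP `|z|%R r; last by rewrite /g psi0// mul0r normr0 addr_ge0.
rewrite normrM -[leRHS]mul1r ler_pM// (le_trans (ler_normB _ _))// lerD//; apply: HC.
  by rewrite (le_trans (ler_normD _ _))// lerD2r.
by rewrite (le_trans zr)// lerDl.
Qed.

Let F (p : T * R) : R := (psi (x p.1) * psi (y p.1) * k0 p.2 (x p.1) (y p.1))%R.

Let mF : measurable_fun setT F.
Proof.
have mx2 := measurableT_comp mx (@measurable_fst _ _ T R).
have my2 := measurableT_comp my (@measurable_fst _ _ T R).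
apply: measurable_funM; last by apply: mk0 => //.
by apply: measurable_funM; [exact: (measurableT_comp mpsi mx2)|exact: (measurableT_comp mpsi my2)].
Qed.

Let F_bound : exists2 C, (0 <= C)%R & forall p, (`|F p| <= C * lm_weight p.2)%R.
Proof.
have [C C0 HC] := k0_bound r; exists C => // p.
have Cw : (0 <= C * lm_weight p.2)%R by rewrite mulr_ge0// lm_weight_ge0.
rewrite /F; have [xr|xr] := leP `|x p.1|%R r; last by rewrite (psi0 xr) !mul0r normr0.
have [yr|yr] := leP `|y p.1|%R r; last by rewrite (psi0 yr) mulr0 mul0r normr0.
rewrite normrM -[leRHS]mul1r; apply: ler_pM => //; last exact: HC.
by rewrite normrM -[leRHS]mul1r; apply: ler_pM.
Qed.

Let iF : (P \x nu).-integrable setT (EFin \o F).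
Proof.
have [C C0 HC] := F_bound.
apply: (iffRL (integrable21ltyP P nu _)); first exact/measurable_EFinP.
have wi := (integrableP _ _ _ (integrableZl measurableT C (lm_weight_integrable nu_levy))).2.
apply: (le_lt_trans _ wi); apply: ge0_le_integral.
- exact: measurableT.
- by move=> u _; exact: integral_ge0.
- apply: (@measurable_integral _ _ _ _ _ P (fun p : R * T => (`|F (p.2, p.1)|)%:E)).
  apply/measurable_EFinP; apply: measurableT_comp => //.
  by apply: (measurableT_comp mF); exact: measurable_fun_pair.
- apply: measurableT_comp => //; apply: measurable_funeM.
  by apply/measurable_EFinP; exact: measurable_lm_weight.
move=> u _; apply: (@le_trans _ _ (\int[P]_w (C * lm_weight u)%:E)).
  apply: ge0_le_integral.
  - exact: measurableT.
  - by [].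
  - apply/measurable_EFinP; apply: measurableT_comp => //.
    exact: (measurableT_comp mF (measurable_pair2 _)).
  - exact: measurable_cst.
  - by move=> w _; rewrite /= lee_fin (HC (w, u)).
rewrite integral_cst// [X in _ * X](probability_setT P) mule1 -EFinM /= lee_fin.
exact: ler_norm.
Qed.

Let fubini_FE w : \int[nu]_u (F (w, u))%:E = (psi (x w) * psi (y w) * K0 (x w) (y w))%:E.
Proof.
rewrite (eq_integral (fun u => (psi (x w) * psi (y w))%:E * (k0 u (x w) (y w))%:E))//.
have i0 := k0_integrable (x w) (y w).
rewrite integralZl// [RHS]EFinM; congr (_ * _).
by rewrite /K0 /Rintegral fineK//; exact: integrable_fin_num.
Qed.

Lemma multiplier_integrable :
  P.-integrable setT (fun w => (psi (x w) * psi (y w) * K0 (x w) (y w))%:E).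
Proof.
have := integrable_fubini_F iF; apply: eq_integrable => // w _.
exact: fubini_FE.
Qed.

(** Bounded support of psi makes the integrand at most a multiple of the weight, so Fubini applies.
    Then psi x psi y splits over the two copies, each [Delta u G] being multiplied by psi, and the
    result is still a squared norm. *)
Lemma multiplier_form :
  sqform (nu \x m0) (fun p : R * R => small p.1 * Pop m1 (fun z => psi z * Delta p.1 G z) p.2)%R =
  \int[P]_w (psi (x w) * psi (y w) * K0 (x w) (y w))%:E.
Proof.
rewrite (eq_integral (fun w => \int[nu]_u (F (w, u))%:E)); last by move=> w _; rewrite fubini_FE.
rewrite (Fubini iF) /sqform.
have mP : measurable_fun setT (fun p : R * R => Pop m1 (g p.1) p.2).
  apply: (@measurable_Pop_family _ m1 (fun q => g q.1 q.2)).
  apply: measurable_funM; first exact: (measurableT_comp mpsi).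
  exact: measurable_Delta2.
rewrite fubini_tonelli1; last 2 first.
- apply: measurable_sqform; apply: measurable_funM => //.
  exact: (measurableT_comp (@measurable_small R) (@measurable_fst _ _ R R)).
- by move=> p; rewrite lee_fin sqr_ge0.
apply: eq_integral => u _; rewrite /fubini_F /=.
have sf : sqform m0 (Pop m1 (g u)) < +oo by apply: sqform_bmeas; exact: Pop_bmeas.
have := has_intE (has_intZ (small u) (double_has_int (bmeas_measurable (bg u))
  (aeW _ (fun c => absint_bmeas m1 c (bg u)))
  (sqform_bmeas m0 (Pop_bmeas m1 (bmeas_norm (bg u)))) mZ mX mX' law)).
rewrite EFinM fineK ?ge0_fin_numE ?sqform_ge0// => e.
transitivity ((small u)%:E * sqform m0 (Pop m1 (g u))).
  rewrite /sqform -ge0_integralZl//.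
  - by apply: eq_integral => c _; rewrite exprMn small_sqr EFinM.
  - by apply: measurable_sqform; apply: Pop_measurable; exact: bmeas_measurable.
  - by move=> c _; rewrite lee_fin sqr_ge0.
  - by rewrite lee_fin small_ge0.
rewrite -e; apply: eq_integral => w _; rewrite /F /g /k0 -/(x w) -/(y w); congr EFin; ring.
Qed.

End multiplier.

Hypothesis Delta_ae : {ae nu \x m0, forall p : R * R, absint m1 (Delta p.1 G) p.2 < +oo}.

Let hN (n : nat) (z : R) : R := if (`|z| <= n%:R)%R then 1%R else 0%R.

Let hN01 n z : hN n z = 0%R \/ hN n z = 1%R.
Proof. by rewrite /hN; case: ifP; [right|left]. Qed.

Let mhN n : measurable_fun setT (hN n).
Proof. by apply: measurable_fun_ifT => //; apply: measurable_fun_ler => //; exact: measurableT_comp. Qed.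

Let hN_cvg z : hN n z @[n --> \oo] --> (1 : R)%R.
Proof.
apply: cvg_near_cst; exists (Num.truncn `|z|).+1 => // n /= hn.
rewrite /hN ifT//; apply: le_trans (ltW (truncnS_gt _)) _.
by rewrite ler_nat.
Qed.

Let gN n (p : R * R) : R := (small p.1 * Pop m1 (fun z => hN n z * Delta p.1 G z) p.2)%R.
Let gI (p : R * R) : R := (small p.1 * Pop m1 (Delta p.1 G) p.2)%R.

Let measurable_Pop2 (psi : R -> R) : measurable_fun setT psi ->
  measurable_fun setT (fun p : R * R => Pop m1 (fun z => psi z * Delta p.1 G z)%R p.2).
Proof.
move=> mpsi; apply: (@measurable_Pop_family _ m1 (fun q => psi q.2 * Delta q.1 G q.2)%R).
apply: measurable_funM; first exact: (measurableT_comp mpsi).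
exact: measurable_Delta2.
Qed.

Let mgN n : measurable_fun setT (gN n).
Proof.
apply: measurable_funM; first exact: (measurableT_comp (@measurable_small R) (@measurable_fst _ _ R R)).
exact: measurable_Pop2.
Qed.

Let mgI : measurable_fun setT gI.
Proof.
apply: measurable_funM; first exact: (measurableT_comp (@measurable_small R) (@measurable_fst _ _ R R)).
exact: measurable_Pop_Delta.
Qed.

Let gN_cvg : {ae nu \x m0, forall p, gN n p @[n --> \oo] --> gI p}.
Proof.
apply: aeS Delta_ae => p hp; apply: cvgMr.
apply: (@Pop_dominated _ _ _ (measurable_Delta mG p.1) (fun n z => hN n z * Delta p.1 G z)%R) => //.
- by move=> n; apply: measurable_funM => //; exact: measurable_Delta.
- move=> n z; rewrite normrM ler_piMl//.
  by case: (hN01 n z) => ->; rewrite ?normr0 ?normr1.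
- by move=> z; rewrite -[X in _ --> X]mul1r; apply: cvgMl; exact: hN_cvg.
Qed.

Hypothesis K0_integrable : P.-integrable setT (fun w => (K0 (x w) (y w))%:E).

Let dN n : R := (\int[P]_w (`|K0 (x w) (y w)| * (1 - hN n (x w))))%R.

Let dN_int n : P.-integrable setT (fun w => (`|K0 (x w) (y w)| * (1 - hN n (x w)))%:E).
Proof.
apply: (le_integrable measurableT _ _ K0_integrable).
  apply/measurable_EFinP; apply: measurable_funM.
    by apply: measurableT_comp => //; exact: measurable_K0.
  by apply: measurable_funB => //; exact: (measurableT_comp (mhN n) mx).
move=> w _; rewrite /= lee_fin normrM normr_id ler_piMr//.
by case: (hN01 n (x w)) => ->; rewrite ?subr0 ?subrr ?normr0 ?normr1.
Qed.

Let dN_cvg : dN @ \oo --> (0 : R)%R.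
Proof.
have -> : 0%R = (\int[P]_w (cst 0 w))%R :> R by rewrite /Rintegral integral0.
apply: (@Rint_dct _ _ _ P (fun n w => `|K0 (x w) (y w)| * (1 - hN n (x w)))%R (cst 0%R)
  (fun w => `|K0 (x w) (y w)|)%R).
- by move=> n; have /measurable_EFinP := measurable_int _ (dN_int n).
- exact: measurable_cst.
- exact: integrable_norm.
- apply: aeW => w /=; rewrite -(mulr0 `|K0 (x w) (y w)|%R) -(subrr 1%R).
  by apply: cvgMr; apply: cvgB; [exact: cvg_cst|exact: hN_cvg].
- move=> n w; rewrite normrM normr_id ler_piMr//.
  by case: (hN01 n (x w)) => ->; rewrite ?subr0 ?subrr ?normr0 ?normr1.
Qed.

Let dN_ge0 n : (0 <= dN n)%R.
Proof.
apply: Rintegral_ge0 => w _; rewrite mulr_ge0//.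
by case: (hN01 n (x w)) => ->; rewrite ?subr0 ?subrr.
Qed.

(** The multiplier psi = hN i - hN j turns the squared distance into E psi x psi y K0. One factor
    psi is bounded by 1, the other by (1 - hN i) + (1 - hN j), and integrability of K0 makes the
    resulting bounds tend to 0. *)
Let gN_cauchy i j : sqform (nu \x m0) (fun p => gN i p - gN j p)%R <= (dN i + dN j)%:E.
Proof.
pose psi z := (hN i z - hN j z)%R.
have psi_le z : (`|psi z| <= (1 - hN i z) + (1 - hN j z))%R.
  rewrite /psi; case: (hN01 i z) => ->; case: (hN01 j z) => ->;
    rewrite ?subrr ?subr0 ?sub0r ?normrN ?normr0 ?normr1; lra.
have psi1 z : (`|psi z| <= 1)%R.
  by rewrite /psi; case: (hN01 i z) => ->; case: (hN01 j z) => ->;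
    rewrite ?subrr ?subr0 ?sub0r ?normrN ?normr0 ?normr1.
have mpsi : measurable_fun setT psi by exact: measurable_funB.
pose r : R := Num.max i%:R j%:R.
have psi0 z : (r < `|z|)%R -> psi z = 0%R.
  by rewrite /r gt_max /psi /hN => /andP[ri rj]; rewrite !leNgt ri rj/= subrr.
have -> : sqform (nu \x m0) (fun p => gN i p - gN j p)%R =
    sqform (nu \x m0) (fun p : R * R => small p.1 * Pop m1 (fun z => psi z * Delta p.1 G z) p.2)%R.
  apply: ae_eq_integral => //.
  - by apply: measurable_sqform; exact: measurable_funB.
  - apply: measurable_sqform; apply: measurable_funM; last exact: measurable_Pop2.
    exact: (measurableT_comp (@measurable_small R)).
  apply: aeS Delta_ae => p hp _; congr (_ ^+ 2)%:E; rewrite /gN -mulrBr; congr (_ * _)%R.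
  have iN n : m1.-integrable setT (EFin \o (fun z : R => hN n (z + p.2) * Delta p.1 G (z + p.2)))%R.
    apply: (le_integrable measurableT _ _ (absint_integrable (measurable_Delta mG p.1) hp)).
      apply/measurable_EFinP; apply: measurable_funM.
        by apply: (measurableT_comp (mhN n)); exact: measurable_addr.
      by apply: (measurableT_comp (measurable_Delta mG p.1)); exact: measurable_addr.
    move=> z _; rewrite /= lee_fin normrM ler_piMl//.
    by case: (hN01 n (z + p.2)%R) => ->; rewrite ?normr0 ?normr1.
  rewrite /Pop -RintegralB//.
  by apply: eq_Rintegral => z _; rewrite /psi mulrBl.
rewrite (multiplier_form mpsi psi1 psi0).
have iA := multiplier_integrable mpsi psi1 psi0.
rewrite EFinD /dN /Rintegral !fineK ?(integrable_fin_num measurableT)//.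
rewrite -integralD//; apply: le_integral => //; first exact: integrableD.
move=> w _; rewrite -EFinD lee_fin -mulrDr; apply: le_trans (ler_norm _) _.
rewrite normrM mulrC ler_wpM2l// normrM.
apply: (@le_trans _ _ (`|psi (x w)|%R)); first by rewrite ler_piMr.
exact: psi_le.
Qed.

(* Truncating by hN keeps the kernel a squared norm (multiplier_form), and the
   distance of two truncations is a truncation itself. *)
Lemma small_jump_form : \int[P]_w (K0 (x w) (y w))%:E = sqform (nu \x m0) gI.
Proof.
have near_i := sqform_fatou mgN mgI gN_cvg dN_cvg gN_cauchy.
have A_E n : sqform (nu \x m0) (gN n) = \int[P]_w (hN n (x w) * hN n (y w) * K0 (x w) (y w))%:E.
  apply: (@multiplier_form (hN n) n%:R) => // z.
  - by case: (hN01 n z) => ->; rewrite ?normr0 ?normr1.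
  - by rewrite /hN ltNge => /negbTE ->.
pose e : R := (\int[P]_w K0 (x w) (y w))%R.
have iA n : P.-integrable setT (fun w => (hN n (x w) * hN n (y w) * K0 (x w) (y w))%:E).
  apply: (@multiplier_integrable (hN n) n%:R) => // z.
  - by case: (hN01 n z) => ->; rewrite ?normr0 ?normr1.
  - by rewrite /hN ltNge => /negbTE ->.
have A_fin n : sqform (nu \x m0) (gN n) \is a fin_num.
  by rewrite A_E; exact: (integrable_fin_num measurableT (iA n)).
have eE : \int[P]_w (K0 (x w) (y w))%:E = e%:E.
  by rewrite /e /Rintegral fineK//; exact: (integrable_fin_num measurableT K0_integrable).
have A_cvg : sqform (nu \x m0) (gN n) @[n --> \oo] --> e%:E.
  under eq_fun do rewrite A_E.
  rewrite -eE.
  have := @dominated_convergence _ _ _ P setT measurableT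
    (fun n w => (hN n (x w) * hN n (y w) * K0 (x w) (y w))%:E) (fun w => (K0 (x w) (y w))%:E)
    (fun w => `|(K0 (x w) (y w))%:E|).
  case=> //.
  - by move=> n; exact: (measurable_int _ (iA n)).
  - exact: (measurable_int _ K0_integrable).
  - apply: aeW => w _; apply: cvg_EFin; first exact: nearW.
    rewrite -[X in _ --> X]mul1r; apply: cvgMl; rewrite -[X in _ --> X]mulr1.
    by apply: cvgM; exact: hN_cvg.
  - exact: integrable_abse.
  - apply: aeW => w n _; rewrite lee_fin normrM ler_piMl// normrM.
    by case: (hN01 n (x w)) => ->; case: (hN01 n (y w)) => ->;
      rewrite ?normr0 ?normr1 ?mulr0 ?mul0r ?mulr1.
have e0 : (0 <= e)%R.
  rewrite -lee_fin -(cvg_lim _ A_cvg)//; apply: lime_ge; first by apply/cvg_ex; exists e%:E.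
  by apply: nearW => n; exact: sqform_ge0.
(* One error serves both comparisons of the n-th truncated form: with the squared norm of [gI] and
   with the expectation e. *)
pose ee n := (dN n + `|e - fine (sqform (nu \x m0) (gN n))|)%R.
have ee_cvg : ee @ \oo --> (0 : R)%R.
  rewrite -[X in _ --> X]addr0; apply: cvgD; first exact: dN_cvg.
  rewrite -[X in _ --> X](normr0 R) -(subrr e); apply: cvg_norm; apply: cvgB; first exact: cvg_cst.
  by have /fine_cvgP[] := A_cvg.
have n1 j : near_sq (ee j) (sqform (nu \x m0) gI) (sqform (nu \x m0) (gN j)).
  have le_ee : (dN j <= ee j)%R by rewrite lerDl.
  exact: (@near_sq_le _ _ _ _ _ le_ee (@near_sq_sym _ _ _ _ (@sqform_near _ _ _ _ _ _ _ (mgN j) mgI (near_i j)))).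
have n2 j : near_sq (ee j) e%:E (sqform (nu \x m0) (gN j)).
  have le_ee : (`|e - fine (sqform (nu \x m0) (gN j))| <= ee j)%R by rewrite lerDr.
  rewrite -[in X in near_sq _ _ X](fineK (A_fin j)).
  exact: (@near_sq_le _ _ _ _ _ le_ee (@near_sq_dist _ _ _ e0 (fine_ge0 (sqform_ge0 _ _)))).
(* [near_sq_lim] is applied to a constant sequence: two quantities near the same approximations
   coincide. *)
have [_ Bc] := @near_sq_lim _ (fun=> sqform (nu \x m0) gI) e%:E
  (fun j _ => sqform (nu \x m0) (gN j)) (fun j => sqform (nu \x m0) (gN j)) ee
  (fun=> sqform_ge0 _ _) e0 (fun j => sqform_ge0 _ _)
  (fun j => addr_ge0 (dN_ge0 j) (normr_ge0 _)) ee_cvg (fun j _ => n1 j) n2 A_fin (fun j => cvg_cst _).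
by rewrite eE -(cvg_lim _ Bc)// lim_cst.
Qed.

End small_jumps.

Section jumps.
Context (R : realType) (m0 m1 : probability R R).
Variables (nu : {sigma_finite_measure set R -> \bar R}) (nu_levy : levy_measure nu).
Variables (G G' : R -> R).
Hypotheses (dG : forall x : R, is_derive x 1%R G (G' x)) (cG' : continuous G').
Hypothesis G_ae : {ae nu \x m0, forall p : R * R,
  absint m1 G (p.2 + p.1) < +oo /\ absint m1 G p.2 < +oo}.
Hypothesis G_shift_L2 : sqform (nu \x m0) (fun p : R * R =>
  Num.sqrt (lm_weight p.1) * Pop m1 (fun x => `|G x|) (p.2 + p.1))%R < +oo.
Hypothesis G_L2 : sqform m0 (Pop m1 (fun x => `|G x|%R)) < +oo.
Context d (T : measurableType d) (P : probability T R) (Z X X' : T -> R).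
Hypotheses (mZ : measurable_fun setT Z) (mX : measurable_fun setT X) (mX' : measurable_fun setT X').
Hypothesis law : forall E, measurable E ->
  P ((fun w => (Z w, (X w, X' w))) @^-1` E) = (m0 \x (m1 \x m1)%E) E.

Let cG : continuous G. Proof. exact: deriv_continuous dG. Qed.
Let mG : measurable_fun setT G. Proof. exact: continuous_measurable_fun. Qed.
Let x w := (X w + Z w)%R.
Let y w := (X' w + Z w)%R.
Let mx : measurable_fun setT x. Proof. exact: measurable_funD. Qed.
Let my : measurable_fun setT y. Proof. exact: measurable_funD. Qed.
Let jform u := sqform m0 (Pop m1 (Delta u G)).

Let jform_le u : {ae m0, forall c, absint m1 (Delta u G) c < +oo} ->
  jform u <= sqform m0 (Pop m1 (fun z => `|Delta u G z|%R)).
Proof.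
move=> hu; have mD := measurable_Delta mG u.
have mDa : measurable_fun setT (fun z => `|Delta u G z|%R) by exact: measurableT_comp.
apply: sqform_le; [exact: Pop_measurable|exact: Pop_measurable|].
by apply: aeS hu => c hc; rewrite [leRHS]ger0_norm ?Pop_abs_ge0//; exact: Pop_abs_le.
Qed.

Lemma jump_expectation : {ae nu, forall u : R,
  \int[P]_w (Delta u G (x w) * Delta u G (y w))%:E = jform u /\
  \int[P]_w (`|Delta u G (x w) * Delta u G (y w)|)%:E =
    sqform m0 (Pop m1 (fun z => `|Delta u G z|%R))}.
Proof.
apply: aeS2 (absint_Delta_ae mG G_ae) (abs_Delta_L2_ae nu_levy mG G_ae G_shift_L2 G_L2) => u hu hu2.
have mD := measurable_Delta mG u.
have mDa : measurable_fun setT (fun z => `|Delta u G z|%R) by exact: measurableT_comp.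
split.
  have jf := sqform_fin (le_lt_trans (jform_le hu) hu2).
  by rewrite (has_intE (double_has_int mD hu hu2 mZ mX mX' law)) (fineK jf).
have hu' : {ae m0, forall c, absint m1 (fun z => `|Delta u G z|%R) c < +oo}.
  apply: aeS hu => c; congr (_ < _).
  by apply: eq_integral => z _; rewrite normr_id.
have hu2' : sqform m0 (Pop m1 (fun z => `|(`|Delta u G z|)|%R)) < +oo.
  rewrite (_ : (fun z => _) = (fun z => `|Delta u G z|%R))//.
  by apply/funext => z; rewrite normr_id.
have := has_intE (double_has_int mDa hu' hu2' mZ mX mX' law).
rewrite (fineK (sqform_fin hu2)) => <-.
by apply: eq_integral => w _; rewrite normrM.
Qed.

Lemma jump_integral :
  \int[nu]_u \int[P]_w (Delta u G (x w) * Delta u G (y w))%:E = \int[nu]_u jform u.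
Proof.
apply: ae_eq_integral => //.
- apply: (@measurable_integral _ _ _ _ _ P (fun p : R * T =>
    (Delta p.1 G (x p.2) * Delta p.1 G (y p.2))%:E)).
  apply/measurable_EFinP; apply: measurable_funM; apply: measurable_Delta2 => //.
    exact: (measurableT_comp mx).
  exact: (measurableT_comp my).
- apply: (@measurable_integral _ _ _ _ _ m0 (fun p : R * R => ((Pop m1 (Delta p.1 G) p.2) ^+ 2)%:E)).
  by apply: measurable_sqform; exact: measurable_Pop_Delta.
- by apply: aeS jump_expectation => u [].
Qed.

Let F (p : T * R) : R := ((1 - small p.2) * (Delta p.2 G (x p.1) * Delta p.2 G (y p.1)))%R.

Let mF : measurable_fun setT F.
Proof.
apply: measurable_funM.
  by apply: measurable_funB => //; exact: (measurableT_comp (@measurable_small R) measurable_snd).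
apply: measurable_funM; apply: measurable_Delta2 => //; first exact: (measurableT_comp mx).
exact: (measurableT_comp my).
Qed.

(** For large jumps 1 - small u is at most the weight, so [abs_Delta_L2] bounds the absolute double
    integral. *)
Let iF : (P \x nu).-integrable setT (EFin \o F).
Proof.
apply: (iffRL (integrable21ltyP P nu _)); first exact/measurable_EFinP.
have hw := abs_Delta_L2 nu_levy mG G_ae G_shift_L2 G_L2.
have mPD := measurable_Pop_abs_Delta m1 mG.
have mPD2 : measurable_fun setT (fun p : R * R => (lm_weight p.1)%:E *
    ((Pop m1 (fun z => `|Delta p.1 G z|)%R p.2) ^+ 2)%:E).
  apply: emeasurable_funM; last exact: measurable_sqform.
  by apply/measurable_EFinP; exact: (measurableT_comp (@measurable_lm_weight R)).
apply: (le_lt_trans _ hw); rewrite /sqform.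
rewrite (eq_integral (fun p : R * R => (lm_weight p.1)%:E *
    ((Pop m1 (fun x => `|Delta p.1 G x|) p.2) ^+ 2)%:E)); last first.
  by move=> p _; rewrite exprMn sqr_sqrtr ?lm_weight_ge0// EFinM.
rewrite fubini_tonelli1//; last first.
  by move=> p; rewrite -EFinM lee_fin mulr_ge0 ?lm_weight_ge0// sqr_ge0.
apply: ae_ge0_le_integral.
- exact: measurableT.
- by move=> u _; exact: integral_ge0.
- apply: (@measurable_integral _ _ _ _ _ P (fun p : R * T => (`|F (p.2, p.1)|)%:E)).
  apply/measurable_EFinP; apply: measurableT_comp => //.
  by apply: (measurableT_comp mF); exact: measurable_fun_pair.
- move=> u _; apply: integral_ge0 => c _.
  by rewrite -EFinM lee_fin mulr_ge0 ?lm_weight_ge0// sqr_ge0.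
- exact: (measurable_integral m0 mPD2).
apply: aeS jump_expectation => u [_ hu] _; rewrite /fubini_F /=.
rewrite ge0_integralZl//; last 3 first.
- by apply: measurable_sqform; exact: (measurableT_comp mPD (measurable_pair1 _)).
- by move=> c _; rewrite lee_fin sqr_ge0.
- by rewrite lee_fin lm_weight_ge0.
rewrite -/(sqform _ _) -hu -ge0_integralZl//; last 2 first.
- apply/measurable_EFinP; apply: measurableT_comp => //.
  by apply: measurable_funM; apply: measurable_Delta2.
- by rewrite lee_fin lm_weight_ge0.
apply: ge0_le_integral.
- exact: measurableT.
- by [].
- apply/measurable_EFinP; apply: measurableT_comp => //.
  exact: (measurableT_comp mF (measurable_pair2 _)).
- apply: measurable_funeM; apply/measurable_EFinP; apply: measurableT_comp => //.
  by apply: measurable_funM; apply: measurable_Delta2.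
move=> w _; rewrite -EFinM lee_fin /F /= normrM ler_wpM2r// ger0_norm ?large_le//.
by case: (small01 u) => ->; rewrite ?subr0 ?subrr.
Qed.

Let K0 w : R := (\int[nu]_u (small u * (Delta u G (x w) * Delta u G (y w))))%R.
Let K1 w : \bar R := \int[nu]_u (F (w, u))%:E.

Let K1_int : P.-integrable setT K1.
Proof. exact: integrable_fubini_F iF. Qed.

Let jump_split : {ae P, forall w,
  \int[nu]_u (Delta u G (x w) * Delta u G (y w))%:E = (K0 w)%:E + K1 w /\ K1 w \is a fin_num}.
Proof.
apply: aeS (ae_integrable1 iF) => w iw.
have i0 := k0_integrable nu_levy dG cG' (x w) (y w).
split; last exact: integrable_fin_num.
have -> : (K0 w)%:E = \int[nu]_u (small u * (Delta u G (x w) * Delta u G (y w)))%:E.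
  by rewrite /K0 /Rintegral fineK//; exact: integrable_fin_num.
rewrite /K1 -integralD//; apply: eq_integral => u _.
by rewrite -EFinD /F /=; congr EFin; ring.
Qed.

Let K1_E : \int[P]_w K1 w = \int[nu]_u ((1 - small u)%:E * jform u).
Proof.
rewrite (Fubini iF); apply: ae_eq_integral => //.
- apply: (@measurable_integral _ _ _ _ _ P (fun p : R * T => (F (p.2, p.1))%:E)).
  by apply/measurable_EFinP; apply: (measurableT_comp mF); exact: measurable_fun_pair.
- apply: emeasurable_funM.
    by apply/measurable_EFinP; apply: measurable_funB => //; exact: measurable_small.
  apply: (@measurable_integral _ _ _ _ _ m0 (fun p : R * R => ((Pop m1 (Delta p.1 G) p.2) ^+ 2)%:E)).
  by apply: measurable_sqform; exact: measurable_Pop_Delta.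
apply: aeS2 jump_expectation (abs_Delta_L2_ae nu_levy mG G_ae G_shift_L2 G_L2) => u [hu hu1] hu2 _.
rewrite -hu -integralZl//.
- apply/integrableP; split.
    by apply/measurable_EFinP; apply: measurable_funM; apply: measurable_Delta2.
  by rewrite /= hu1.
Qed.

(** J splits into the Gaussian term, the large-jump integral and the small-jump kernel. Each has its
    own evaluation, and the two jump forms recombine because small u takes the values 0 and 1. *)
Lemma jump_total (S0 : T -> R) (v : R) : has_int P S0 v ->
  P.-integrable setT (fun w => (S0 w)%:E + \int[nu]_u (Delta u G (x w) * Delta u G (y w))%:E) ->
  \int[P]_w ((S0 w)%:E + \int[nu]_u (Delta u G (x w) * Delta u G (y w))%:E) =
  v%:E + \int[nu]_u jform u.
Proof.
set J := (fun w => _) => hS iJ; have [iS _] := hS.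
have mK0 : measurable_fun setT K0 by exact: (measurable_K0 nu dG mZ mX mX').
(* Subtracting two integrable pieces transfers the integrability of J to the small-jump kernel, as
   [small_jump_form] demands. *)
have iD : P.-integrable setT (fun w => J w - ((S0 w)%:E + K1 w)).
  by apply: integrableB => //; exact: integrableD.
have KD : {ae P, forall w, setT w -> (K0 w)%:E = J w - ((S0 w)%:E + K1 w)}.
  apply: aeS jump_split => w [hw fw] _; rewrite /J hw -(fineK fw).
  by rewrite -!EFinD; congr EFin; ring.
have iK0 : P.-integrable setT (EFin \o K0).
  apply/integrableP; split; first exact/measurable_EFinP.
  have /integrableP[mD iDl] := iD.
  rewrite (ge0_ae_eq_integral (g := fun w => `|J w - ((S0 w)%:E + K1 w)|))//.
  - by apply/measurable_EFinP; exact: measurableT_comp.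
  - exact: measurableT_comp.
  - by apply: aeS KD => w hw _; rewrite -hw.
rewrite (ae_eq_integral (fun w => (S0 w)%:E + ((K0 w)%:E + K1 w)))//.
- have iSK := integrableD measurableT iK0 K1_int.
  rewrite integralD// (has_intE hS) integralD// K1_E; congr (_ + _).
  rewrite (small_jump_form nu_levy dG cG' mZ mX mX' law _ iK0); last first.
    by apply: aeS (absint_Delta_prod_ae mG G_ae) => p [].
  have mj : measurable_fun setT jform.
    apply: (@measurable_integral _ _ _ _ _ m0 (fun p : R * R => ((Pop m1 (Delta p.1 G) p.2) ^+ 2)%:E)).
    by apply: measurable_sqform; exact: measurable_Pop_Delta.
  have -> : sqform (nu \x m0) (fun p : R * R => small p.1 * Pop m1 (Delta p.1 G) p.2)%R =
      \int[nu]_u ((small u)%:E * jform u).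
    rewrite /sqform fubini_tonelli1; last 2 first.
    - apply: measurable_sqform; apply: measurable_funM; last exact: measurable_Pop_Delta.
      exact: (measurableT_comp (@measurable_small R) (@measurable_fst _ _ R R)).
    - by move=> p; rewrite lee_fin sqr_ge0.
    apply: eq_integral => u _; rewrite /fubini_F /= /jform /sqform -ge0_integralZl//.
    - by apply: eq_integral => c _; rewrite exprMn small_sqr EFinM.
    - apply: measurable_sqform; apply: Pop_measurable; exact: measurable_Delta.
    - by move=> c _; rewrite lee_fin sqr_ge0.
    - by rewrite lee_fin small_ge0.
  have l0 u : (0 <= 1 - small u :> R)%R by case: (small01 u) => ->; rewrite ?subr0 ?subrr.
  rewrite -ge0_integralD//.
  + by apply: eq_integral => u _; case: (small01 u) => ->;
      rewrite ?subr0 ?subrr ?mul0e ?mul1e ?add0e ?adde0.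
  + by move=> u _; rewrite mule_ge0 ?lee_fin ?small_ge0// sqform_ge0.
  + by apply: emeasurable_funM => //; apply/measurable_EFinP; exact: measurable_small.
  + by move=> u _; rewrite mule_ge0 ?lee_fin ?sqform_ge0//.
  + apply: emeasurable_funM => //; apply/measurable_EFinP.
    by apply: measurable_funB => //; exact: measurable_small.
- exact: measurable_int iJ.
- apply: measurable_int (integrableD measurableT iS (integrableD measurableT iK0 K1_int)).
- by apply: aeS jump_split => w [hw _] _; rewrite /J hw.
Qed.

End jumps.

(** * The grids n = 2^m + 1 and the conclusion *)

Section influence_limit.
Context (R : realType) d (T : measurableType d) (P : probability T R).
Variables (Y Y' Y'' : R -> {RV P >-> R}) (b sigma : R).
Variable nu : {sigma_finite_measure set R -> \bar R}.
Variables (G : R -> R) (a : R).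
Hypotheses (Y_levy : levy_process Y) (Y_char : has_characteristics Y b sigma nu)
  (Y'_copy : process_copy Y Y') (Y''_copy : process_copy Y Y'')
  (Y_indep : independent_processes3 Y Y' Y'').
Let mu (t : R) : probability R R := distribution P (Y t).
Hypotheses (dG : forall x : R, is_derive x 1%R G (derive1 G x)) (cG' : continuous (derive1 G)).
Hypotheses (G2 : sqform (mu 1%R) G < +oo) (G'2 : sqform (mu 1%R) (derive1 G) < +oo).
Hypotheses (a0 : (0 < a)%R) (a1 : (a < 1)%R).

Let mu_conv : conv_semigroup mu := levy_conv_semigroup Y_levy.
Let sigma0 : (0 <= sigma)%R. Proof. by have [] := Y_char. Qed.
Let nu_levy : levy_measure nu. Proof. by have [] := Y_char. Qed.

Let chf1 : chf mu (levy_exponent_re sigma nu) (levy_exponent_im b nu) 1.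
Proof.
have [_ _ h] := Y_char; move=> s; have := h s.
rewrite unlock => -[hc hs].
rewrite /chcos /chsin !Rint_distribution.
- by rewrite !mul1r /Rintegral hc hs.
- by apply: (measurableT_comp (@measurable_sin R)).
- by apply: (measurableT_comp (@measurable_cos R)).
Qed.

Let mu_cos t s th : (0 <= t)%R -> (\int[mu t]_x cos (s * x + th) =
  expR (t * levy_exponent_re sigma nu s) * cos (t * levy_exponent_im b nu s + th))%R.
Proof.
move=> t0; apply: (Rint_cos_mu mu_conv) => //.
- exact: (@continuous_re _ _ nu_levy sigma).
- exact: (@continuous_im _ _ nu_levy b).
- exact: levy_exponent_re0.
- exact: levy_exponent_im0.
- by move=> t1 u s1; exact: (levy_right_cont Y_levy).
Qed.

(** The grid has 2^m + 1 steps while the normalisation is 2^m, so c h is 1 - h, which tends to 1. *)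
Let k (m : nat) : nat := Num.truncn (a * 2 ^+ m)%R.
Let h (m : nat) : R := ((2 ^ m).+1)%:R^-1%R.
Let c (m : nat) : R := (2 ^+ m)%R.

Let c_gt0 m : (0 < c m)%R. Proof. by rewrite exprn_gt0. Qed.
Let h_ge0 m : (0 <= h m)%R. Proof. by rewrite invr_ge0. Qed.
Let ac0 m : (0 <= a * c m)%R. Proof. by rewrite mulr_ge0 ?ltW. Qed.

Let k_lt m : (k m < 2 ^ m)%N.
Proof.
rewrite -(ltr_nat R) natrX; apply: (@le_lt_trans _ _ (a * c m)%R).
  by rewrite truncn_le.
by rewrite gtr_pMl.
Qed.

Let kh1 m : ((k m).+1%:R * h m <= 1)%R.
Proof. by rewrite ler_pdivrMr ?ltr0n// mul1r ler_nat ltnS ltnW. Qed.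

Let ack m : (a * c m <= (k m).+1%:R)%R.
Proof. by rewrite ltW// truncnS_gt. Qed.

Let cvg_pow : (2 ^- m)%R @[m --> \oo] --> (0 : R)%R.
Proof.
rewrite (_ : (fun m => _) = (fun m => (2^-1 : R) ^+ m)%R); last by apply/funext => m; rewrite exprVn.
by apply: cvg_expr; rewrite ger0_norm ?invr_ge0// invf_lt1// ltr1n.
Qed.

Let h_cvg : h @ \oo --> (0 : R)%R.
Proof.
apply: (@squeeze_cvgr _ _ _ _ (fun=> 0%R) (fun m => (2 ^- m)%R)); last exact: cvg_pow.
  apply: nearW => m; rewrite h_ge0/= lef_pV2 ?posrE ?exprn_gt0 ?ltr0n//.
  by rewrite -natrX ler_nat.
exact: cvg_cst.
Qed.

Let ch_cvg : (c m * h m)%R @[m --> \oo] --> (1 : R)%R.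
Proof.
rewrite (_ : (fun m => _) = (fun m => 1 - h m)%R).
  by rewrite -[X in _ --> X]subr0; apply: cvgB => //; exact: cvg_cst.
apply/funext => m; rewrite /c /h -(natr1 (2 ^ m)) natrX; field.
by rewrite gt_eqF// addr_gt0// exprn_gt0.
Qed.

Let s_cvg : ((k m)%:R * h m)%R @[m --> \oo] --> a.
Proof.
apply: (@squeeze_cvgr _ _ _ _ (fun m => a * (c m * h m) - h m)%R (fun m => a * (c m * h m))%R).
- apply: nearW => m; rewrite mulrA -[X in (_ - X)%R]mul1r -mulrBl.
  rewrite !ler_wpM2r//=; first by rewrite truncn_le.
  by rewrite lerBlDr natr1.
- by rewrite -[X in _ --> X]subr0 -[X in _ --> (X - _)%R]mulr1; apply: cvgB => //; exact: cvgMr.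
- by rewrite -[X in _ --> X]mulr1; exact: cvgMr.
Qed.

Let cG : continuous G. Proof. exact: deriv_continuous dG. Qed.
Let mG : measurable_fun setT G. Proof. exact: continuous_measurable_fun. Qed.
Let mG' : measurable_fun setT (derive1 G). Proof. exact: continuous_measurable_fun. Qed.

Let x (w : T) : R := (Y a w + Y'' (1 - a)%R w)%R.
Let y (w : T) : R := (Y' a w + Y'' (1 - a)%R w)%R.

Let a0' : (0 <= a)%R := ltW a0.
Let a1' : (a <= 1)%R := ltW a1.
Let law E (mE : measurable E) := fixed_time_triple_law Y'_copy Y''_copy Y_indep
  (ltac:(by rewrite subr_ge0) : (0 <= 1 - a)%R) a0' mE.

Let G_ae := absint_shift_ae mu_conv nu_levy sigma0 mu_cos a0 a1 h_ge0 c_gt0 kh1 ack s_cvg h_cvg ch_cvg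
  dG cG' G2.
Let G_shift := shift_L2 mu_conv nu_levy sigma0 mu_cos a0 a1 h_ge0 c_gt0 kh1 ack s_cvg h_cvg ch_cvg
  dG cG' G2.
Let G_L2 : sqform (mu (1 - a)%R) (Pop (mu a) (fun x => `|G x|%R)) < +oo.
Proof. exact: le_lt_trans (phi_abs_L2 mu_conv mG a0' a1' G2) G2. Qed.

Let S0_int : has_int P (fun w => sigma * derive1 G (x w) * derive1 G (y w))%R
  (sigma * fine (phi mu a (derive1 G)))%R.
Proof.
have := has_intZ sigma (double_has_int mG' (absint_ae mu_conv mG' a0' a1' (abs_int_lty mG' G'2))
  (le_lt_trans (phi_abs_L2 mu_conv mG' a0' a1' G'2) G'2)
  (measurable_funPT (Y'' (1 - a)%R)) (measurable_funPT (Y a)) (measurable_funPT (Y' a)) law).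
by under eq_fun do rewrite mulrA.
Qed.

Let S0_E : (sigma * fine (phi mu a (derive1 G)))%:E = Lgauss mu sigma a (derive1 G).
Proof.
rewrite EFinM fineK// ge0_fin_numE ?phi_ge0//.
exact: le_lt_trans (phi_le_L2 mu_conv mG' a0' a1' G'2) G'2.
Qed.

Lemma influence_limit_sigma_finite :
  let S (n : nat) (x : 'I_n -> R) : R := G (\sum_(l < n) x l)%R in
  let n (m : nat) : nat := (2 ^ m).+1 in
  let B (m : nat) (k : nat) : \bar R :=
    Bseq P (@S (n m)) (increments Y (n m)) (increments Y' (n m)) k in
  let u_ (m : nat) : \bar R :=
    (2 ^+ m)%R%:E * B m (Num.truncn (a * 2 ^+ m)%R).+1 in
  let J (w : T) : \bar R :=
    (sigma * derive1 G (x w) * derive1 G (y w))%R%:E +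
    \int[nu]_u (Delta u G (x w) * Delta u G (y w))%R%:E in
  let L : \bar R :=
    'E_P[fun w => (sigma * derive1 G (x w) * derive1 G (y w))%R] +
    \int[nu]_u 'E_P[fun w => (Delta u G (x w) * Delta u G (y w))%R] in
  [/\ P.-integrable setT J -> u_ m @[m --> \oo] --> \int[P]_w J w,
      L \is a fin_num
    & u_ m @[m --> \oo] --> L].
Proof.
move=> S n B u_ J L.
have [Lfin Lcvg] := Qform_L2_cvg mu_conv nu_levy sigma0 mu_cos a0 a1 h_ge0 c_gt0 kh1 ack s_cvg h_cvg ch_cvg
  dG cG' G2 G'2.
have LE : L = Lform mu nu sigma a G (derive1 G).
  rewrite /L unlock /Lform -S0_E (has_intE S0_int); congr (_ + _).
  exact: (jump_integral nu_levy dG G_ae G_shift G_L2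
    (measurable_funPT (Y'' (1 - a)%R)) (measurable_funPT (Y a)) (measurable_funPT (Y' a)) law).
have uE m : u_ m = Qform mu k h c m G.
  rewrite /u_ /Qform; congr (_ * _).
  exact: (Bseq_Vform Y_levy Y'_copy Y_indep mG G2 (ltn0Sn _) (leqW (k_lt m))).
have ucvg : u_ m @[m --> \oo] --> L by under eq_fun do rewrite uE; rewrite LE.
split=> // [iJ|]; last by rewrite LE.
(* When J is integrable its expectation equals L, so this claim reduces to the convergence to L. *)
rewrite (_ : \int[P]_w J w = L)// LE /Lform -S0_E.
exact: (jump_total nu_levy dG cG' G_ae G_shift G_L2
    (measurable_funPT (Y'' (1 - a)%R)) (measurable_funPT (Y a)) (measurable_funPT (Y' a)) law S0_int iJ).
Qed.

End influence_limit.
Section sigma_finite_alias.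
Context (R : realType) (nu : {measure set R -> \bar R}) (nu_levy : levy_measure nu).

(** A copy of nu, convertible to it and indexed by the proof that it is a Levy measure; the index
    lets the sigma-finite structure be attached without any assumption added to the theorem. *)
Definition levy_alias of levy_measure nu : set R -> \bar R := nu.

HB.instance Definition _ := Measure.copy (levy_alias nu_levy) nu.
HB.instance Definition _ :=
  Measure_isSigmaFinite.Build _ _ _ (levy_alias nu_levy) (levy_sigma_finite nu_levy).

End sigma_finite_alias.

Theorem theorem3p5 (R : realType)
    (d0 : measure_display) (T0 : measurableType d0) (P0 : probability T0 R)
    (Y1 : {RV P0 >-> R})
    (d : measure_display) (T : measurableType d) (P : probability T R)
    (Y Y' Y'' : R -> {RV P >-> R})
    (b sigma : R) (nu : {measure set R -> \bar R})
    (G : R -> R) (alpha : R)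
    (Y1_infdiv : infinitely_divisible P0 Y1)
    (Y_levy : levy_process Y)
    (Y_law : same_law P P0 (Y 1%R) Y1)
    (Y_char : has_characteristics Y b sigma nu)
    (Y'_copy : process_copy Y Y')
    (Y''_copy : process_copy Y Y'')
    (Y_indep : independent_processes3 Y Y' Y'')
    (G_smooth : smooth G)
    (G_L2 : forall k : nat, 'E_P0[fun w => ((derive1n k G (Y1 w)) ^+ 2)%R] < +oo)
    (alpha_gt0 : (0 < alpha)%R) (alpha_lt1 : (alpha < 1)%R) :
  let S (n : nat) (x : 'I_n -> R) : R := G (\sum_(l < n) x l)%R in
  let n (m : nat) : nat := (2 ^ m).+1 in
  let B (m : nat) (k : nat) : \bar R :=
    Bseq P (@S (n m)) (increments Y (n m)) (increments Y' (n m)) k in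
  let u_ (m : nat) : \bar R :=
    (2 ^+ m)%R%:E * B m (Num.truncn (alpha * 2 ^+ m)%R).+1 in
  let x (w : T) : R := (Y alpha w + Y'' (1 - alpha)%R w)%R in
  let y (w : T) : R := (Y' alpha w + Y'' (1 - alpha)%R w)%R in
  let J (w : T) : \bar R :=
    (sigma * derive1 G (x w) * derive1 G (y w))%R%:E +
    \int[nu]_u (Delta u G (x w) * Delta u G (y w))%R%:E in
  (* J need not be integrable under the hypotheses on G; L is the expectation
     of J with E moved inside the integral in u, which is always finite. *)
  let L : \bar R :=
    'E_P[fun w => (sigma * derive1 G (x w) * derive1 G (y w))%R] +
    \int[nu]_u 'E_P[fun w => (Delta u G (x w) * Delta u G (y w))%R] in
  [/\ P.-integrable setT J -> u_ m @[m --> \oo] --> \int[P]_w J w,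
      L \is a fin_num
    & u_ m @[m --> \oo] --> L].
Proof.
have [_ nu_levy _] := Y_char.
have dG n (x : R) : is_derive x 1%R (derive1n n G) (derive1n n.+1 G x).
  by apply: DeriveDef; [exact: G_smooth|rewrite derive1nS derive1E].
(* The moments are assumed for Y1 on its own probability space; [Y_law] transports them to the law
   of Y at time 1. *)
have L2 n : sqform (distribution P (Y 1%R)) (derive1n n G) < +oo.
  have mn : measurable_fun setT (derive1n n G).
    by apply: continuous_measurable_fun; exact: deriv_continuous (dG n).
  have := G_L2 n; rewrite unlock /sqform => /(le_lt_trans _); apply.
  rewrite (@ge0_integral_law _ _ _ _ _ P0 (distribution P (Y 1%R)) Y1 _ _
    (fun x => ((derive1n n G x) ^+ 2)%:E))//.
  - by move=> E mE; have hh := Y_law E mE; exact (esym hh).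
  - exact: measurable_sqform.
  - by move=> x; rewrite lee_fin sqr_ge0.
apply: (@influence_limit_sigma_finite _ _ _ P Y Y' Y'' b sigma (levy_alias nu_levy) G alpha) => //.
- exact: (dG 0%N).
- exact: (deriv_continuous (dG 1%N)).
- exact: (L2 0%N).
- exact: (L2 1%N).
Qed.
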